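(* Let $k$ be a field, $a\ge1$ and $d\in\mathbb Z$. Let $\Pi$ be an Adams positively graded $(d+1)$-Calabi-Yau dg category over $k$ of Gorenstein parameter $a$, that is, $\Pi$ is smooth and $\mathrm{RHom}_{\Pi^e}(\Pi,\Pi^e)[d+1]\simeq\Pi(a)$ in $\mathrm{D}^{\mathbb Z}(\Pi^e)$. Suppose that $\Pi_0$ is perfect over $\Pi$ on each side. Then its $a$-th quasi-Veronese category $\Pi^{[a]}$ is a graded $(d+1)$-Calabi-Yau dg category of Gorenstein parameter $1$.
   Context: An Adams graded dg category $\mathcal X$ over $k$ is one whose morphism spaces are $\mathbb{Z}^2$-graded (cohomological degree, Adams degree) with differential of degree $(1,0)$ satisfying the Leibniz rule; $\mathcal X_i$ is the Adams degree $i$ part; positively graded means $\mathcal X_i=0$ for $i<0$. $\mathcal X^e=\mathcal X^{\mathrm{op}}\otimes_k\mathcal X$; $\mathrm{D}^{\mathbb Z}$ is the derived category of graded dg modules; $(i)$ is the Adams shift $M(i)_j=M_{i+j}$; smooth means $\mathcal X$ is perfect over $\mathcal X^e$. ''$\Pi_0$ perfect on each side'' means the modules $\Pi_0(-,X)$ and $\Pi_0(X,-)$, $X\in\Pi$, are perfect over $\Pi$ and $\Pi^{\mathrm{op}}$ respectively. A graded dg category $\Lambda$ is $n$-Calabi-Yau of Gorenstein parameter $b$ if it is smooth and $\mathrm{RHom}_{\Lambda^e}(\Lambda,\Lambda^e)[n]\simeq\Lambda(b)$ in $\mathrm{D}^{\mathbb Z}(\Lambda^e)$. For $n\ge1$ the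 $n$-th quasi-Veronese category of $\mathcal X$ is the Adams graded dg category $$\mathcal X^{[n]}=\bigoplus_{i\in\mathbb Z}\begin{pmatrix}\mathcal X_{ni}&\mathcal X_{ni-1}&\cdots&\mathcal X_{n(i-1)+1}\\ \mathcal X_{ni+1}&\mathcal X_{ni}&\cdots&\mathcal X_{n(i-1)+2}\\ \vdots&\vdots&\ddots&\vdots\\ \mathcal X_{n(i+1)-1}&\mathcal X_{n(i+1)-2}&\cdots&\mathcal X_{ni}\end{pmatrix},$$ whose objects are $n$ copies of those of $\mathcal X$, whose Adams degree $i$ part is the $i$-th summand (the $(r,c)$ entry, recording maps from copy $c$ to copy $r$, is $\mathcal X_{ni+r-c}$), and whose composition is matrix multiplication. *)

(* Defs.v *)
From HB Require Import structures.
From mathcomp Require Import all_boot all_order all_algebra.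
From mathcomp Require Import generic_quotient.
From mathcomp Require Import boolp.
From mathcomp Require Import zify ring.
Set Implicit Arguments.
Unset Strict Implicit.
Unset Printing Implicit Defensive.
Import Order.TTheory GRing.Theory Num.Theory.
Local Open Scope ring_scope.

(* A bidegree is a pair (cohomological degree, Adams degree). *)
Notation deg := (int * int)%type.
Notation delta := ((1, 0) : deg).

Definition ksg {k : fieldType} (n : int) : k := (-1) ^ n.

Section Signs.
Variable k : fieldType.

Lemma ksgD m n : ksg (m + n) = ksg m * ksg n :> k.
Proof. by rewrite /ksg expfzDr // oppr_eq0 oner_eq0. Qed.

Lemma ksg0 : ksg 0 = 1 :> k. Proof. by []. Qed.
Lemma ksg1 : ksg 1 = -1 :> k. Proof. by []. Qed.

Lemma ksgK n : ksg n * ksg n = 1 :> k.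
Proof. by rewrite /ksg -expfzMl mulrNN mulr1 exp1rz. Qed.

Lemma ksgP n : ksg n = 1 :> k \/ ksg n = -1 :> k.
Proof.
have /eqP := ksgK n; rewrite -expr2 sqrf_eq1 => /orP[]/eqP ->; by [left|right].
Qed.

Lemma deg_fstD (g h : deg) : (g + h).1 = g.1 + h.1. Proof. by []. Qed.
Lemma deg_sndD (g h : deg) : (g + h).2 = g.2 + h.2. Proof. by []. Qed.
Lemma deg_ext (g h : deg) : g.1 = h.1 -> g.2 = h.2 -> g = h.
Proof. by case: g h => a b [c d] /= -> ->. Qed.

Lemma deg_irr (g h : deg) (e e' : g = h) : e = e'.
Proof. exact: eq_irrelevance. Qed.

Section Linear.
Variables U V : lmodType k.
Variable f : U -> V.
Hypothesis lf : linear f.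

Lemma linp0 : f 0 = 0.
Proof. by have := lf (-1) 0 0; rewrite scaler0 addr0 scaleN1r addNr. Qed.
Lemma linpD u v : f (u + v) = f u + f v.
Proof. by have := lf 1 u v; rewrite !scale1r. Qed.
Lemma linpZ a u : f (a *: u) = a *: f u.
Proof. by have := lf a u 0; rewrite linp0 !addr0. Qed.
Lemma linpN u : f (- u) = - f u.
Proof. by rewrite -scaleN1r linpZ scaleN1r. Qed.
End Linear.

Lemma lin_comp (U V W : lmodType k) (f : V -> W) (g : U -> V) :
  linear f -> linear g -> linear (fun u => f (g u)).
Proof. by move=> lf lg a u v; rewrite lg lf. Qed.

Lemma lin_add (U V : lmodType k) (f g : U -> V) :
  linear f -> linear g -> linear (fun u => f u + g u).
Proof. by move=> lf lg a u v; rewrite lf lg scalerDr addrACA. Qed.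

Lemma lin_scale (U V : lmodType k) (f : U -> V) b :
  linear f -> linear (fun u => b *: f u).
Proof. by move=> lf a u v; rewrite lf scalerDr !scalerA mulrC. Qed.

End Signs.

(* Proves equalities between products of signs. *)
Ltac signs :=
  repeat match goal with
  | |- context [@ksg ?k ?n] =>
      let s := fresh "s" in
      have := ksgP k n; set s := (@ksg k n); case=> ->; clear s
  end; ring.

Ltac degs := subst; apply: deg_ext; rewrite ?deg_fstD ?deg_sndD /=; lia.

(* Adams graded dg categories.  Composition and differential carry a proof
   that the bidegree of the result is the expected one, so that no transport
   along equalities of bidegrees is ever needed. *)
Record adgcat (k : fieldType) := Adgcat {
  ob :> Type;
  hom : ob -> ob -> deg -> lmodType k;
  idm : forall x g, g = 0 -> hom x x g;
  comp : forall x y z g h l, g + h = l -> hom y z g -> hom x y h -> hom x z l;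
  dif : forall x y g g', g + delta = g' -> hom x y g -> hom x y g';
  comp_linl : forall x y z g h l (e : g + h = l) (u : hom x y h),
    linear (fun f : hom y z g => comp e f u);
  comp_linr : forall x y z g h l (e : g + h = l) (f : hom y z g),
    linear (fun u : hom x y h => comp e f u);
  dif_lin : forall x y g g' (e : g + delta = g'), linear (@dif x y g g' e);
  comp_idl : forall x y g h (e0 : g = 0) (e : g + h = h) (f : hom x y h),
    comp e (idm y e0) f = f;
  comp_idr : forall x y g h (e0 : h = 0) (e : g + h = g) (f : hom x y g),
    comp e f (idm x e0) = f;
  comp_assoc : forall w x y z g1 g2 g3 g12 g23 g
    (e12 : g1 + g2 = g12) (e : g12 + g3 = g)
    (e23 : g2 + g3 = g23) (e' : g1 + g23 = g)
    (f : hom y z g1) (u : hom x y g2) (v : hom w x g3),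
    comp e (comp e12 f u) v = comp e' f (comp e23 u v);
  dif_dif : forall x y g g' g'' (e : g + delta = g') (e' : g' + delta = g'')
    (f : hom x y g), dif e' (dif e f) = 0;
  dif_comp : forall x y z g h l g' h' l'
    (e : g + h = l) (el : l + delta = l')
    (eg : g + delta = g') (eh : h + delta = h')
    (e1 : g' + h = l') (e2 : g + h' = l')
    (f : hom y z g) (u : hom x y h),
    dif el (comp e f u)
      = comp e1 (dif eg f) u + ksg g.1 *: comp e2 f (dif eh u) }.

Definition adams_positive (k : fieldType) (A : adgcat k) :=
  forall (x y : A) (g : deg) (f : hom x y g), (g.2 < 0)%R -> f = 0.

Section Opposite.
Variables (k : fieldType) (A : adgcat k).

Lemma opp_deg (g h l : deg) : g + h = l -> h + g = l.
Proof. by rewrite addrC. Qed.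

Let ohom (x y : A) := hom y x.
Let ocomp (x y z : A) g h l (e : g + h = l) (f : ohom y z g) (u : ohom x y h) :
  ohom x z l := ksg (g.1 * h.1) *: comp (opp_deg e) u f.

Fact op_linl x y z g h l (e : g + h = l) (u : ohom x y h) :
  linear (fun f : ohom y z g => ocomp e f u).
Proof. by apply: lin_scale; apply: comp_linr. Qed.

Fact op_linr x y z g h l (e : g + h = l) (f : ohom y z g) :
  linear (fun u : ohom x y h => ocomp e f u).
Proof. by apply: lin_scale; apply: comp_linl. Qed.

Fact op_idl x y g h (e0 : g = 0) (e : g + h = h) (f : ohom x y h) :
  ocomp e (idm y e0) f = f.
Proof.
by subst g; rewrite /ocomp mul0r ksg0 scale1r comp_idr.
Qed.

Fact op_idr x y g h (e0 : h = 0) (e : g + h = g) (f : ohom x y g) :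
  ocomp e f (idm x e0) = f.
Proof.
by subst h; rewrite /ocomp mulr0 ksg0 scale1r comp_idl.
Qed.

Fact op_assoc w x y z g1 g2 g3 g12 g23 g
    (e12 : g1 + g2 = g12) (e : g12 + g3 = g)
    (e23 : g2 + g3 = g23) (e' : g1 + g23 = g)
    (f : ohom y z g1) (u : ohom x y g2) (v : ohom w x g3) :
  ocomp e (ocomp e12 f u) v = ocomp e' f (ocomp e23 u v).
Proof.
rewrite /ocomp (linpZ (comp_linr _ _)) (linpZ (comp_linl _ _)) !scalerA.
rewrite (comp_assoc _ _ (opp_deg e12) (opp_deg e)); congr (_ *: _).
subst; rewrite !deg_fstD mulrDl mulrDr !ksgD; ring.
Qed.

Fact op_leibniz x y z g h l g' h' l'
    (e : g + h = l) (el : l + delta = l')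
    (eg : g + delta = g') (eh : h + delta = h')
    (e1 : g' + h = l') (e2 : g + h' = l')
    (f : ohom y z g) (u : ohom x y h) :
    dif el (ocomp e f u)
      = ocomp e1 (dif eg f) u + ksg g.1 *: ocomp e2 f (dif eh u).
Proof.
rewrite /ocomp (linpZ (dif_lin _)) (dif_comp _ _ eh eg (opp_deg e2) (opp_deg e1)).
rewrite scalerDr addrC !scalerA; subst g' h'; rewrite !deg_fstD /=.
rewrite mulrDl mulrDr mul1r mulr1 !ksgD; congr (_ *: _ + _ *: _).
by case: (ksgP k g.1) => ->; ring.
Qed.

Definition opcat : adgcat k :=
  @Adgcat k A ohom (fun x g e => idm x e) ocomp (fun x y => @dif k A y x)
    op_linl op_linr (fun x y => @dif_lin k A y x) op_idl op_idr op_assoc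
    (fun x y => @dif_dif k A y x) op_leibniz.

Lemma opcat_positive : adams_positive A -> adams_positive opcat.
Proof. by move=> pA x y g f; apply: pA. Qed.

End Opposite.

(* The bidegree-l component of the tensor product over k of two bigraded
   vector spaces, presented by generators and relations. *)
Section Tensor.
Variables (k : fieldType) (U V : deg -> lmodType k) (l : deg).

Inductive tterm : Type :=
| TPure g h of g + h = l & U g & V h
| TZero
| TAdd of tterm & tterm
| TScale of k & tterm.

Inductive teq : tterm -> tterm -> Prop :=
| teq_refl t : teq t t
| teq_sym t u : teq t u -> teq u t
| teq_trans t u v : teq t u -> teq u v -> teq t v
| teq_add t t' u u' : teq t t' -> teq u u' -> teq (TAdd t u) (TAdd t' u')
| teq_scale a t t' : teq t t' -> teq (TScale a t) (TScale a t')
| teq_addA t u v : teq (TAdd t (TAdd u v)) (TAdd (TAdd t u) v)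
| teq_addC t u : teq (TAdd t u) (TAdd u t)
| teq_add0 t : teq (TAdd TZero t) t
| teq_addN t : teq (TAdd (TScale (-1) t) t) TZero
| teq_scaleA a b t : teq (TScale a (TScale b t)) (TScale (a * b) t)
| teq_scale1 t : teq (TScale 1 t) t
| teq_scaleDr a t u : teq (TScale a (TAdd t u)) (TAdd (TScale a t) (TScale a u))
| teq_scaleDl a b t : teq (TScale (a + b) t) (TAdd (TScale a t) (TScale b t))
| teq_linl g h (e : g + h = l) a (u u' : U g) (v : V h) :
    teq (TPure e (a *: u + u') v) (TAdd (TScale a (TPure e u v)) (TPure e u' v))
| teq_linr g h (e : g + h = l) a (u : U g) (v v' : V h) :
    teq (TPure e u (a *: v + v')) (TAdd (TScale a (TPure e u v)) (TPure e u v')).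

HB.instance Definition _ := gen_eqMixin tterm.
HB.instance Definition _ := gen_choiceMixin tterm.

Definition teqb (t u : tterm) : bool := `[< teq t u >].

Fact teqb_refl : reflexive teqb.
Proof. by move=> t; apply/asboolP; apply: teq_refl. Qed.
Fact teqb_sym : symmetric teqb.
Proof. by move=> t u; apply/asboolP/asboolP; apply: teq_sym. Qed.
Fact teqb_trans : transitive teqb.
Proof. by move=> u t v /asboolP tu /asboolP uv; apply/asboolP/(teq_trans tu). Qed.

Definition teq_equiv : equiv_rel tterm := EquivRel teqb teqb_refl teqb_sym teqb_trans.

Definition tens : Type := {eq_quot teq_equiv}%qT.
HB.instance Definition _ := Choice.on tens.
HB.instance Definition _ := EqQuotient.on tens.

Definition tclass (t : tterm) : tens := (\pi_tens t)%qT.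

Lemma tclassP t u : tclass t = tclass u <-> teq t u.
Proof.
split; first by move/eqmodP => /asboolP.
by move=> tu; apply/eqmodP/asboolP.
Qed.

Lemma trepr (x : tens) : tclass (repr x) = x.
Proof. exact: reprK. Qed.

Lemma teq_repr t : teq (repr (tclass t)) t.
Proof. by apply/tclassP; rewrite trepr. Qed.

Definition tadd (x y : tens) := tclass (TAdd (repr x) (repr y)).
Definition tscale a (x : tens) := tclass (TScale a (repr x)).
Definition tzero := tclass TZero.
Definition topp := tscale (-1).

Lemma taddE t u : tadd (tclass t) (tclass u) = tclass (TAdd t u).
Proof. by apply/tclassP; apply: teq_add; apply: teq_repr. Qed.
Lemma tscaleE a t : tscale a (tclass t) = tclass (TScale a t).
Proof. by apply/tclassP; apply: teq_scale; apply: teq_repr. Qed.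

Fact taddA : associative tadd.
Proof.
move=> x y z; rewrite -(trepr x) -(trepr y) -(trepr z) !taddE.
exact/tclassP/teq_addA.
Qed.
Fact taddC : commutative tadd.
Proof.
by move=> x y; rewrite -(trepr x) -(trepr y) !taddE; apply/tclassP/teq_addC.
Qed.
Fact tadd0 : left_id tzero tadd.
Proof. by move=> x; rewrite -(trepr x) taddE; apply/tclassP/teq_add0. Qed.
Fact taddN : left_inverse tzero topp tadd.
Proof.
by move=> x; rewrite -(trepr x) /topp tscaleE taddE; apply/tclassP/teq_addN.
Qed.
HB.instance Definition _ := GRing.isZmodule.Build tens taddA taddC tadd0 taddN.

Fact tscaleA a b (x : tens) : tscale a (tscale b x) = tscale (a * b) x.
Proof. by rewrite -(trepr x) !tscaleE; apply/tclassP/teq_scaleA. Qed.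
Fact tscale1 : left_id 1 tscale.
Proof. by move=> x; rewrite -(trepr x) !tscaleE; apply/tclassP/teq_scale1. Qed.
Lemma tclassD t u : tclass t + tclass u = tclass (TAdd t u).
Proof. exact: taddE. Qed.

Fact tscaleDr : right_distributive tscale +%R.
Proof.
move=> a x y; rewrite -(trepr x) -(trepr y) tclassD !tscaleE tclassD.
exact/tclassP/teq_scaleDr.
Qed.
Fact tscaleDl x : {morph tscale^~ x : a b / a + b}.
Proof.
by move=> a b; rewrite -(trepr x) !tscaleE tclassD; apply/tclassP/teq_scaleDl.
Qed.
HB.instance Definition _ :=
  GRing.Zmodule_isLmodule.Build k tens tscaleA tscale1 tscaleDr tscaleDl.

Definition pure g h (e : g + h = l) (u : U g) (v : V h) : tens :=
  tclass (TPure e u v).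

Lemma pure_linl g h (e : g + h = l) (v : V h) : linear (fun u => pure e u v).
Proof.
move=> a u u'; rewrite /pure; have -> : a *: tclass (TPure e u v)
  = tclass (TScale a (TPure e u v)) by exact: tscaleE.
by rewrite tclassD; apply/tclassP/teq_linl.
Qed.

Lemma pure_linr g h (e : g + h = l) (u : U g) : linear (fun v => pure e u v).
Proof.
move=> a v v'; rewrite /pure; have -> : a *: tclass (TPure e u v)
  = tclass (TScale a (TPure e u v)) by exact: tscaleE.
by rewrite tclassD; apply/tclassP/teq_linr.
Qed.

Lemma tens_ext (W : lmodType k) (f f' : tens -> W) :
    linear f -> linear f' ->
    (forall g h (e : g + h = l) u v, f (pure e u v) = f' (pure e u v)) ->
  forall x, f x = f' x.
Proof.
move=> lf lf' ff' x; rewrite -(trepr x); elim: (repr x) => {x}.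
- exact: ff'.
- by have -> : tclass TZero = 0 by []; rewrite (linp0 lf) (linp0 lf').
- by move=> t IHt u IHu; rewrite -tclassD (linpD lf) (linpD lf') IHt IHu.
- move=> a t IH; have -> : tclass (TScale a t) = a *: tclass t.
    by rewrite -tscaleE.
  by rewrite (linpZ lf) (linpZ lf') IH.
Qed.

(* The linear map out of the tensor product induced by a bilinear family. *)
Section Lift.
Variable W : lmodType k.

Definition bilin (b : forall g h, g + h = l -> U g -> V h -> W) :=
  (forall g h (e : g + h = l) v, linear (fun u => b g h e u v)) /\
  (forall g h (e : g + h = l) u, linear (fun v => b g h e u v)).

Fixpoint teval (b : forall g h, g + h = l -> U g -> V h -> W) (t : tterm) : W :=
  match t with
  | TPure g h e u v => b g h e u v
  | TZero => 0
  | TAdd t u => teval b t + teval b u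
  | TScale a t => a *: teval b t
  end.

Definition tlift b (x : tens) : W := teval b (repr x).

Lemma teval_teq b : bilin b -> forall t u, teq t u -> teval b t = teval b u.
Proof.
case=> bl br t u; elim=> {t u} //=.
- by move=> t u v _ -> _ ->.
- by move=> t t' u u' _ -> _ ->.
- by move=> a t t' _ ->.
- by move=> *; rewrite addrA.
- by move=> *; rewrite addrC.
- by move=> *; rewrite add0r.
- by move=> *; rewrite scaleN1r addNr.
- by move=> *; rewrite scalerA.
- by move=> *; rewrite scale1r.
- by move=> *; rewrite scalerDr.
- by move=> *; rewrite scalerDl.
- by move=> *; rewrite bl.
- by move=> *; rewrite br.
Qed.

Lemma tlift_class b : bilin b -> forall t, tlift b (tclass t) = teval b t.
Proof. by move=> bb t; apply: teval_teq => //; apply: teq_repr. Qed.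

Lemma tlift_pure b : bilin b -> forall g h (e : g + h = l) u v,
  tlift b (pure e u v) = b g h e u v.
Proof. by move=> bb g h e u v; rewrite tlift_class. Qed.

Lemma tlift_lin b : bilin b -> linear (tlift b).
Proof.
move=> bb a x y; rewrite -(trepr x) -(trepr y).
have -> : a *: tclass (repr x) = tclass (TScale a (repr x)) by exact: tscaleE.
by rewrite tclassD !tlift_class.
Qed.

Lemma tlift_param (P : lmodType k)
    (b : P -> forall g h, g + h = l -> U g -> V h -> W) :
    (forall g h (e : g + h = l) u v, linear (fun p => b p g h e u v)) ->
  forall x, linear (fun p => tlift (b p) x).
Proof.
move=> lb x; rewrite /tlift; elim: (repr x) => {x} /=.
- exact: lb.
- by move=> a p q; rewrite scaler0 addr0.
- by move=> t IHt u IHu; apply: lin_add.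
- by move=> a t IHt; apply: lin_scale.
Qed.

End Lift.
End Tensor.

Section TensorCat.
Variables (k : fieldType) (A B : adgcat k).

Let thom (x y : A * B) (g : deg) : lmodType k :=
  tens (hom x.1 y.1) (hom x.2 y.2) g.

Lemma tens_deg (g h l g1 g2 h1 h2 : deg) :
  g1 + g2 = g -> h1 + h2 = h -> g + h = l -> (g1 + h1) + (g2 + h2) = l.
Proof. by move=> *; degs. Qed.

Lemma tens_degl (g g' g1 g2 : deg) :
  g1 + g2 = g -> g + delta = g' -> (g1 + delta) + g2 = g'.
Proof. by move=> *; degs. Qed.

Lemma tens_degr (g g' g1 g2 : deg) :
  g1 + g2 = g -> g + delta = g' -> g1 + (g2 + delta) = g'.
Proof. by move=> *; degs. Qed.

Section Comp.
Variables (x y z : A * B) (g h l : deg) (e : g + h = l).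

Definition tcomp_pure2 g1 g2 (eg : g1 + g2 = g)
    (f : hom y.1 z.1 g1) (u : hom y.2 z.2 g2)
    h1 h2 (eh : h1 + h2 = h) (f' : hom x.1 y.1 h1) (u' : hom x.2 y.2 h2) :
    thom x z l :=
  ksg (g2.1 * h1.1) *: pure (tens_deg eg eh e)
    (comp (erefl (g1 + h1)) f f') (comp (erefl (g2 + h2)) u u').

(* (f (x) u) (f' (x) u') = (-1)^(|u||f'|) f f' (x) u u' *)
Definition tcomp (t : thom y z g) (s : thom x y h) : thom x z l :=
  tlift (fun g1 g2 eg f u => tlift (tcomp_pure2 eg f u) s) t.

Lemma tcomp_pure2_bilin g1 g2 (eg : g1 + g2 = g) f u : bilin (tcomp_pure2 eg f u).
Proof.
split=> h1 h2 eh w; apply: lin_scale.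
  apply: (lin_comp (pure_linl _ _) (comp_linr _ _)).
apply: (lin_comp (pure_linr _ _) (comp_linr _ _)).
Qed.

Lemma tcomp_bilin s :
  bilin (fun g1 g2 (eg : g1 + g2 = g) f u => tlift (tcomp_pure2 eg f u) s).
Proof.
split=> g1 g2 eg w; apply: tlift_param => h1 h2 eh f' u'; apply: lin_scale.
  apply: (lin_comp (pure_linl _ _) (comp_linl _ _)).
apply: (lin_comp (pure_linr _ _) (comp_linl _ _)).
Qed.

Fact tcomp_linl s : linear (fun t => tcomp t s).
Proof. exact: tlift_lin (tcomp_bilin s). Qed.

Fact tcomp_linr t : linear (tcomp t).
Proof.
apply: tlift_param => g1 g2 eg f u; apply: tlift_lin; exact: tcomp_pure2_bilin.
Qed.

Lemma tcompE g1 g2 (eg : g1 + g2 = g) h1 h2 (eh : h1 + h2 = h)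
    l1 l2 (e1 : g1 + h1 = l1) (e2 : g2 + h2 = l2) (el : l1 + l2 = l)
    f u f' u' :
  tcomp (pure eg f u) (pure eh f' u')
    = ksg (g2.1 * h1.1) *: pure el (comp e1 f f') (comp e2 u u').
Proof.
rewrite /tcomp (tlift_pure (tcomp_bilin _)) (tlift_pure (tcomp_pure2_bilin _ _ _)).
by subst l1 l2; rewrite /tcomp_pure2 (deg_irr (tens_deg eg eh e) el).
Qed.

End Comp.

Section Dif.
Variables (x y : A * B) (g g' : deg) (e : g + delta = g').

Definition tdif_pure g1 g2 (eg : g1 + g2 = g)
    (f : hom x.1 y.1 g1) (u : hom x.2 y.2 g2) : thom x y g' :=
  pure (tens_degl eg e) (dif (erefl (g1 + delta)) f) u +
  ksg g1.1 *: pure (tens_degr eg e) f (dif (erefl (g2 + delta)) u).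

(* d (f (x) u) = df (x) u + (-1)^|f| f (x) du *)
Definition tdif (t : thom x y g) : thom x y g' := tlift tdif_pure t.

Lemma tdif_bilin : bilin tdif_pure.
Proof.
split=> g1 g2 eg w; apply: lin_add.
- exact: (lin_comp (pure_linl _ _) (dif_lin _)).
- apply: lin_scale; exact: pure_linl.
- exact: pure_linr.
- apply: lin_scale; exact: (lin_comp (pure_linr _ _) (dif_lin _)).
Qed.

Fact tdif_lin : linear tdif.
Proof. exact: tlift_lin tdif_bilin. Qed.

Lemma tdifE g1 g2 (eg : g1 + g2 = g) g1' g2' (e1 : g1 + delta = g1')
    (e2 : g2 + delta = g2') (el : g1' + g2 = g') (er : g1 + g2' = g') f u :
  tdif (pure eg f u) = pure el (dif e1 f) u + ksg g1.1 *: pure er f (dif e2 u).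
Proof.
rewrite /tdif (tlift_pure tdif_bilin); subst g1' g2'; rewrite /tdif_pure.
by rewrite (deg_irr (tens_degl eg e) el) (deg_irr (tens_degr eg e) er).
Qed.

End Dif.

Definition tidm (x : A * B) g (e : g = 0) : thom x x g :=
  pure (etrans (addr0 (0 : deg)) (esym e)) (idm x.1 erefl) (idm x.2 erefl).

Fact tcomp_idl x y g h (e0 : g = 0) (e : g + h = h) (t : thom x y h) :
  tcomp e (tidm y e0) t = t.
Proof.
move: t; apply: tens_ext => //; first exact: tcomp_linr.
move=> h1 h2 eh f u; rewrite (tcompE _ _ _ (add0r h1) (add0r h2) eh).
by rewrite !comp_idl mul0r ksg0 scale1r.
Qed.

Fact tcomp_idr x y g h (e0 : h = 0) (e : g + h = g) (t : thom x y g) :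
  tcomp e t (tidm x e0) = t.
Proof.
move: t; apply: tens_ext => //; first exact: tcomp_linl.
move=> h1 h2 eh f u; rewrite (tcompE _ _ _ (addr0 h1) (addr0 h2) eh).
by rewrite !comp_idr mulr0 ksg0 scale1r.
Qed.

Fact tcomp_assoc w x y z g1 g2 g3 g12 g23 g
    (e12 : g1 + g2 = g12) (e : g12 + g3 = g)
    (e23 : g2 + g3 = g23) (e' : g1 + g23 = g)
    (t : thom y z g1) (s : thom x y g2) (r : thom w x g3) :
  tcomp e (tcomp e12 t s) r = tcomp e' t (tcomp e23 s r).
Proof.
move: t; apply: tens_ext.
- exact: (lin_comp (tcomp_linl _ _) (tcomp_linl _ _)).
- exact: tcomp_linl.
move=> a1 a2 ea f u; move: s; apply: tens_ext.
- exact: (lin_comp (tcomp_linl _ _) (tcomp_linr _ _)).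
- exact: (lin_comp (tcomp_linr _ _) (tcomp_linl _ _)).
move=> b1 b2 eb f' u'; move: r; apply: tens_ext.
- exact: tcomp_linr.
- exact: (lin_comp (tcomp_linr _ _) (tcomp_linr _ _)).
move=> c1 c2 ec f'' u''.
have eab : (a1 + b1) + (a2 + b2) = g12 by degs.
have ebc : (b1 + c1) + (b2 + c2) = g23 by degs.
have eabc : (a1 + b1 + c1) + (a2 + b2 + c2) = g by degs.
rewrite (tcompE e12 ea eb erefl erefl eab).
rewrite (tcompE e23 eb ec erefl erefl ebc).
rewrite (linpZ (tcomp_linl _ _)) (linpZ (tcomp_linr _ _)).
rewrite (tcompE e eab ec erefl erefl eabc).
rewrite (tcompE e' ea ebc (addrA a1 b1 c1) (addrA a2 b2 c2) eabc).
rewrite (comp_assoc _ _ (erefl (b1 + c1)) (addrA a1 b1 c1)).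
rewrite (comp_assoc _ _ (erefl (b2 + c2)) (addrA a2 b2 c2)).
rewrite !scalerA; congr (_ *: _); rewrite !deg_fstD mulrDl mulrDr !ksgD; ring.
Qed.

Fact tdif_dif x y g g' g'' (e : g + delta = g') (e' : g' + delta = g'')
    (t : thom x y g) : tdif e' (tdif e t) = 0.
Proof.
move: t; apply: (@tens_ext _ _ _ _ _ _ (fun=> 0)).
- exact: (lin_comp (tdif_lin _) (tdif_lin _)).
- by move=> a u v; rewrite scaler0 addr0.
move=> a b ea f u.
have el : (a + delta) + b = g' by degs.
have er : a + (b + delta) = g' by degs.
have ell : (a + delta + delta) + b = g'' by degs.
have elr : (a + delta) + (b + delta) = g'' by degs.
have err : a + (b + delta + delta) = g'' by degs.
rewrite (tdifE e ea erefl erefl el er).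
rewrite (linpD (tdif_lin _)) (linpZ (tdif_lin _)).
rewrite (tdifE e' el erefl erefl ell elr) (tdifE e' er erefl erefl elr err).
rewrite !dif_dif (linp0 (pure_linl _ _)) (linp0 (pure_linr _ _)).
rewrite scaler0 add0r addr0 -scalerDl.
by rewrite deg_fstD ksgD ksg1 mulrN1 addNr scale0r.
Qed.

Fact tdif_comp x y z g h l g' h' l'
    (e : g + h = l) (el : l + delta = l')
    (eg : g + delta = g') (eh : h + delta = h')
    (e1 : g' + h = l') (e2 : g + h' = l')
    (t : thom y z g) (s : thom x y h) :
    tdif el (tcomp e t s)
      = tcomp e1 (tdif eg t) s + ksg g.1 *: tcomp e2 t (tdif eh s).
Proof.
move: t; apply: tens_ext.
- exact: (lin_comp (tdif_lin _) (tcomp_linl _ _)).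
- apply: lin_add; last by apply: lin_scale; apply: tcomp_linl.
  exact: (lin_comp (tcomp_linl _ _) (tdif_lin _)).
move=> a1 a2 ea f u; move: s; apply: tens_ext.
- exact: (lin_comp (tdif_lin _) (tcomp_linr _ _)).
- apply: lin_add; first exact: tcomp_linr.
  by apply: lin_scale; apply: (lin_comp (tcomp_linr _ _) (tdif_lin _)).
move=> b1 b2 eb f' u'.
have eab : (a1 + b1) + (a2 + b2) = l by degs.
have ea1 : (a1 + delta) + a2 = g' by degs.
have ea2 : a1 + (a2 + delta) = g' by degs.
have eb1 : (b1 + delta) + b2 = h' by degs.
have eb2 : b1 + (b2 + delta) = h' by degs.
have E1 : (a1 + b1 + delta) + (a2 + b2) = l' by degs.
have E2 : (a1 + b1) + (a2 + b2 + delta) = l' by degs.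
have p1 : (a1 + delta) + b1 = a1 + b1 + delta by degs.
have p2 : (a2 + delta) + b2 = a2 + b2 + delta by degs.
have q1 : a1 + (b1 + delta) = a1 + b1 + delta by degs.
have q2 : a2 + (b2 + delta) = a2 + b2 + delta by degs.
rewrite (tcompE e ea eb erefl erefl eab) (linpZ (tdif_lin _)).
rewrite (tdifE el eab erefl erefl E1 E2).
rewrite (tdifE eg ea erefl erefl ea1 ea2) (tdifE eh eb erefl erefl eb1 eb2).
rewrite (linpD (tcomp_linl _ _)) (linpD (tcomp_linr _ _)).
rewrite (linpZ (tcomp_linl _ _)) (linpZ (tcomp_linr _ _)).
rewrite (tcompE e1 ea1 eb p1 erefl E1) (tcompE e1 ea2 eb erefl p2 E2).
rewrite (tcompE e2 ea eb1 q1 erefl E1) (tcompE e2 ea eb2 erefl q2 E2).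
rewrite (dif_comp erefl erefl erefl erefl p1 q1).
rewrite (dif_comp erefl erefl erefl erefl p2 q2).
rewrite (linpD (pure_linl _ _)) (linpZ (pure_linl _ _)).
rewrite (linpD (pure_linr _ _)) (linpZ (pure_linr _ _)).
rewrite !scalerDr !scalerA.
set X1 := pure _ _ _; set X2 := pure _ _ _; set X3 := pure _ _ _; set X4 := pure _ _ _.
rewrite -!addrA; congr (_ + _).
rewrite [in RHS]addrCA; subst g; rewrite !deg_fstD !mulrDr !mulrDl !mulr1 !mul1r !ksgD.
congr (_ *: _ + (_ *: _ + _ *: _)).
all: signs.
Qed.

Definition tenscat : adgcat k :=
  @Adgcat k (A * B)%type thom tidm tcomp tdif
    tcomp_linl tcomp_linr tdif_lin tcomp_idl tcomp_idr tcomp_assoc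
    tdif_dif tdif_comp.

End TensorCat.

Definition envcat (k : fieldType) (A : adgcat k) : adgcat k :=
  tenscat (opcat A) A.

Record dgfunctor (k : fieldType) (A B : adgcat k) := Dgfunctor {
  fob :> A -> B;
  fhom : forall (x y : A) g, hom x y g -> hom (fob x) (fob y) g;
  fhom_lin : forall x y g, linear (@fhom x y g);
  fhom_id : forall x g (e : g = 0), fhom (idm x e) = idm (fob x) e;
  fhom_comp : forall x y z g h l (e : g + h = l)
    (f : hom y z g) (u : hom x y h), fhom (comp e f u) = comp e (fhom f) (fhom u);
  fhom_dif : forall x y g g' (e : g + delta = g') (f : hom x y g),
    fhom (dif e f) = dif e (fhom f) }.

Arguments fhom {k A B} _ {x y g} _.

(* The isomorphism A^e -> (A^e)^op, f (x) u |-> (-1)^(|f||u|) u (x) f. *)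
Section EnvSwap.
Variables (k : fieldType) (A : adgcat k).
Let E := envcat A.
Let sw (x : E) : opcat E := (x.2, x.1).

Let epure (x y : E) l g h (e : g + h = l) (f : @hom k (opcat A) x.1 y.1 g)
  (u : @hom k A x.2 y.2 h) : hom x y l := pure e f u.

Let swap_pure (x y : E) l g h (e : g + h = l)
    (f : @hom k (opcat A) x.1 y.1 g) (u : @hom k A x.2 y.2 h) :
    hom (sw x) (sw y) l := ksg (g.1 * h.1) *: @epure (sw y) (sw x) l h g (opp_deg e) u f.

Let swap_hom (x y : E) l (t : hom x y l) : hom (sw x) (sw y) l :=
  tlift (@swap_pure x y l) t.

Lemma swap_bilin x y l : bilin (@swap_pure x y l).
Proof.
by split=> g h e w; apply: lin_scale; [apply: pure_linr|apply: pure_linl].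
Qed.

Fact swap_lin x y l : linear (@swap_hom x y l).
Proof. exact: tlift_lin (swap_bilin x y l). Qed.

Lemma swapE x y l g h (e : g + h = l) (e' : h + g = l)
    (f : @hom k (opcat A) x.1 y.1 g) (u : @hom k A x.2 y.2 h) :
  swap_hom (@epure x y l g h e f u)
    = ksg (g.1 * h.1) *: @epure (sw y) (sw x) l h g e' u f.
Proof.
rewrite /swap_hom /epure (tlift_pure (swap_bilin _ _ _)) /swap_pure.
by rewrite (deg_irr (opp_deg e) e').
Qed.

Lemma epureE (x y z : E) g h l (e : g + h = l)
    g1 g2 (eg : g1 + g2 = g) h1 h2 (eh : h1 + h2 = h)
    l1 l2 (e1 : g1 + h1 = l1) (e2 : g2 + h2 = l2) (el : l1 + l2 = l)
    (f : @hom k (opcat A) y.1 z.1 g1) u (f' : @hom k (opcat A) x.1 y.1 h1) u' :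
  comp e (epure eg f u) (epure eh f' u')
    = ksg (g2.1 * h1.1) *: @epure x z _ _ _ el (comp e1 f f') (comp e2 u u').
Proof. exact: tcompE. Qed.

Lemma epure_opE (x y z : E) g h l (e : g + h = l)
    g1 g2 (eg : g1 + g2 = g) h1 h2 (eh : h1 + h2 = h)
    l1 l2 (e1 : h1 + g1 = l1) (e2 : h2 + g2 = l2) (el : l1 + l2 = l)
    (f : @hom k (opcat A) z.1 y.1 g1) u (f' : @hom k (opcat A) y.1 x.1 h1) u' :
  @comp k (opcat E) x y z g h l e (@epure z y _ _ _ eg f u) (@epure y x _ _ _ eh f' u')
    = ksg (g.1 * h.1) *: (ksg (h2.1 * g1.1) *:
        @epure z x _ _ _ el (comp e1 f' f) (comp e2 u' u)).
Proof. by congr (_ *: _); apply: epureE. Qed.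

Lemma epure_dif (x y : E) g g' (e : g + delta = g')
    g1 g2 (eg : g1 + g2 = g) g1' g2' (e1 : g1 + delta = g1')
    (e2 : g2 + delta = g2') (el : g1' + g2 = g') (er : g1 + g2' = g')
    (f : @hom k (opcat A) x.1 y.1 g1) u :
  dif e (epure eg f u)
    = epure el (dif e1 f) u + ksg g1.1 *: @epure x y _ _ _ er f (dif e2 u).
Proof. exact: tdifE. Qed.

Fact swap_id x g (e : g = 0) : swap_hom (idm x e) = idm (sw x) e.
Proof.
subst g; rewrite /= /tidm.
have := @swapE x x 0 0 0 (etrans (addr0 0) (esym erefl)) (addr0 0)
  (idm x.1 erefl) (idm x.2 erefl).
by rewrite mul0r ksg0 scale1r /epure (deg_irr (addr0 0) (etrans (addr0 0) (esym erefl))).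
Qed.

Fact swap_comp x y z g h l (e : g + h = l) (f : hom y z g) (u : hom x y h) :
  swap_hom (comp e f u) = comp e (swap_hom f) (swap_hom u).
Proof.
move: f; apply: tens_ext.
- by move=> a v w; rewrite comp_linl swap_lin.
- by move=> a v w; rewrite swap_lin comp_linl.
move=> a1 a2 ea f f'; move: u; apply: tens_ext.
- by move=> a v w; rewrite comp_linr swap_lin.
- by move=> a v w; rewrite swap_lin comp_linr.
move=> b1 b2 eb u u'.
rewrite -[pure ea f f']/(@epure y z _ _ _ ea f f').
rewrite -[pure eb u u']/(@epure x y _ _ _ eb u u').
have ea' : a2 + a1 = g by degs.
have eb' : b2 + b1 = h by degs.
have E1 : (a1 + b1) + (a2 + b2) = l by degs.
have E2 : (a2 + b2) + (a1 + b1) = l by degs.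
have p1 : b1 + a1 = a1 + b1 by degs.
have p2 : b2 + a2 = a2 + b2 by degs.
rewrite (swapE _ ea') (swapE _ eb').
rewrite (linpZ (comp_linl _ _)) (linpZ (comp_linr _ _)).
rewrite (epureE e ea eb erefl erefl E1).
rewrite (linpZ (@swap_lin _ _ _)) (swapE _ E2).
rewrite (@epure_opE (sw x) (sw y) (sw z) _ _ _ e _ _ ea' _ _ eb' _ _ p2 p1 E2).
rewrite /= (deg_irr (opp_deg (erefl (a1 + b1))) p1) (deg_irr (opp_deg p2) erefl).
rewrite /epure (linpZ (pure_linl _ _)) (linpZ (pure_linr _ _)) !scalerA.
congr (_ *: _); subst g h; rewrite !deg_fstD !mulrDr !mulrDl !ksgD.
rewrite ?(mulrC b1.1 a2.1) ?(mulrC b2.1 a2.1) ?(mulrC b1.1 a1.1) ?(mulrC b2.1 a1.1).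
rewrite ?(mulrC a2.1 a1.1) ?(mulrC b2.1 b1.1).
signs.
Qed.

Fact swap_dif x y g g' (e : g + delta = g') (f : hom x y g) :
  swap_hom (dif e f) = dif e (swap_hom f).
Proof.
move: f; apply: tens_ext.
- by move=> a v w; rewrite dif_lin swap_lin.
- by move=> a v w; rewrite swap_lin dif_lin.
move=> a b ea f u; rewrite -[pure ea f u]/(@epure x y _ _ _ ea f u).
have ea' : b + a = g by degs.
have E1 : (a + delta) + b = g' by degs.
have E2 : a + (b + delta) = g' by degs.
have F1 : b + (a + delta) = g' by degs.
have F2 : (b + delta) + a = g' by degs.
rewrite (epure_dif e ea erefl erefl E1 E2) (swapE _ ea').
rewrite (linpD (@swap_lin _ _ _)) (linpZ (@swap_lin _ _ _)).
rewrite (swapE _ F1) (swapE _ F2) (linpZ (dif_lin _)).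
rewrite [dif e _](@epure_dif (sw y) (sw x) _ _ e _ _ ea' _ _ erefl erefl F2 F1).
rewrite scalerDr !scalerA [RHS]addrC; congr (_ *: _ + _ *: _).
all: rewrite !deg_fstD ?mulrDr ?mulrDl ?mulr1 ?mul1r !ksgD; signs.
Qed.

Definition env_swap : dgfunctor E (opcat E) :=
  @Dgfunctor k E (opcat E) sw swap_hom swap_lin swap_id swap_comp swap_dif.

End EnvSwap.

(* Graded dg modules are right modules: contravariant in the object. *)
Record dgmod (k : fieldType) (A : adgcat k) := Dgmod {
  mcar :> A -> deg -> lmodType k;
  act : forall x y g h l, g + h = l -> mcar y g -> hom x y h -> mcar x l;
  mdif : forall x g g', g + delta = g' -> mcar x g -> mcar x g';
  act_linl : forall x y g h l (e : g + h = l) (f : hom x y h),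
    linear (fun m : mcar y g => act e m f);
  act_linr : forall x y g h l (e : g + h = l) (m : mcar y g),
    linear (fun f : hom x y h => act e m f);
  mdif_lin : forall x g g' (e : g + delta = g'), linear (@mdif x g g' e);
  act_id : forall x g h (e0 : h = 0) (e : g + h = g) (m : mcar x g),
    act e m (idm x e0) = m;
  act_comp : forall x y z g1 g2 g3 g12 g23 g
    (e12 : g1 + g2 = g12) (e : g12 + g3 = g)
    (e23 : g2 + g3 = g23) (e' : g1 + g23 = g)
    (m : mcar z g1) (f : hom y z g2) (u : hom x y g3),
    act e (act e12 m f) u = act e' m (comp e23 f u);
  mdif_mdif : forall x g g' g'' (e : g + delta = g') (e' : g' + delta = g'')
    (m : mcar x g), mdif e' (mdif e m) = 0;
  mdif_act : forall x y g h l g' h' l'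
    (e : g + h = l) (el : l + delta = l')
    (eg : g + delta = g') (eh : h + delta = h')
    (e1 : g' + h = l') (e2 : g + h' = l')
    (m : mcar y g) (f : hom x y h),
    mdif el (act e m f)
      = act e1 (mdif eg m) f + ksg g.1 *: act e2 m (dif eh f) }.

Record dgmap (k : fieldType) (A : adgcat k) (M N : dgmod A) := Dgmap {
  dgmap_fun : forall x g, M x g -> N x g;
  dgmap_lin : forall x g, linear (@dgmap_fun x g);
  dgmap_act : forall x y g h l (e : g + h = l) (m : M y g) (f : hom x y h),
    dgmap_fun (act e m f) = act e (dgmap_fun m) f;
  dgmap_dif : forall x g g' (e : g + delta = g') (m : M x g),
    dgmap_fun (mdif e m) = mdif e (dgmap_fun m) }.

Arguments dgmap_fun {k A M N} _ {x g} _.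

Section Modules.
Variables (k : fieldType) (A : adgcat k).

Definition representable (y : A) : dgmod A :=
  @Dgmod k A (fun x g => hom x y g) (fun x z g h l e m f => comp e m f)
    (fun x g g' e => dif e)
    (fun x z => @comp_linl k A x z y) (fun x z => @comp_linr k A x z y)
    (fun x => @dif_lin k A x y)
    (fun x => @comp_idr k A x y) (fun w x z => @comp_assoc k A w x z y)
    (fun x => @dif_dif k A x y) (fun x z => @dif_comp k A x z y).

(* M[n](i) is shift M (n, i): M[n](i)_g = M_((n,i)+g) with differential
   (-1)^n d; the action of a right module is unchanged. *)
Section Shift.
Variables (M : dgmod A) (s : deg).

Lemma shift_act_deg (g h l : deg) : g + h = l -> (s + g) + h = s + l.
Proof. by move=> *; degs. Qed.

Let scar x g := M x (s + g).
Let sact x y g h l (e : g + h = l) (m : scar y g) (f : hom x y h) : scar x l :=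
  act (shift_act_deg e) m f.
Let sdif x g g' (e : g + delta = g') (m : scar x g) : scar x g' :=
  ksg s.1 *: mdif (shift_act_deg e) m.

Fact shift_linl x y g h l (e : g + h = l) (f : hom x y h) :
  linear (fun m : scar y g => sact e m f).
Proof. exact: act_linl. Qed.
Fact shift_linr x y g h l (e : g + h = l) (m : scar y g) :
  linear (fun f : hom x y h => sact e m f).
Proof. exact: act_linr. Qed.
Fact shift_dif_lin x g g' (e : g + delta = g') : linear (@sdif x g g' e).
Proof. by apply: lin_scale; apply: mdif_lin. Qed.
Fact shift_id x g h (e0 : h = 0) (e : g + h = g) (m : scar x g) :
  sact e m (idm x e0) = m.
Proof. exact: act_id. Qed.
Fact shift_comp x y z g1 g2 g3 g12 g23 g
    (e12 : g1 + g2 = g12) (e : g12 + g3 = g)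
    (e23 : g2 + g3 = g23) (e' : g1 + g23 = g)
    (m : scar z g1) (f : hom y z g2) (u : hom x y g3) :
  sact e (sact e12 m f) u = sact e' m (comp e23 f u).
Proof. exact: act_comp. Qed.
Fact shift_dif_dif x g g' g'' (e : g + delta = g') (e' : g' + delta = g'')
    (m : scar x g) : sdif e' (sdif e m) = 0.
Proof. by rewrite /sdif (linpZ (mdif_lin _)) mdif_mdif !scaler0. Qed.
Fact shift_dif_act x y g h l g' h' l'
    (e : g + h = l) (el : l + delta = l')
    (eg : g + delta = g') (eh : h + delta = h')
    (e1 : g' + h = l') (e2 : g + h' = l')
    (m : scar y g) (f : hom x y h) :
    sdif el (sact e m f)
      = sact e1 (sdif eg m) f + ksg g.1 *: sact e2 m (dif eh f).
Proof.
rewrite /sdif /sact (linpZ (act_linl _ _)).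
rewrite (mdif_act _ _ (shift_act_deg eg) eh (shift_act_deg e1) (shift_act_deg e2)).
by rewrite scalerDr scalerA deg_fstD ksgD mulrA ksgK mul1r.
Qed.

Definition shift : dgmod A :=
  @Dgmod k A scar sact sdif shift_linl shift_linr shift_dif_lin
    shift_id shift_comp shift_dif_dif shift_dif_act.

End Shift.

(* The mapping cone N (+) M[1] of f : M -> N, with differential
   (n, m) |-> (dn + f m, - dm). *)
Section Cone.
Variables (M N : dgmod A) (f : dgmap M N).

Lemma cone_act_deg (g h l : deg) : g + h = l -> (g + delta) + h = l + delta.
Proof. by move=> *; degs. Qed.

Let ccar x g : lmodType k := (N x g * M x (g + delta)%R)%type.
Let cact x y g h l (e : g + h = l) (p : ccar y g) (u : hom x y h) : ccar x l :=
  (act e p.1 u, act (cone_act_deg e) p.2 u).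
Let cdif x g g' (e : g + delta = g') (p : ccar x g) : ccar x g' :=
  (mdif e p.1 + ecast i (N x i) e (dgmap_fun f p.2), - mdif (cone_act_deg e) p.2).

Fact cone_linl x y g h l (e : g + h = l) (u : hom x y h) :
  linear (fun p : ccar y g => cact e p u).
Proof. by move=> a p q; rewrite /cact /= !act_linl. Qed.
Fact cone_linr x y g h l (e : g + h = l) (p : ccar y g) :
  linear (fun u : hom x y h => cact e p u).
Proof. by move=> a u v; rewrite /cact /= !act_linr. Qed.
Fact cone_dif_lin x g g' (e : g + delta = g') : linear (@cdif x g g' e).
Proof.
move=> a p q; rewrite /cdif; case: g' / e => /=; rewrite !mdif_lin dgmap_lin.
congr (_, _) => /=; first by rewrite scalerDr addrACA.
by rewrite scalerN opprD.
Qed.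
Fact cone_id x g h (e0 : h = 0) (e : g + h = g) (p : ccar x g) :
  cact e p (idm x e0) = p.
Proof. by rewrite /cact !act_id -surjective_pairing. Qed.
Fact cone_comp x y z g1 g2 g3 g12 g23 g
    (e12 : g1 + g2 = g12) (e : g12 + g3 = g)
    (e23 : g2 + g3 = g23) (e' : g1 + g23 = g)
    (p : ccar z g1) (w : hom y z g2) (u : hom x y g3) :
  cact e (cact e12 p w) u = cact e' p (comp e23 w u).
Proof.
rewrite /cact /= (act_comp _ _ e23 e').
by rewrite (act_comp _ _ e23 (cone_act_deg e')).
Qed.
Fact cone_dif_dif x g g' g'' (e : g + delta = g') (e' : g' + delta = g'')
    (p : ccar x g) : cdif e' (cdif e p) = 0.
Proof.
subst g' g''; rewrite /cdif /= (linpD (mdif_lin _)) mdif_mdif add0r.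
rewrite (linpN (@dgmap_lin _ _ _ _ f _ _)) (linpN (mdif_lin _)) mdif_mdif oppr0.
by rewrite dgmap_dif (deg_irr (cone_act_deg _) erefl) addrN oppr0.
Qed.
Fact cone_dif_act x y g h l g' h' l'
    (e : g + h = l) (el : l + delta = l')
    (eg : g + delta = g') (eh : h + delta = h')
    (e1 : g' + h = l') (e2 : g + h' = l')
    (p : ccar y g) (u : hom x y h) :
    cdif el (cact e p u)
      = cact e1 (cdif eg p) u + ksg g.1 *: cact e2 p (dif eh u).
Proof.
rewrite /cdif /cact /=; congr (_, _) => /=.
  rewrite (mdif_act _ _ eg eh e1 e2) (linpD (act_linl _ _)) -!addrA.
  congr (_ + _); rewrite addrC; congr (_ + _).
  rewrite dgmap_act; subst g' l l' => /=.
  by rewrite (deg_irr e1 (cone_act_deg erefl)).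
rewrite (mdif_act _ _ (cone_act_deg eg) eh (cone_act_deg e1) (cone_act_deg e2)).
rewrite (linpN (act_linl _ _)) opprD -scaleNr deg_fstD ksgD ksg1 mulrN1 opprK.
by [].
Qed.

Definition cone : dgmod A :=
  @Dgmod k A ccar cact cdif cone_linl cone_linr cone_dif_lin
    cone_id cone_comp cone_dif_dif cone_dif_act.

End Cone.
End Modules.

Section Restriction.
Variables (k : fieldType) (A B : adgcat k) (F : dgfunctor A B) (M : dgmod B).

Let ract (x y : A) g h l (e : g + h = l) (m : M (F y) g) (f : hom x y h) :
  M (F x) l := act e m (fhom F f).

Fact restr_linr x y g h l (e : g + h = l) (m : M (F y) g) :
  linear (fun f : hom x y h => ract e m f).
Proof. by move=> a f u; rewrite /ract fhom_lin act_linr. Qed.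
Fact restr_id x g h (e0 : h = 0) (e : g + h = g) (m : M (F x) g) :
  ract e m (idm x e0) = m.
Proof. by rewrite /ract fhom_id act_id. Qed.
Fact restr_comp x y z g1 g2 g3 g12 g23 g
    (e12 : g1 + g2 = g12) (e : g12 + g3 = g)
    (e23 : g2 + g3 = g23) (e' : g1 + g23 = g)
    (m : M (F z) g1) (f : hom y z g2) (u : hom x y g3) :
  ract e (ract e12 m f) u = ract e' m (comp e23 f u).
Proof. by rewrite /ract fhom_comp; apply: act_comp. Qed.
Fact restr_dif_act x y g h l g' h' l'
    (e : g + h = l) (el : l + delta = l')
    (eg : g + delta = g') (eh : h + delta = h')
    (e1 : g' + h = l') (e2 : g + h' = l')
    (m : M (F y) g) (f : hom x y h) :
    mdif el (ract e m f)
      = ract e1 (mdif eg m) f + ksg g.1 *: ract e2 m (dif eh f).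
Proof. by rewrite /ract fhom_dif; apply: mdif_act. Qed.

Definition restriction : dgmod A :=
  @Dgmod k A (fun x => M (F x)) ract (fun x => @mdif k B M (F x))
    (fun x y g h l e f => act_linl e (fhom F f)) restr_linr
    (fun x => @mdif_lin k B M (F x)) restr_id restr_comp
    (fun x => @mdif_mdif k B M (F x)) restr_dif_act.

End Restriction.

(* A-linear maps M -> N of bidegree s; these form the bidegree-s component of
   the Hom complex of M and N. *)
Section HomComplex.
Variables (k : fieldType) (A : adgcat k) (M N : dgmod A).

Record dghom (s : deg) := Dghom {
  hfun : forall x g g', s + g = g' -> M x g -> N x g';
  hfun_lin : forall x g g' (e : s + g = g'), linear (@hfun x g g' e);
  hfun_act : forall x y g h l g' l' (e : g + h = l) (eg : s + g = g')
    (el : s + l = l') (e' : g' + h = l') (m : M y g) (f : hom x y h),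
    hfun el (act e m f) = act e' (hfun eg m) f }.

Section Module.
Variable s : deg.

Lemma dghomP (f f' : dghom s) :
  (forall x g g' (e : s + g = g') (m : M x g), hfun f e m = hfun f' e m) -> f = f'.
Proof.
case: f f' => [f lf af] [f' lf' af'] /= ff'.
have E : f = f'.
  apply: functional_extensionality_dep => x.
  apply: functional_extensionality_dep => g.
  apply: functional_extensionality_dep => g'.
  apply: functional_extensionality_dep => e.
  by apply: functional_extensionality_dep => m; apply: ff'.
by subst f'; rewrite (Prop_irrelevance lf lf') (Prop_irrelevance af af').
Qed.

HB.instance Definition _ := gen_eqMixin (dghom s).
HB.instance Definition _ := gen_choiceMixin (dghom s).

Fact hzero_lin x g g' (e : s + g = g') : linear (fun _ : M x g => 0 : N x g').
Proof. by move=> a u v; rewrite scaler0 addr0. Qed.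
Fact hzero_act x y g h l g' l' (e : g + h = l) (eg : s + g = g')
    (el : s + l = l') (e' : g' + h = l') (m : M y g) (u : hom x y h) :
  0 = act e' (0 : N y g') u.
Proof. by rewrite (linp0 (act_linl _ _)). Qed.
Definition hzero : dghom s := @Dghom s (fun _ _ _ _ _ => 0) hzero_lin hzero_act.

Fact hadd_act (f f' : dghom s) x y g h l g' l' (e : g + h = l) (eg : s + g = g')
    (el : s + l = l') (e' : g' + h = l') (m : M y g) (u : hom x y h) :
  hfun f el (act e m u) + hfun f' el (act e m u)
    = act e' (hfun f eg m + hfun f' eg m) u.
Proof. by rewrite !(hfun_act _ e eg el e') (linpD (act_linl _ _)). Qed.
Definition hadd (f f' : dghom s) : dghom s :=
  @Dghom s (fun x g g' e m => hfun f e m + hfun f' e m)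
    (fun x g g' e => lin_add (hfun_lin f e) (hfun_lin f' e)) (hadd_act f f').

Fact hscale_act b (f : dghom s) x y g h l g' l' (e : g + h = l) (eg : s + g = g')
    (el : s + l = l') (e' : g' + h = l') (m : M y g) (u : hom x y h) :
  b *: hfun f el (act e m u) = act e' (b *: hfun f eg m) u.
Proof. by rewrite !(hfun_act _ e eg el e') (linpZ (act_linl _ _)). Qed.
Definition hscale b (f : dghom s) : dghom s :=
  @Dghom s (fun x g g' e m => b *: hfun f e m)
    (fun x g g' e => lin_scale b (hfun_lin f e)) (hscale_act b f).

Fact haddA : associative hadd.
Proof. by move=> f f' f''; apply: dghomP => * /=; rewrite addrA. Qed.
Fact haddC : commutative hadd.
Proof. by move=> f f'; apply: dghomP => * /=; rewrite addrC. Qed.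
Fact hadd0 : left_id hzero hadd.
Proof. by move=> f; apply: dghomP => * /=; rewrite add0r. Qed.
Fact haddN : left_inverse hzero (hscale (-1)) hadd.
Proof. by move=> f; apply: dghomP => * /=; rewrite scaleN1r addNr. Qed.
HB.instance Definition _ := GRing.isZmodule.Build (dghom s) haddA haddC hadd0 haddN.

Fact hscaleA a b f : hscale a (hscale b f) = hscale (a * b) f.
Proof. by apply: dghomP => * /=; rewrite scalerA. Qed.
Fact hscale1 : left_id 1 hscale.
Proof. by move=> f; apply: dghomP => * /=; rewrite scale1r. Qed.
Fact hscaleDr : right_distributive hscale +%R.
Proof. by move=> a f f'; apply: dghomP => * /=; rewrite scalerDr. Qed.
Fact hscaleDl f : {morph hscale^~ f : a b / a + b}.
Proof. by move=> a b; apply: dghomP => * /=; rewrite scalerDl. Qed.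
HB.instance Definition _ := GRing.Zmodule_isLmodule.Build k (dghom s)
  hscaleA hscale1 hscaleDr hscaleDl.

End Module.

Lemma hfunD s (f f' : dghom s) x g g' (e : s + g = g') (m : M x g) :
  hfun (f + f') e m = hfun f e m + hfun f' e m.
Proof. by []. Qed.
Lemma hfunZ s a (f : dghom s) x g g' (e : s + g = g') (m : M x g) :
  hfun (a *: f) e m = a *: hfun f e m.
Proof. by []. Qed.
Lemma hfun0 s x g g' (e : s + g = g') (m : M x g) : hfun (0 : dghom s) e m = 0.
Proof. by []. Qed.

(* d f = d o f - (-1)^|f| f o d *)
Section Differential.
Variables (s s' : deg) (es : s + delta = s').

Lemma hdif_degl (g g' : deg) : s' + g = g' -> (s + g) + delta = g'.
Proof. by move=> *; degs. Qed.
Lemma hdif_degr (g g' : deg) : s' + g = g' -> s + (g + delta) = g'.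
Proof. by move=> *; degs. Qed.

Let hdif_fun (f : dghom s) x g g' (e : s' + g = g') (m : M x g) : N x g' :=
  mdif (hdif_degl e) (hfun f erefl m)
    - ksg s.1 *: hfun f (hdif_degr e) (mdif erefl m).

Lemma hdif_funE (f : dghom s) x g g' (e : s' + g = g') (m : M x g)
    i (ei : s + g = i) (ei' : i + delta = g')
    j (ej : g + delta = j) (ej' : s + j = g') :
  hdif_fun f e m = mdif ei' (hfun f ei m) - ksg s.1 *: hfun f ej' (mdif ej m).
Proof.
subst i j; rewrite /hdif_fun.
by rewrite (deg_irr (hdif_degl e) ei') (deg_irr (hdif_degr e) ej').
Qed.

Fact hdif_fun_lin f x g g' (e : s' + g = g') : linear (@hdif_fun f x g g' e).
Proof.
move=> a u v; rewrite /hdif_fun !(hfun_lin, mdif_lin).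
by rewrite scalerDr opprD addrACA !scalerA scalerBr scalerA [_ * a]mulrC.
Qed.

Fact hdif_fun_act f x y g h l g' l' (e : g + h = l) (eg : s' + g = g')
    (el : s' + l = l') (e' : g' + h = l') (m : M y g) (u : hom x y h) :
  hdif_fun f el (act e m u) = act e' (hdif_fun f eg m) u.
Proof.
have p1 : s + g + h = s + l by clear hdif_fun; degs.
have p2 : s + l + delta = l' by clear hdif_fun; degs.
have p3 : s + g + delta = g' by clear hdif_fun; degs.
have p4 : s + g + (h + delta) = l' by clear hdif_fun; degs.
have p5 : g + delta + h = l + delta by clear hdif_fun; degs.
have p6 : g + (h + delta) = l + delta by clear hdif_fun; degs.
have p7 : s + (l + delta) = l' by clear hdif_fun; degs.
have p8 : s + (g + delta) = g' by clear hdif_fun; degs.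
rewrite (hdif_funE f el _ erefl p2 erefl p7) (hdif_funE f eg _ erefl p3 erefl p8).
rewrite (hfun_act f e erefl erefl p1).
rewrite (mdif_act p1 p2 p3 erefl e' p4) (mdif_act e erefl erefl erefl p5 p6).
rewrite (linpD (hfun_lin _ _)) (linpZ (hfun_lin _ _)).
rewrite (hfun_act f p5 p8 p7 e') (hfun_act f p6 erefl p7 p4).
rewrite (linpD (act_linl _ _)) (linpN (act_linl _ _)) (linpZ (act_linl _ _)).
rewrite scalerDr scalerA opprD deg_fstD ksgD.
by rewrite addrACA addrN addr0.
Qed.

Definition hdif (f : dghom s) : dghom s' :=
  @Dghom s' (hdif_fun f) (hdif_fun_lin f) (hdif_fun_act f).

Lemma hdifE (f : dghom s) x g g' (e : s' + g = g') (m : M x g)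
    i (ei : s + g = i) (ei' : i + delta = g')
    j (ej : g + delta = j) (ej' : s + j = g') :
  hfun (hdif f) e m = mdif ei' (hfun f ei m) - ksg s.1 *: hfun f ej' (mdif ej m).
Proof. exact: hdif_funE. Qed.

Fact hdif_lin : linear hdif.
Proof.
move=> a f f'; apply: dghomP => x g g' e m.
rewrite hfunD hfunZ; rewrite /= /hdif_fun !hfunD !hfunZ mdif_lin.
by rewrite !scalerDr opprD addrACA !scalerA scalerN !scalerA [_ * a]mulrC.
Qed.

End Differential.

Fact hdif_hdif s s' s'' (e : s + delta = s') (e' : s' + delta = s'') (f : dghom s) :
  hdif e' (hdif e f) = 0.
Proof.
apply: dghomP => x g g' e0 m.
have p1 : s' + g + delta = g' by degs.
have p2 : s' + (g + delta) = g' by degs.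
have p3 : s + g + delta = s' + g by degs.
have p4 : s + (g + delta) = s' + g by degs.
have p6 : s + (g + delta + delta) = g' by degs.
rewrite (hdifE e' _ _ _ erefl p1 erefl p2) (hdifE e _ _ _ erefl p3 erefl p4).
rewrite (hdifE e _ _ _ p4 p1 erefl p6).
rewrite (linpD (mdif_lin _)) (linpN (mdif_lin _)) (linpZ (mdif_lin _)).
rewrite !mdif_mdif (linp0 (hfun_lin _ _)) scaler0 subr0 add0r.
by subst s'; rewrite deg_fstD ksgD ksg1 mulrN1 scaleNr opprK addNr.
Qed.

End HomComplex.

(* Hom_A(P, A), with left action of A by postcomposition, as a right module
   over A^op: (f . a)(m) = (-1)^(|a||f|) a (f m). *)
Section Dual.
Variables (k : fieldType) (A : adgcat k) (P : dgmod A).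

Let dcar (y : opcat A) (s : deg) : lmodType k := dghom P (@representable k A y) s.

Lemma dual_deg (g h l i i' : deg) : g + h = l -> l + i = i' -> h + (g + i) = i'.
Proof. by move=> *; degs. Qed.

Section Act.
Variables (x y : opcat A) (g h l : deg) (e : g + h = l).
Variables (f : dcar y g) (a : hom x y h).

Let dact_fun (z : A) i i' (ei : l + i = i') (m : P z i) : @representable k A x z i' :=
  ksg (h.1 * g.1) *: @comp k A z y x _ _ _ (dual_deg e ei) a (hfun f erefl m).

Fact dact_lin z i i' (ei : l + i = i') : linear (@dact_fun z i i' ei).
Proof.
by move=> b u v; rewrite /dact_fun hfun_lin comp_linr scalerDr !scalerA mulrC.
Qed.

Lemma dact_funE z i i' (ei : l + i = i') (m : P z i)
    j (ej : g + i = j) (ej' : h + j = i') :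
  dact_fun ei m = ksg (h.1 * g.1) *: @comp k A z y x _ _ _ ej' a (hfun f ej m).
Proof. by subst j; rewrite /dact_fun (deg_irr (dual_deg e ei) ej'). Qed.

Fact dact_act z t i j n i' n' (ei : i + j = n) (eg : l + i = i')
    (el : l + n = n') (e' : i' + j = n') (m : P t i) (u : hom z t j) :
  dact_fun el (act ei m u) = act e' (dact_fun eg m) u.
Proof.
have p1 : g + i + j = g + n by degs.
have p2 : h + (g + i) = i' by degs.
have p3 : h + (g + n) = n' by degs.
rewrite (dact_funE el _ erefl p3) (dact_funE eg _ erefl p2).
rewrite (hfun_act f ei erefl erefl p1) /= (linpZ (comp_linl _ _)).
by rewrite (comp_assoc _ _ p1 p3).
Qed.

Definition dact : dcar x l :=
  @Dghom k A P (@representable k A x) l dact_fun dact_lin dact_act.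

Lemma dactE z i i' (ei : l + i = i') (m : P z i)
    j (ej : g + i = j) (ej' : h + j = i') :
  hfun dact ei m = ksg (h.1 * g.1) *: @comp k A z y x _ _ _ ej' a (hfun f ej m).
Proof. exact: dact_funE. Qed.

End Act.

Let ddif (x : opcat A) g g' (e : g + delta = g') (f : dcar x g) : dcar x g' :=
  hdif e f.

Fact dual_linl x y g h l (e : g + h = l) (a : hom x y h) :
  linear (fun f : dcar y g => dact e f a).
Proof.
move=> b f f'; apply: dghomP => z i i' ei m; rewrite hfunD hfunZ.
rewrite !(dactE e _ _ _ _ erefl (dual_deg e ei)) hfunD hfunZ comp_linr.
by rewrite scalerDr !scalerA mulrC.
Qed.
Fact dual_linr x y g h l (e : g + h = l) (f : dcar y g) :
  linear (fun a : hom x y h => dact e f a).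
Proof.
move=> b a a'; apply: dghomP => z i i' ei m; rewrite hfunD hfunZ.
rewrite !(dactE e _ _ _ _ erefl (dual_deg e ei)) /=.
by rewrite comp_linl scalerDr !scalerA mulrC.
Qed.
Fact dual_id x g h (e0 : h = 0) (e : g + h = g) (f : dcar x g) :
  dact e f (idm x e0) = f.
Proof.
apply: dghomP => z i i' ei m; subst h.
by rewrite (dactE e _ _ _ _ ei (add0r i')) mul0r ksg0 scale1r /= comp_idl.
Qed.
Fact dual_comp x y z g1 g2 g3 g12 g23 g
    (e12 : g1 + g2 = g12) (e : g12 + g3 = g)
    (e23 : g2 + g3 = g23) (e' : g1 + g23 = g)
    (f : dcar z g1) (a : hom y z g2) (b : hom x y g3) :
  dact e (dact e12 f a) b = dact e' f (comp e23 a b).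
Proof.
apply: dghomP => t i i' ei m.
have p1 : g12 + i = g12 + i by [].
have p2 : g3 + (g12 + i) = i' by degs.
have p3 : g2 + (g1 + i) = g12 + i by degs.
have p4 : g23 + (g1 + i) = i' by degs.
rewrite (dactE e _ _ _ _ erefl p2) (dactE e12 _ _ _ _ erefl p3).
rewrite (dactE e' _ _ _ _ erefl p4) /= (linpZ (comp_linl _ _)).
rewrite (linpZ (comp_linr _ _)) !scalerA (comp_assoc _ _ p3 p2).
congr (_ *: _); subst g12 g23; rewrite !deg_fstD !mulrDr !mulrDl !ksgD.
by rewrite (mulrC g3.1 g2.1); ring.
Qed.
Fact dual_dif_act x y g h l g' h' l'
    (e : g + h = l) (el : l + delta = l')
    (eg : g + delta = g') (eh : h + delta = h')
    (e1 : g' + h = l') (e2 : g + h' = l')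
    (f : dcar y g) (a : hom x y h) :
    ddif el (dact e f a)
      = dact e1 (ddif eg f) a + ksg g.1 *: dact e2 f (dif eh a).
Proof.
apply: dghomP => z i i' ei m; rewrite hfunD hfunZ.
have p1 : l + i + delta = i' by degs.
have p2 : l + (i + delta) = i' by degs.
have p3 : h + (g + i) = l + i by degs.
have p4 : h + (g + (i + delta)) = i' by degs.
have p5 : h + (g' + i) = i' by degs.
have p6 : h' + (g + i) = i' by degs.
have p7 : g + i + delta = g' + i by degs.
have p8 : g + (i + delta) = g' + i by degs.
rewrite (hdifE el _ _ _ erefl p1 erefl p2).
rewrite (dactE e _ _ _ _ erefl p3) (dactE e _ _ _ _ p8 p5).
rewrite (dactE e1 _ _ _ _ erefl p5) (dactE e2 _ _ _ _ erefl p6).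
rewrite (hdifE eg _ _ _ erefl p7 erefl p8).
rewrite /= (linpZ (dif_lin _)) (dif_comp p3 p1 eh p7 p6 p5).
rewrite (linpD (comp_linr _ _)) (linpN (comp_linr _ _)) (linpZ (comp_linr _ _)).
set X1 := comp _ _ _; set X2 := comp _ _ _; set X3 := comp _ _ _.
rewrite !scalerDr !scalerN !scalerA [RHS]addrC addrA -!scaleNr.
subst l g' h'; rewrite !deg_fstD !mulrDr !mulrDl mulr1 mul1r !ksgD.
by congr (_ *: _ + _ *: _ + _ *: _); signs.
Qed.

Definition dual : dgmod (opcat A) :=
  @Dgmod k (opcat A) dcar (fun x y g h l e f a => dact e f a) ddif
    dual_linl dual_linr (fun x g g' e => hdif_lin e) dual_id dual_comp
    (fun x g g' g'' e e' f => hdif_hdif e e' f) dual_dif_act.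

End Dual.

Section Derived.
Variables (k : fieldType) (A : adgcat k).
Implicit Types L M N P : dgmod A.

Definition closed M x g (m : M x g) := mdif (erefl (g + delta)) m = 0.
Definition exact M x g (m : M x g) :=
  exists (g0 : deg) (e : g0 + delta = g) (m0 : M x g0), m = mdif e m0.

Definition acyclic M := forall x g (m : M x g), closed m -> exact m.

(* The map induced on cohomology is injective and surjective. *)
Definition quasi_iso M N (f : dgmap M N) := forall x g,
  (forall m : M x g, closed m -> exact (dgmap_fun f m) -> exact m) /\
  (forall n : N x g, closed n ->
     exists2 m : M x g, closed m & exact (n - dgmap_fun f m)).

(* The derived category: the Gabriel-Zisman localization of the category of
   graded dg modules at the quasi-isomorphisms. *)
Inductive dhom : dgmod A -> dgmod A -> Type :=
| Dmap M N of dgmap M N : dhom M N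
| Dinv M N (f : dgmap M N) of quasi_iso f : dhom N M
| Did M : dhom M M
| Dcomp L M N of dhom M N & dhom L M : dhom L N.

Inductive deq : forall M N, dhom M N -> dhom M N -> Prop :=
| deq_refl M N (a : dhom M N) : deq a a
| deq_sym M N (a b : dhom M N) : deq a b -> deq b a
| deq_trans M N (a b c : dhom M N) : deq a b -> deq b c -> deq a c
| deq_comp L M N (a a' : dhom M N) (b b' : dhom L M) :
    deq a a' -> deq b b' -> deq (Dcomp a b) (Dcomp a' b')
| deq_compA L M N P (a : dhom N P) (b : dhom M N) (c : dhom L M) :
    deq (Dcomp a (Dcomp b c)) (Dcomp (Dcomp a b) c)
| deq_idl M N (a : dhom M N) : deq (Dcomp (Did N) a) a
| deq_idr M N (a : dhom M N) : deq (Dcomp a (Did M)) a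
| deq_map_id M (f : dgmap M M) :
    (forall x g (m : M x g), dgmap_fun f m = m) -> deq (Dmap f) (Did M)
| deq_map_comp L M N (f : dgmap M N) (g : dgmap L M) (h : dgmap L N) :
    (forall x i (m : L x i), dgmap_fun h m = dgmap_fun f (dgmap_fun g m)) ->
    deq (Dmap h) (Dcomp (Dmap f) (Dmap g))
| deq_invl M N (f : dgmap M N) (qf : quasi_iso f) :
    deq (Dcomp (Dinv qf) (Dmap f)) (Did M)
| deq_invr M N (f : dgmap M N) (qf : quasi_iso f) :
    deq (Dcomp (Dmap f) (Dinv qf)) (Did N).

Definition derived_iso M N :=
  exists (a : dhom M N) (b : dhom N M),
    deq (Dcomp b a) (Did M) /\ deq (Dcomp a b) (Did N).

(* The thick subcategory generated by the shifts of the representables. *)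
Inductive perfect : dgmod A -> Prop :=
| perfect_zero M : (forall x g (m : M x g), m = 0) -> perfect M
| perfect_representable y s : perfect (shift (representable y) s)
| perfect_cone M N (f : dgmap M N) : perfect M -> perfect N -> perfect (cone f)
| perfect_retract M N (i : dhom N M) (r : dhom M N) :
    deq (Dcomp r i) (Did N) -> perfect M -> perfect N.

Definition kprojective P := forall N, acyclic N ->
  forall s (f : dghom P N s), hdif (erefl (s + delta)) f = 0 ->
  exists (s0 : deg) (e : s0 + delta = s) (f0 : dghom P N s0), f = hdif e f0.

Definition kprojective_resolution P M :=
  kprojective P /\ exists q : dgmap P M, quasi_iso q.

End Derived.

(* A as a module over A^e: its value at (x, y) is A(y, x), and
   m (f (x) u) = (-1)^(|f||m|) f m u. *)
Section Diagonal.
Variables (k : fieldType) (A : adgcat k).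
Let E := envcat A.

Lemma diag_deg (g h l h1 h2 : deg) :
  h1 + h2 = h -> g + h = l -> h1 + (g + h2) = l.
Proof. by move=> *; degs. Qed.

Let bcar (x : E) (g : deg) : lmodType k := @hom k A x.2 x.1 g.

Let bact_pure (x y : E) g h l (e : g + h = l) (m : bcar y g) h1 h2
    (eh : h1 + h2 = h) (f : @hom k A y.1 x.1 h1) (u : @hom k A x.2 y.2 h2) :
  bcar x l :=
  ksg (h1.1 * g.1) *: comp (diag_deg eh e) f (comp (erefl (g + h2)) m u).

Let bact (x y : E) g h l (e : g + h = l) (m : bcar y g) (t : @hom k E x y h) :
  bcar x l := tlift (bact_pure e m) t.

Lemma bact_bilin x y g h l (e : g + h = l) (m : bcar y g) :
  bilin (@bact_pure x y g h l e m).
Proof.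
split=> h1 h2 eh w; apply: lin_scale; first exact: comp_linl.
exact: (lin_comp (comp_linr _ _) (comp_linr _ _)).
Qed.

Lemma bactE (x y : E) g h l (e : g + h = l) (m : bcar y g) h1 h2 (eh : h1 + h2 = h)
    (f : @hom k A y.1 x.1 h1) (u : @hom k A x.2 y.2 h2)
    j (ej : g + h2 = j) (ej' : h1 + j = l) :
  @bact x y g h l e m (@pure k (@hom k (opcat A) x.1 y.1) (@hom k A x.2 y.2) h h1 h2 eh f u)
    = ksg (h1.1 * g.1) *: comp ej' f (comp ej m u).
Proof.
rewrite /bact (tlift_pure (@bact_bilin x y _ _ _ e m)) /bact_pure; subst j.
by rewrite (deg_irr (diag_deg eh e) ej').
Qed.

Fact diag_linl x y g h l (e : g + h = l) (t : @hom k E x y h) :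
  linear (fun m : bcar y g => bact e m t).
Proof.
apply: tlift_param => h1 h2 eh f u; apply: lin_scale.
exact: (lin_comp (comp_linr _ _) (comp_linl _ _)).
Qed.
Fact diag_linr x y g h l (e : g + h = l) (m : bcar y g) :
  linear (fun t : @hom k E x y h => bact e m t).
Proof. exact: tlift_lin (@bact_bilin x y _ _ _ e m). Qed.
Fact diag_id x g h (e0 : h = 0) (e : g + h = g) (m : bcar x g) :
  bact e m (idm x e0) = m.
Proof.
subst h; rewrite (@bactE x x _ _ _ _ _ _ _ _ _ _ g (addr0 g) (add0r g)).
by rewrite mul0r ksg0 scale1r comp_idr /= comp_idl.
Qed.
Fact diag_comp x y z g1 g2 g3 g12 g23 g
    (e12 : g1 + g2 = g12) (e : g12 + g3 = g)
    (e23 : g2 + g3 = g23) (e' : g1 + g23 = g)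
    (m : bcar z g1) (t : @hom k E y z g2) (s : @hom k E x y g3) :
  bact e (bact e12 m t) s = bact e' m (comp e23 t s).
Proof.
move: t; apply: tens_ext.
- by move=> a v w; rewrite diag_linr diag_linl.
- by move=> a v w; rewrite comp_linl diag_linr.
move=> b1 b2 eb f u; move: s; apply: tens_ext.
- exact: diag_linr.
- by move=> a v w; rewrite comp_linr diag_linr.
move=> c1 c2 ec f' u'.
have p1 : b1 + (g1 + b2) = g12 by degs.
have p2 : c1 + (g12 + c2) = g by degs.
have p3 : c1 + b1 = b1 + c1 by degs.
have p4 : (b1 + c1) + (b2 + c2) = g23 by degs.
have p5 : (b1 + c1) + (g1 + (b2 + c2)) = g by degs.
have p6 : b1 + (g1 + (b2 + c2)) = g12 + c2 by degs.
have p7 : g1 + b2 + c2 = g1 + (b2 + c2) by degs.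
rewrite [comp e23 _ _](tcompE e23 eb ec erefl erefl p4).
rewrite (@bactE y z _ _ _ e12 m _ _ eb f u _ erefl p1).
rewrite (linpZ (diag_linl _ _)) (linpZ (diag_linr _ _)).
rewrite (@bactE x y _ _ _ e _ _ _ ec _ _ _ erefl p2).
rewrite (@bactE x z _ _ _ e' _ _ _ p4 _ _ _ erefl p5) /=.
rewrite (deg_irr (opp_deg erefl) p3) (linpZ (comp_linl _ _)) !scalerA.
rewrite (comp_assoc p1 erefl p7 p6) (comp_assoc _ p7 erefl erefl).
rewrite -(comp_assoc p3 p5 p6 p2).
congr (_ *: _); subst g12 g23 g2; rewrite !deg_fstD !mulrDr !mulrDl !ksgD.
by rewrite (mulrC b2.1 c1.1) (mulrC b1.1 c1.1); signs.
Qed.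
Fact diag_dif_act x y g h l g' h' l'
    (e : g + h = l) (el : l + delta = l')
    (eg : g + delta = g') (eh : h + delta = h')
    (e1 : g' + h = l') (e2 : g + h' = l')
    (m : bcar y g) (t : @hom k E x y h) :
    dif el (bact e m t)
      = bact e1 (dif eg m) t + ksg g.1 *: bact e2 m (dif eh t).
Proof.
move: t; apply: tens_ext.
- by move=> a v w; rewrite diag_linr dif_lin.
- move=> a v w; rewrite !diag_linr dif_lin diag_linr !scalerDr !scalerA addrACA.
  by rewrite [_ * a]mulrC.
move=> a1 a2 ea f u.
have p1 : (a1 + delta) + a2 = h' by degs.
have p2 : a1 + (a2 + delta) = h' by degs.
have q0 : a1 + (g + a2) = l by degs.
have q1 : (a1 + delta) + (g + a2) = l' by degs.
have q2 : a1 + (g' + a2) = l' by degs.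
have q3 : g + (a2 + delta) = g' + a2 by degs.
have q4 : g + a2 + delta = g' + a2 by degs.
rewrite [dif eh _](tdifE eh ea erefl erefl p1 p2).
rewrite (linpD (diag_linr _ _)) (linpZ (diag_linr _ _)).
rewrite (@bactE x y _ _ _ e m _ _ ea f u _ erefl q0).
rewrite (@bactE x y _ _ _ e1 _ _ _ ea f u _ erefl q2).
rewrite (@bactE x y _ _ _ e2 m _ _ p1 _ _ _ erefl q1).
rewrite (@bactE x y _ _ _ e2 m _ _ p2 _ _ _ q3 q2).
rewrite (linpZ (dif_lin _)) (dif_comp q0 el erefl q4 q1 q2).
rewrite (dif_comp erefl q4 eg erefl erefl q3) (linpD (comp_linr _ _)).
rewrite (linpZ (comp_linr _ _)) /= !scalerDr !scalerA.
set X1 := comp _ _ _; set X2 := comp _ _ _; set X3 := comp _ _ _.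
rewrite addrCA; subst l g' h'; rewrite !deg_fstD !mulrDr !mulrDl ?mulr1 ?mul1r !ksgD.
by congr (_ *: _ + (_ *: _ + _ *: _)); signs.
Qed.

Definition diagonal : dgmod E :=
  @Dgmod k E bcar bact (fun x g g' e => dif e) diag_linl diag_linr
    (fun x => @dif_lin k A x.2 x.1) diag_id diag_comp
    (fun x => @dif_dif k A x.2 x.1) diag_dif_act.

End Diagonal.

Definition smooth (k : fieldType) (A : adgcat k) := perfect (diagonal A).

(* For P a module over A^e, the bimodule Hom_{A^e}(P, A^e), seen as a right
   module over A^e through the isomorphism A^e = (A^e)^op. *)
Definition bimod_dual (k : fieldType) (A : adgcat k) (P : dgmod (envcat A)) :
  dgmod (envcat A) := restriction (env_swap A) (dual P).

(* RHom_{A^e}(A, A^e) is computed as Hom_{A^e}(P, A^e) for a K-projective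
   resolution P of A. *)
Definition calabi_yau (k : fieldType) (A : adgcat k) (n b : int) :=
  smooth A /\
  exists P : dgmod (envcat A),
    kprojective_resolution P (diagonal A) /\
    derived_iso (shift (bimod_dual P) (n, 0)) (shift (diagonal A) (0, b)).

(* The Adams degree 0 part of a positively graded A, as modules over A through
   the projection A -> A_0: the elements of Adams degree 0 of A(-, y), on which
   morphisms of non-zero Adams degree act by 0. *)
Section ZeroSub.
Variables (k : fieldType) (V : lmodType k) (b : bool).

Definition zero_pred : {pred V} := [pred v | b || (v == 0)].

Fact zero_pred_closed : submod_closed zero_pred.
Proof.
split=> [|a u v]; rewrite !inE ?eqxx ?orbT //.
by case: b => //= /eqP -> /eqP ->; rewrite scaler0 addr0.
Qed.
HB.instance Definition _ := GRing.isSubmodClosed.Build k V zero_pred zero_pred_closed.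

(* V if b holds, and 0 otherwise *)
Record zero_sub := ZeroSub { zval : V; _ : zval \in zero_pred }.
HB.instance Definition _ := [isSub for zval].
HB.instance Definition _ := [Choice of zero_sub by <:].
HB.instance Definition _ := [SubChoice_isSubLmodule of zero_sub by <:].

Lemma zvalP (u v : zero_sub) : zval u = zval v -> u = v.
Proof. exact: val_inj. Qed.
Lemma zval_case (u : zero_sub) : b \/ zval u = 0.
Proof. by case: u => u /= /orP[|/eqP]; [left | right]. Qed.

End ZeroSub.

Section ZeroPart.
Variables (k : fieldType) (A : adgcat k) (posA : adams_positive A) (y : A).

Let zcar (x : A) (g : deg) : lmodType k := zero_sub (hom x y g) (g.2 == 0).

Lemma zcarD x g (u v : zcar x g) : zval (u + v) = zval u + zval v.
Proof. by []. Qed.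
Lemma zcarZ x g a (u : zcar x g) : zval (a *: u) = a *: zval u.
Proof. by []. Qed.

Fact zact_subproof (x z : A) g h l (e : g + h = l) (m : zcar z g) (f : hom x z h) :
  (if h.2 == 0 then comp e (zval m) f else 0) \in @zero_pred k (hom x y l) (l.2 == 0).
Proof.
rewrite inE; case: (h.2 =P 0) => h0; last by rewrite eqxx orbT.
apply/orP; subst l; rewrite deg_sndD h0 addr0.
have [|m0] := zval_case m; [by left | right].
by rewrite m0 (linp0 (comp_linl _ _)).
Qed.

Let zact (x z : A) g h l (e : g + h = l) (m : zcar z g) (f : hom x z h) : zcar x l :=
  ZeroSub (zact_subproof e m f).

Fact zdif_subproof (x : A) g g' (e : g + delta = g') (m : zcar x g) :
  dif e (zval m) \in @zero_pred k (hom x y g') (g'.2 == 0).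
Proof.
rewrite inE; apply/orP; subst g'; rewrite deg_sndD addr0.
have [|m0] := zval_case m; [by left | right].
by rewrite m0 (linp0 (dif_lin _)).
Qed.

Let zdif (x : A) g g' (e : g + delta = g') (m : zcar x g) : zcar x g' :=
  ZeroSub (zdif_subproof e m).

Fact zero_linl x z g h l (e : g + h = l) (f : hom x z h) :
  linear (fun m : zcar z g => zact e m f).
Proof.
move=> a m m'; apply: zvalP; rewrite zcarD zcarZ /=.
by case: ifP => _; rewrite ?comp_linl // scaler0 addr0.
Qed.
Fact zero_linr x z g h l (e : g + h = l) (m : zcar z g) :
  linear (fun f : hom x z h => zact e m f).
Proof.
move=> a f f'; apply: zvalP; rewrite zcarD zcarZ /=.
by case: ifP => _; rewrite ?comp_linr // scaler0 addr0.
Qed.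
Fact zero_dif_lin x g g' (e : g + delta = g') : linear (@zdif x g g' e).
Proof.
by move=> a f f'; apply: zvalP; rewrite zcarD zcarZ /= dif_lin.
Qed.
Fact zero_id x g h (e0 : h = 0) (e : g + h = g) (m : zcar x g) :
  zact e m (idm x e0) = m.
Proof. by apply: zvalP; rewrite /= comp_idr; subst h. Qed.
Fact zero_comp x z w g1 g2 g3 g12 g23 g
    (e12 : g1 + g2 = g12) (e : g12 + g3 = g)
    (e23 : g2 + g3 = g23) (e' : g1 + g23 = g)
    (m : zcar w g1) (f : hom z w g2) (u : hom x z g3) :
  zact e (zact e12 m f) u = zact e' m (comp e23 f u).
Proof.
apply: zvalP => /=.
case: (ltrP g2.2 0) => [n2|p2].
  rewrite (posA f n2) (linp0 (comp_linl _ _)) !(linp0 (comp_linr _ _)).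
  by rewrite !if_same (linp0 (comp_linl _ _)) if_same.
case: (ltrP g3.2 0) => [n3|p3].
  by rewrite (posA u n3) !(linp0 (comp_linr _ _)) !if_same.
have -> : (g23.2 == 0) = (g2.2 == 0) && (g3.2 == 0) by subst g23; rewrite paddr_eq0.
case: (g2.2 == 0); case: (g3.2 == 0) => //=; first exact: comp_assoc.
exact: (linp0 (comp_linl _ _)).
Qed.
Fact zero_dif_dif x g g' g'' (e : g + delta = g') (e' : g' + delta = g'')
    (m : zcar x g) : zdif e' (zdif e m) = 0.
Proof. by apply: zvalP; rewrite /= dif_dif. Qed.
Fact zero_dif_act x z g h l g' h' l'
    (e : g + h = l) (el : l + delta = l')
    (eg : g + delta = g') (eh : h + delta = h')
    (e1 : g' + h = l') (e2 : g + h' = l')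
    (m : zcar z g) (f : hom x z h) :
    zdif el (zact e m f)
      = zact e1 (zdif eg m) f + ksg g.1 *: zact e2 m (dif eh f).
Proof.
apply: zvalP; rewrite zcarD zcarZ /=.
have -> : h'.2 = h.2 by subst h'; rewrite deg_sndD addr0.
case: ifP => _; first exact: dif_comp.
by rewrite (linp0 (dif_lin _)) scaler0 addr0.
Qed.

Definition zero_part : dgmod A :=
  @Dgmod k A zcar zact zdif zero_linl zero_linr zero_dif_lin
    zero_id zero_comp zero_dif_dif zero_dif_act.

End ZeroPart.

(* Pi_0(-, X) is perfect over Pi and Pi_0(X, -) is perfect over Pi^op. *)
Definition zero_part_perfect (k : fieldType) (A : adgcat k)
    (posA : adams_positive A) :=
  (forall x : A, perfect (zero_part posA x)) /\
  (forall x : A, @perfect k (opcat A) (zero_part (opcat_positive posA) x)).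

Section QuasiVeronese.
Variables (k : fieldType) (n : nat) (A : adgcat k).

Definition vdeg (r c : 'I_n) (g : deg) : deg :=
  (g.1, n%:Z * g.2 + (r : nat)%:Z - (c : nat)%:Z).

Lemma vdeg0 (c : 'I_n) (g : deg) : g = 0 -> vdeg c c g = 0.
Proof. by move=> ->; apply: deg_ext; rewrite //= mulr0 add0r subrr. Qed.

Lemma vdegD (r s c : 'I_n) (g h l : deg) :
  g + h = l -> vdeg s r g + vdeg r c h = vdeg s c l.
Proof.
by move=> <-; apply: deg_ext => //; rewrite deg_sndD /vdeg /= mulrDr; lia.
Qed.

Lemma vdeg_delta (r c : 'I_n) (g g' : deg) :
  g + delta = g' -> vdeg r c g + delta = vdeg r c g'.
Proof.
by move=> <-; apply: deg_ext => //; rewrite deg_sndD /vdeg /= !addr0.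
Qed.

Let vob : Type := (A * 'I_n)%type.
Let vhom (x y : vob) (g : deg) : lmodType k := hom x.1 y.1 (vdeg y.2 x.2 g).
Let vidm (x : vob) g (e : g = 0) : vhom x x g := idm x.1 (vdeg0 x.2 e).
Let vcomp (x y z : vob) g h l (e : g + h = l) (f : vhom y z g) (u : vhom x y h) :
  vhom x z l := comp (vdegD y.2 z.2 x.2 e) f u.
Let vdif (x y : vob) g g' (e : g + delta = g') (f : vhom x y g) : vhom x y g' :=
  dif (vdeg_delta y.2 x.2 e) f.

Fact ver_idl x y g h (e0 : g = 0) (e : g + h = h) (f : vhom x y h) :
  vcomp e (vidm y e0) f = f.
Proof. exact: comp_idl. Qed.
Fact ver_idr x y g h (e0 : h = 0) (e : g + h = g) (f : vhom x y g) :
  vcomp e f (vidm x e0) = f.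
Proof. exact: comp_idr. Qed.
Fact ver_assoc w x y z g1 g2 g3 g12 g23 g
    (e12 : g1 + g2 = g12) (e : g12 + g3 = g)
    (e23 : g2 + g3 = g23) (e' : g1 + g23 = g)
    (f : vhom y z g1) (u : vhom x y g2) (v : vhom w x g3) :
  vcomp e (vcomp e12 f u) v = vcomp e' f (vcomp e23 u v).
Proof. exact: comp_assoc. Qed.
Fact ver_dif_dif x y g g' g'' (e : g + delta = g') (e' : g' + delta = g'')
    (f : vhom x y g) : vdif e' (vdif e f) = 0.
Proof. exact: dif_dif. Qed.
Fact ver_dif_comp x y z g h l g' h' l'
    (e : g + h = l) (el : l + delta = l')
    (eg : g + delta = g') (eh : h + delta = h')
    (e1 : g' + h = l') (e2 : g + h' = l')
    (f : vhom y z g) (u : vhom x y h) :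
    vdif el (vcomp e f u)
      = vcomp e1 (vdif eg f) u + ksg g.1 *: vcomp e2 f (vdif eh u).
Proof. exact: dif_comp. Qed.

(* The object (x, c) is the c-th copy of x; maps of Adams degree i from copy c
   to copy r are the maps of A of Adams degree n i + r - c. *)
Definition quasi_veronese : adgcat k :=
  @Adgcat k vob vhom vidm vcomp vdif
    (fun x y z g h l e u => comp_linl _ u) (fun x y z g h l e f => comp_linr _ f)
    (fun x y g g' e => dif_lin _) ver_idl ver_idr ver_assoc
    ver_dif_dif ver_dif_comp.

End QuasiVeronese.

(* Main.v *)
Require Import Defs.
From HB Require Import structures.
From mathcomp Require Import all_boot all_order all_algebra.
From mathcomp Require Import boolp zify.
Import Defs.
Set Implicit Arguments.
Unset Strict Implicit.
Unset Printing Implicit Defensive.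
Import Order.TTheory GRing.Theory Num.Theory.
Local Open Scope ring_scope.

(* Write A = Pi, B = A^[n].  A graded A^e-module is a Z-equivariant bimodule
   over the category of twists (x, i) of objects of A, and a graded B^e-module
   is an nZ-equivariant one; forgetting equivariance gives an exact functor
   V, (VM)((x,c),(y,r))_g = M(x,y)_(n g + c - r), from graded A^e-modules to
   graded B^e-modules, with V(A) = B and V(M(n)) = V(M)(1).  Each graded Hom
   space of A^e is a sum of n Hom spaces of B^e, because the Adams degree of the
   first tensor factor has a residue mod n.  Hence V sends a representable to a
   sum of n representables, so it preserves perfect modules; it has an exact
   right adjoint (coinduction, a product over n lifts), so it preserves
   K-projectives; and Hom_{B^e}(VP, B^e) = V Hom_{A^e}(P, A^e).  Applying V to
   RHom_{A^e}(A, A^e)[d] = A(n b) gives the same equation for B, with b. *)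

(** * Generalities on dg modules *)

(** The obstacle is that lifting an object and a degree of A^e to B^e determines them only up to
    propositional equality. All that V needs is therefore isolated in the record [adams_cover]:
    weights on objects, embeddings [chom] and projections [rhom] between Hom spaces. Only its
    instance [env_cover] looks inside the enveloping categories. An object T and a bidegree G have
    exactly n lifts, one for each index, and a Hom space of A^e splits in two ways. Splitting over
    the lifts of its target yields the pullback of representables and makes coinduction a module.
    Splitting over the lifts of its source says that coinduction sends the representable of B^e at X
    to that of A^e at the image of X; combined with the adjunction, this is the statement on duals.
    For K-projectivity, a closed map from VP to an acyclic N is transposed, becomes a boundary
    because coinduction preserves acyclicity, and the bounding map is transposed back. Cohomological
    degrees are never changed, so all Koszul signs agree on the two sides. *)

Section LinearSums.
Variables (k : fieldType) (U V : lmodType k).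

Lemma linp_sum (f : U -> V) (lf : linear f) (I : Type) (r : seq I) (P : pred I) (F : I -> U) :
  f (\sum_(i <- r | P i) F i) = \sum_(i <- r | P i) f (F i).
Proof. exact: (big_morph f (linpD lf) (linp0 lf)). Qed.

Lemma lin_sum (I : Type) (r : seq I) (P : pred I) (f : I -> U -> V) :
  (forall i, linear (f i)) -> linear (fun u => \sum_(i <- r | P i) f i u).
Proof.
move=> lf a u v; rewrite scaler_sumr -big_split /=.
by apply: eq_bigr => i _; apply: lf.
Qed.

End LinearSums.

Section Morphisms.
Variables (k : fieldType) (A : adgcat k).
Implicit Types L M N : dgmod A.

Definition mcast M x g g' (e : g = g') (m : M x g) : M x g' := ecast i (M x i) e m.

Lemma mcast_lin M x g g' (e : g = g') : linear (@mcast M x g g' e).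
Proof. by case: g' / e. Qed.

Lemma mcast_id M x g (e : g = g) (m : M x g) : mcast e m = m.
Proof. by rewrite (deg_irr e erefl). Qed.

Lemma mcastK M x g g' (e : g = g') : cancel (@mcast M x g g' e) (mcast (esym e)).
Proof. by case: g' / e. Qed.

Lemma mcastKV M x g g' (e : g = g') : cancel (mcast (esym e)) (@mcast M x g g' e).
Proof. by case: g' / e. Qed.

Lemma mcast_bij M x g g' (e : g = g') : bijective (@mcast M x g g' e).
Proof. exact: Bijective (mcastK e) (mcastKV e). Qed.

Lemma mcast_act M x y g g' h l l' (e : g = g') (e1 : g' + h = l') (e2 : g + h = l)
    (el : l = l') (m : M y g) (f : hom x y h) :
  act e1 (mcast e m) f = mcast el (act e2 m f).
Proof. by case: g' / e e1; case: l' / el => e1; rewrite /= (deg_irr e1 e2). Qed.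

Lemma mcast_dif M x g g' l l' (e : g = g') (e1 : g' + delta = l') (e2 : g + delta = l)
    (el : l = l') (m : M x g) :
  mdif e1 (mcast e m) = mcast el (mdif e2 m).
Proof. by case: g' / e e1; case: l' / el => e1; rewrite /= (deg_irr e1 e2). Qed.

Lemma mcast_fun M N (f : dgmap M N) x g g' (e : g = g') (m : M x g) :
  dgmap_fun f (mcast e m) = mcast e (dgmap_fun f m).
Proof. by case: g' / e. Qed.

Definition dgcomp L M N (f : dgmap M N) (g : dgmap L M) : dgmap L N.
Proof.
refine (@Dgmap k A L N (fun x i m => dgmap_fun f (dgmap_fun g m)) _ _ _).
- by move=> x i; apply: (lin_comp (dgmap_lin f (g:=i)) (dgmap_lin g (g:=i))).
- by move=> *; rewrite !dgmap_act.
- by move=> *; rewrite !dgmap_dif.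
Defined.

Definition dgshift M N (f : dgmap M N) s : dgmap (shift M s) (shift N s).
Proof.
refine (@Dgmap k A (shift M s) (shift N s) (fun x i m => dgmap_fun f m) _ _ _).
- by move=> x i a u v; rewrite dgmap_lin.
- by move=> *; rewrite /= dgmap_act.
- by move=> *; rewrite /= (linpZ (@dgmap_lin _ _ _ _ f _ _)) dgmap_dif.
Defined.

Definition bij_dgmap M N (f : dgmap M N) :=
  forall x g, bijective (@dgmap_fun k A M N f x g).

Lemma bij_dgshift M N (f : dgmap M N) s : bij_dgmap f -> bij_dgmap (dgshift f s).
Proof. by move=> bf x i; apply: bf. Qed.

Lemma closedE M x g g' (e : g + delta = g') (m : M x g) : closed m <-> mdif e m = 0.
Proof. by case: g' / e. Qed.

Lemma exactD M x g (m m' : M x g) : exact m -> exact m' -> exact (m + m').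
Proof.
case=> g0 [e [m0 ->]] [g1 [e' [m1 ->]]].
have eg : g1 = g0 by apply: (addIr delta); rewrite e.
subst g1; rewrite (deg_irr e' e) -(linpD (mdif_lin _)).
by exists g0, e, (m0 + m1).
Qed.

Lemma exact_map M N (f : dgmap M N) x g (m : M x g) : exact m -> exact (dgmap_fun f m).
Proof.
by case=> g0 [e [m0 ->]]; exists g0, e, (dgmap_fun f m0); rewrite dgmap_dif.
Qed.

Lemma closed_map M N (f : dgmap M N) x g (m : M x g) : closed m -> closed (dgmap_fun f m).
Proof.
by rewrite /closed -dgmap_dif => ->; apply: linp0 (@dgmap_lin _ _ _ _ f _ _).
Qed.

Lemma quasi_iso_comp L M N (f : dgmap M N) (g : dgmap L M) :
  quasi_iso f -> quasi_iso g -> quasi_iso (dgcomp f g).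
Proof.
move=> qf qg x i; have [f1 f2] := qf x i; have [g1 g2] := qg x i; split.
  by move=> m cm em; apply: g1 => //; apply: f1 => //; apply: closed_map.
move=> n /f2[m cm em]; have [l cl el] := g2 m cm; exists l => //=.
have -> : n - dgmap_fun f (dgmap_fun g l) =
    (n - dgmap_fun f m) + dgmap_fun f (m - dgmap_fun g l).
  rewrite (linpD (@dgmap_lin _ _ _ _ f _ _)) (linpN (@dgmap_lin _ _ _ _ f _ _)).
  by rewrite addrA subrK.
by apply: exactD => //; apply: exact_map.
Qed.

Lemma exact0 M x g : exact (0 : M x g).
Proof.
have e : g - delta + delta = g by rewrite subrK.
by exists (g - delta), e, 0; rewrite (linp0 (mdif_lin _)).
Qed.

Lemma bij_quasi_iso M N (f : dgmap M N) : bij_dgmap f -> quasi_iso f.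
Proof.
move=> bf x g; split=> [m _ [g0 [e [n0 en]]]|n cn].
  have [f' fK f'K] := bf x g0; exists g0, e, (f' n0).
  by apply: (bij_inj (bf x g)); rewrite dgmap_dif f'K.
have [f' fK f'K] := bf x g; exists (f' n); last by rewrite f'K subrr; apply: exact0.
apply: (bij_inj (bf x (g + delta))).
by rewrite dgmap_dif f'K cn (linp0 (@dgmap_lin _ _ _ _ f _ _)).
Qed.

Lemma quasi_iso_derived_iso M N (f : dgmap M N) : quasi_iso f -> derived_iso M N.
Proof.
move=> qf; exists (Dmap f), (Dinv qf); split; [exact: deq_invl|exact: deq_invr].
Qed.

Lemma bij_derived_iso M N (f : dgmap M N) : bij_dgmap f -> derived_iso M N.
Proof. by move=> bf; apply/quasi_iso_derived_iso/(bij_quasi_iso bf). Qed.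

Lemma derived_iso_sym M N : derived_iso M N -> derived_iso N M.
Proof. by case=> a [b [ba ab]]; exists b, a. Qed.

Lemma derived_iso_trans L M N : derived_iso L M -> derived_iso M N -> derived_iso L N.
Proof.
have simp L' M' N' (a : dhom L' M') b (a' : dhom M' N') b' :
    deq (Dcomp b a) (Did L') -> deq (Dcomp b' a') (Did M') ->
    deq (Dcomp (Dcomp b b') (Dcomp a' a)) (Did L').
  move=> ba ba'; apply: deq_trans (deq_compA _ _ _) _.
  apply: deq_trans ba; apply: deq_comp; last exact: deq_refl.
  apply: deq_trans (deq_sym (deq_compA _ _ _)) _.
  apply: deq_trans (deq_idr _); apply: deq_comp => //; exact: deq_refl.
case=> a [b [ba ab]] [a' [b' [ba' ab']]].
by exists (Dcomp a' a), (Dcomp b b'); split; apply: simp.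
Qed.

Lemma perfect_derived_iso M N : derived_iso M N -> perfect M -> perfect N.
Proof. by case=> a [b [_ ab]]; apply: perfect_retract ab. Qed.

End Morphisms.

Lemma ksgB1 (k : fieldType) (n : int) : ksg (n - 1) = - ksg n :> k.
Proof. by have := ksgD k (n - 1) 1; rewrite subrK ksg1 mulrN1 => ->; rewrite opprK. Qed.

(** * Retracts of finite sums of shifted representables *)

Section FiniteSums.
Variables (k : fieldType) (A : adgcat k).

Lemma row0_unique (u v : 'rV[k]_0) : u = v.
Proof. by rewrite (thinmx0 u) (thinmx0 v). Qed.

Definition zero_dgmod : dgmod A.
Proof.
refine (@Dgmod k A (fun _ _ => 'rV[k]_0 : lmodType k) (fun _ _ _ _ _ _ _ _ => 0)
  (fun _ _ _ _ _ => 0) _ _ _ _ _ _ _); intros; try (intros ? ? ?);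
  exact: row0_unique.
Defined.

Definition zero_dgmap (M N : dgmod A) : dgmap M N.
Proof.
refine (@Dgmap k A M N (fun _ _ _ => 0) _ _ _).
- by move=> x g a u v; rewrite scaler0 addr0.
- by move=> *; rewrite (linp0 (act_linl _ _)).
- by move=> *; rewrite (linp0 (mdif_lin _)).
Defined.

(* A sum [W = sum_j r_j i_j] of maps through shifted representables makes [W] a
   retract of an iterated cone of zero maps. *)
Lemma perfect_finite_sum (W : dgmod A) (I : Type) (r : seq I) (y : I -> A) (s : I -> deg)
    (p : forall j, dgmap W (shift (representable (y j)) (s j)))
    (q : forall j, dgmap (shift (representable (y j)) (s j)) W) :
  exists (Q : dgmod A) (p' : dgmap W Q) (q' : dgmap Q W), perfect Q /\
    forall x g (m : W x g), dgmap_fun q' (dgmap_fun p' m)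
      = \sum_(j <- r) dgmap_fun (q j) (dgmap_fun (p j) m).
Proof.
elim: r => [|j r [Q [p' [q' [perfQ qp']]]]].
  exists zero_dgmod, (zero_dgmap _ _), (zero_dgmap _ _); split.
    by apply: perfect_zero => x g m; exact: row0_unique.
  by move=> x g m; rewrite big_nil.
(* The cone is Q (+) N[1], so N is shifted by -1 to contribute the shift by [s j]. The sign that
   [ksgB1] produces cancels the minus sign in the differential of the cone. *)
pose N := shift (representable (y j)) (s j - delta).
have ed (g : deg) : s j + g = s j - delta + (g + delta).
  by rewrite addrCA subrK addrC.
pose p1 x g (m : W x g) : cone (zero_dgmap N Q) x g :=
  (dgmap_fun p' m, @mcast _ _ (representable (y j)) x _ _ (ed g) (dgmap_fun (p j) m)).
pose q1 x g (m : cone (zero_dgmap N Q) x g) : W x g :=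
  dgmap_fun q' m.1 +
  dgmap_fun (q j) (@mcast _ _ (representable (y j)) x _ _ (esym (ed g)) m.2).
have p1l x g : linear (@p1 x g).
  by move=> a u v; rewrite /p1 !dgmap_lin mcast_lin.
have q1l x g : linear (@q1 x g).
  by move=> a u v; rewrite /q1 /= mcast_lin !dgmap_lin scalerDr addrACA.
have p1a x z g h l (e : g + h = l) (m : W z g) (f : hom x z h) :
    p1 x l (act e m f) = act e (p1 z g m) f.
  have e2 : s j + g + h = s j + l by degs.
  rewrite /p1 !dgmap_act; congr (_, _).
  symmetry; exact: (@mcast_act _ _ (representable (y j)) x z _ _ _ _ _ (ed g)
    (shift_act_deg (s j - delta) (cone_act_deg e)) (shift_act_deg (s j) e) (ed l)).
have p1d x g g' (e : g + delta = g') (m : W x g) :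
    p1 x g' (mdif e m) = mdif e (p1 x g m).
  have e2 : s j + g + delta = s j + g' by degs.
  rewrite /p1 !dgmap_dif /=.
  have -> : ecast i (Q x i) e (0 : Q x (g + delta)) = 0 by case: g' / e e2.
  rewrite addr0; congr (_, _).
  have dj := @mcast_dif _ _ (representable (y j)) x _ _ _ _ (ed g)
    (shift_act_deg (s j - delta) (cone_act_deg e)) (shift_act_deg (s j) e) (ed g')
    (dgmap_fun (p j) m).
  rewrite [X in - (_ *: X)]dj -scaleNr ksgB1 opprK.
  exact: (linpZ (@mcast_lin _ _ (representable (y j)) x _ _ (ed g'))).
have q1a x z g h l (e : g + h = l) (m : cone (zero_dgmap N Q) z g) (f : hom x z h) :
    q1 x l (act e m f) = act e (q1 z g m) f.
  rewrite /q1 (linpD (act_linl _ _)) -!dgmap_act; congr (_ + dgmap_fun _ _).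
  symmetry; exact: (@mcast_act _ _ (representable (y j)) x z _ _ _ _ _ (esym (ed g))
    (shift_act_deg (s j) e) (shift_act_deg (s j - delta) (cone_act_deg e)) (esym (ed l))).
have q1d x g g' (e : g + delta = g') (m : cone (zero_dgmap N Q) x g) :
    q1 x g' (mdif e m) = mdif e (q1 x g m).
  rewrite /q1 (linpD (mdif_lin _)) -!dgmap_dif /=.
  have -> : ecast i (Q x i) e (0 : Q x (g + delta)) = 0 by case: g' / e.
  rewrite addr0; congr (_ + _); congr (dgmap_fun _ _).
  have dj := @mcast_dif _ _ (representable (y j)) x _ _ _ _ (esym (ed g))
     (shift_act_deg (s j) e) (shift_act_deg (s j - delta) (cone_act_deg e))
     (esym (ed g')) m.2.
  rewrite [X in _ = _ *: X]dj -scaleNr ksgB1 opprK.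
  exact: (linpZ (@mcast_lin _ _ (representable (y j)) x _ _ (esym (ed g')))).
exists (cone (zero_dgmap N Q)), (Dgmap p1l p1a p1d), (Dgmap q1l q1a q1d); split.
  by apply: perfect_cone => //; apply: perfect_representable.
move=> x g m; rewrite big_cons -qp' /= /q1 /p1 /= addrC; congr (dgmap_fun _ _ + _).
exact: (@mcastK _ _ (representable (y j))).
Qed.

(** Perfect modules are closed under retracts, so a factorization of the identity of W through
    finitely many shifted representables is enough. *)
Lemma perfect_finite_retract (W : dgmod A) (I : finType) (y : I -> A) (s : I -> deg)
    (p : forall j, dgmap W (shift (representable (y j)) (s j)))
    (q : forall j, dgmap (shift (representable (y j)) (s j)) W) :
  (forall x g (m : W x g), \sum_j dgmap_fun (q j) (dgmap_fun (p j) m) = m) ->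
  perfect W.
Proof.
move=> qp; have [Q [p' [q' [perfQ qp']]]] := perfect_finite_sum (index_enum I) p q.
apply: (@perfect_retract _ _ Q W (Dmap p') (Dmap q')) => //.
apply: deq_trans (deq_map_id (f := dgcomp q' p') _); last first.
  by move=> x g m; rewrite /= qp' qp.
exact/deq_sym/deq_map_comp.
Qed.

End FiniteSums.

(** * Covers of graded dg categories *)

Definition wdeg (n : nat) (w : int) (g : deg) : deg := (g.1, n%:Z * g.2 + w).

Ltac wd := rewrite /wdeg /=; lia.
Tactic Notation "wdegs" := apply: deg_ext; wd.
Tactic Notation "wdegs" constr(H) :=
  apply: deg_ext; move: (congr1 fst H) (congr1 snd H); wd.
Tactic Notation "wdegs" constr(H) constr(H') :=
  apply: deg_ext; move: (congr1 fst H) (congr1 snd H) (congr1 fst H') (congr1 snd H'); wd.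
Tactic Notation "wdegs" constr(H) constr(H') constr(H'') :=
  apply: deg_ext; move: (congr1 fst H) (congr1 snd H) (congr1 fst H') (congr1 snd H')
    (congr1 fst H'') (congr1 snd H''); wd.

Section ObjectTransport.
Variables (k : fieldType) (E : adgcat k).

Definition hcast (X Y S T : E) G (eX : X = S) (eY : Y = T) (m : hom X Y G) : hom S T G :=
  ecast T' (hom S T' G) eY (ecast S' (hom S' Y G) eX m).

End ObjectTransport.

(* A functor [E' -> E] which multiplies Adams degrees by [n] up to weights of
   the objects, and makes each graded Hom space of [E] a sum over the [n] lifts
   of one of its two ends. *)
Record adams_cover (k : fieldType) (n : nat) (E' E : adgcat k) := Cover {
  cob :> E' -> E;
  cwt : E' -> int;
  cidx : E' -> 'I_n;
  cdeg : E' -> deg -> deg;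
  cdegE : forall X g, cdeg X g = wdeg n (cwt X) g;
  chom : forall X Y g G, wdeg n (cwt X - cwt Y) g = G ->
    hom X Y g -> hom (cob X) (cob Y) G;
  rhom : forall X Y g G, wdeg n (cwt X - cwt Y) g = G ->
    hom (cob X) (cob Y) G -> hom X Y g;
  chom_lin : forall X Y g G e, linear (@chom X Y g G e);
  rhom_lin : forall X Y g G e, linear (@rhom X Y g G e);
  chom_id : forall X g G (e : wdeg n (cwt X - cwt X) g = G) (e0 : g = 0) (e1 : G = 0),
    chom e (idm X e0) = idm (cob X) e1;
  chom_comp : forall X Y Z g h l G H L (eg : wdeg n (cwt Y - cwt Z) g = G)
    (eh : wdeg n (cwt X - cwt Y) h = H) (el : wdeg n (cwt X - cwt Z) l = L)
    (e : g + h = l) (e' : G + H = L) (f : hom Y Z g) (u : hom X Y h),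
    chom el (comp e f u) = comp e' (chom eg f) (chom eh u);
  chom_dif : forall X Y g g' G G' (eg : wdeg n (cwt X - cwt Y) g = G)
    (eg' : wdeg n (cwt X - cwt Y) g' = G') (e : g + delta = g') (e' : G + delta = G')
    (f : hom X Y g), chom eg' (dif e f) = dif e' (chom eg f);
  chomK : forall X Y g G (e : wdeg n (cwt X - cwt Y) g = G), cancel (chom e) (rhom e);
  rhom_chom_target : forall X Y Y' T (eY : cob Y = T) (eY' : cob Y' = T) g g' G
    (e : wdeg n (cwt X - cwt Y) g = G) (e' : wdeg n (cwt X - cwt Y') g' = G)
    (f : hom X Y g), cidx Y <> cidx Y' ->
    rhom e' (hcast erefl (etrans eY (esym eY')) (chom e f)) = 0;
  rhom_chom_source : forall X X' Y S (eX : cob X = S) (eX' : cob X' = S) g g' G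
    (e : wdeg n (cwt X - cwt Y) g = G) (e' : wdeg n (cwt X' - cwt Y) g' = G)
    (f : hom X Y g), cidx X <> cidx X' ->
    rhom e' (hcast (etrans eX (esym eX')) erefl (chom e f)) = 0;
  sum_target : forall X T (Z : 'I_n -> E') (eZ : forall c, cob (Z c) = T)
    (g : 'I_n -> deg) G (e : forall c, wdeg n (cwt X - cwt (Z c)) (g c) = G)
    (m : hom (cob X) T G), (forall c, cidx (Z c) = c) ->
    \sum_c hcast erefl (eZ c) (chom (e c) (rhom (e c) (hcast erefl (esym (eZ c)) m))) = m;
  sum_source : forall Y S (Z : 'I_n -> E') (eZ : forall c, cob (Z c) = S)
    (g : 'I_n -> deg) G (e : forall c, wdeg n (cwt (Z c) - cwt Y) (g c) = G)
    (m : hom S (cob Y) G), (forall c, cidx (Z c) = c) ->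
    \sum_c hcast (eZ c) erefl (chom (e c) (rhom (e c) (hcast (esym (eZ c)) erefl m))) = m;
  fiber_inj : forall Y Y' g g', cob Y = cob Y' -> cidx Y = cidx Y' ->
    wdeg n (cwt Y) g = wdeg n (cwt Y') g' -> Y = Y' /\ g = g';
  fiber_ex : forall T c G, exists Y g,
    [/\ cob Y = T, cidx Y = c & wdeg n (cwt Y) g = G] }.

(** * Components of Hom spaces along a cover *)

Section CoverHom.
Variables (k : fieldType) (n : nat) (E' E : adgcat k) (C : adams_cover n E' E).

Lemma fiber T G : exists (Z : 'I_n -> E') (t : 'I_n -> deg),
  [/\ forall c, C (Z c) = T, forall c, cidx C (Z c) = c
    & forall c, wdeg n (cwt C (Z c)) (t c) = G].
Proof.
have /choice[Z zP] : forall c, exists Yg : E' * deg,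
    [/\ C Yg.1 = T, cidx C Yg.1 = c & wdeg n (cwt C Yg.1) Yg.2 = G].
  by move=> c; have [Y [g P]] := @fiber_ex _ _ _ _ C T c G; exists (Y, g).
exists (fun c => (Z c).1), (fun c => (Z c).2).
by split=> c; have [] := zP c.
Qed.

(** [fh] and [rh] are [chom] and [rhom] between objects merely equal to the images of X and Y, which
    is all that lifts provide. Destructing the two equations reduces their basic laws to fields of
    the record. *)
Definition fh X Y S T (eX : C X = S) (eY : C Y = T) g G
    (e : wdeg n (cwt C X - cwt C Y) g = G) (f : hom X Y g) : hom S T G :=
  hcast eX eY (chom e f).

Definition rh X Y S T (eX : C X = S) (eY : C Y = T) g G
    (e : wdeg n (cwt C X - cwt C Y) g = G) (m : hom S T G) : hom X Y g :=
  rhom e (hcast (esym eX) (esym eY) m).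

Lemma fh_lin X Y S T (eX : C X = S) (eY : C Y = T) g G
  (e : wdeg n (cwt C X - cwt C Y) g = G) : linear (fh eX eY e).
Proof. by case: S / eX; case: T / eY; apply: chom_lin. Qed.

Lemma rh_lin X Y S T (eX : C X = S) (eY : C Y = T) g G
  (e : wdeg n (cwt C X - cwt C Y) g = G) : linear (rh eX eY e).
Proof. by case: S / eX; case: T / eY; apply: rhom_lin. Qed.

Lemma fh_id X S (eX : C X = S) g G (e : wdeg n (cwt C X - cwt C X) g = G)
  (e0 : g = 0) (e1 : G = 0) : fh eX eX e (idm X e0) = idm S e1.
Proof. by case: S / eX; apply: chom_id. Qed.

Lemma fh_comp X Y Z S T U (eX : C X = S) (eY : C Y = T) (eZ : C Z = U)
    g h l G H L (eg : wdeg n (cwt C Y - cwt C Z) g = G)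
    (eh : wdeg n (cwt C X - cwt C Y) h = H) (el : wdeg n (cwt C X - cwt C Z) l = L)
    (e : g + h = l) (e' : G + H = L) (f : hom Y Z g) (u : hom X Y h) :
  fh eX eZ el (comp e f u) = comp e' (fh eY eZ eg f) (fh eX eY eh u).
Proof. by case: S / eX; case: T / eY; case: U / eZ; apply: chom_comp. Qed.

Lemma fh_dif X Y S T (eX : C X = S) (eY : C Y = T) g g' G G'
    (eg : wdeg n (cwt C X - cwt C Y) g = G)
    (eg' : wdeg n (cwt C X - cwt C Y) g' = G') (e : g + delta = g') (e' : G + delta = G')
    (f : hom X Y g) : fh eX eY eg' (dif e f) = dif e' (fh eX eY eg f).
Proof. by case: S / eX; case: T / eY; apply: chom_dif. Qed.

Lemma rh_fh X Y S T (eX : C X = S) (eY : C Y = T) g G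
  (e : wdeg n (cwt C X - cwt C Y) g = G) : cancel (fh eX eY e) (rh eX eY e).
Proof. by case: S / eX; case: T / eY; apply: chomK. Qed.

Lemma rh_fh_target X Y Y' S T (eX : C X = S) (eY : C Y = T) (eY' : C Y' = T) g g' G
    (e : wdeg n (cwt C X - cwt C Y) g = G) (e' : wdeg n (cwt C X - cwt C Y') g' = G)
    (f : hom X Y g) : cidx C Y <> cidx C Y' -> rh eX eY' e' (fh eX eY e f) = 0.
Proof.
move=> ne; case: S / eX; rewrite -(rhom_chom_target eY eY' e e' f ne) /rh.
congr rhom; rewrite /fh /hcast /=; case: T / eY eY' => eY'.
by rewrite (Prop_irrelevance (etrans erefl (esym eY')) (esym eY')).
Qed.

Lemma rh_fh_source X X' Y S T (eX : C X = S) (eX' : C X' = S) (eY : C Y = T) g g' G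
    (e : wdeg n (cwt C X - cwt C Y) g = G) (e' : wdeg n (cwt C X' - cwt C Y) g' = G)
    (f : hom X Y g) : cidx C X <> cidx C X' -> rh eX' eY e' (fh eX eY e f) = 0.
Proof.
move=> ne; case: T / eY; rewrite -(rhom_chom_source eX eX' e e' f ne) /rh.
congr rhom; rewrite /fh /hcast /=; case: S / eX eX' => eX'.
by rewrite (Prop_irrelevance (etrans erefl (esym eX')) (esym eX')).
Qed.

Lemma fh_sum_target X S T (eX : C X = S) (Z : 'I_n -> E') (eZ : forall c, C (Z c) = T)
    (g : 'I_n -> deg) G (e : forall c, wdeg n (cwt C X - cwt C (Z c)) (g c) = G)
    (m : hom S T G) : (forall c, cidx C (Z c) = c) ->
  \sum_c fh eX (eZ c) (e c) (rh eX (eZ c) (e c) m) = m.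
Proof. by case: S / eX m => m; apply: sum_target. Qed.

Lemma fh_sum_source Y S T (eY : C Y = T) (Z : 'I_n -> E') (eZ : forall c, C (Z c) = S)
    (g : 'I_n -> deg) G (e : forall c, wdeg n (cwt C (Z c) - cwt C Y) (g c) = G)
    (m : hom S T G) : (forall c, cidx C (Z c) = c) ->
  \sum_c fh (eZ c) eY (e c) (rh (eZ c) eY (e c) m) = m.
Proof. by case: T / eY m => m; apply: sum_source. Qed.

(** Produces a full family of lifts that contains the given pair (Y, t): [fiber_inj] forces the
    member with the index of Y to be that pair. *)
Lemma fiber_at T Y (eY : C Y = T) t : exists (Z : 'I_n -> E') (s : 'I_n -> deg),
  [/\ forall c, C (Z c) = T, forall c, cidx C (Z c) = c,
      forall c, wdeg n (cwt C (Z c)) (s c) = wdeg n (cwt C Y) t,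
      Z (cidx C Y) = Y & s (cidx C Y) = t].
Proof.
have [Z [s [eZ iZ dZ]]] := fiber T (wdeg n (cwt C Y) t).
have [] := @fiber_inj _ _ _ _ C (Z (cidx C Y)) Y (s (cidx C Y)) t.
- by rewrite eZ.
- by rewrite iZ.
- exact: dZ.
by move=> ? ?; exists Z, s.
Qed.

(** Split m over the lifts of its target. By [fh_comp], each component keeps its target lift after
    composition with u, so projecting to Z retains only the component of index [cidx C Z]. The next
    lemma is the same argument with the lifts of the source. *)
Lemma rh_compr X Y Z S T U (eX : C X = S) (eY : C Y = T) (eZ : C Z = U)
    g h l G H L (eg : wdeg n (cwt C Y - cwt C Z) g = G)
    (eh : wdeg n (cwt C X - cwt C Y) h = H) (el : wdeg n (cwt C X - cwt C Z) l = L)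
    (e : g + h = l) (e' : G + H = L) (m : hom T U G) (u : hom X Y h) :
  rh eX eZ el (comp e' m (fh eX eY eh u)) = comp e (rh eY eZ eg m) u.
Proof.
(* The weight of a target enters Hom degrees with a minus sign, hence lifts in degree [- g] and Hom
   degrees [- s c]. *)
have [W [s [eW iW dW eWZ esZ]]] := fiber_at eZ (- g).
have p c : wdeg n (cwt C Y - cwt C (W c)) (- s c) = G by wdegs eg (dW c).
have q c : wdeg n (cwt C X - cwt C (W c)) (- s c + h) = L by wdegs (p c) eh e'.
rewrite -{1}(fh_sum_target eY eW p m iW) (linp_sum (comp_linl _ _)).
rewrite (linp_sum (rh_lin _ _ _)) (bigD1 (cidx C Z)) //= big1 ?addr0; last first.
  move=> c /eqP cZ; rewrite -(fh_comp eX eY (eW c) (p c) eh (q c) erefl e').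
  by rewrite rh_fh_target // iW.
move: (p (cidx C Z)) (eW (cidx C Z)); rewrite eWZ esZ opprK => p' eZ'.
rewrite (Prop_irrelevance eZ' eZ) (deg_irr p' eg).
by rewrite -(fh_comp eX eY eZ eg eh el e e') rh_fh.
Qed.

Lemma rh_compl X Y Z S T U (eX : C X = S) (eY : C Y = T) (eZ : C Z = U)
    g h l G H L (eg : wdeg n (cwt C Y - cwt C Z) g = G)
    (eh : wdeg n (cwt C X - cwt C Y) h = H) (el : wdeg n (cwt C X - cwt C Z) l = L)
    (e : g + h = l) (e' : G + H = L) (f : hom Y Z g) (m : hom S T H) :
  rh eX eZ el (comp e' (fh eY eZ eg f) m) = comp e f (rh eX eY eh m).
Proof.
have [W [s [eW iW dW eWX esX]]] := fiber_at eX h.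
have p c : wdeg n (cwt C (W c) - cwt C Y) (s c) = H by wdegs eh (dW c).
have q c : wdeg n (cwt C (W c) - cwt C Z) (g + s c) = L by wdegs (p c) eg e'.
rewrite -{1}(fh_sum_source eY eW p m iW) (linp_sum (comp_linr _ _)).
rewrite (linp_sum (rh_lin _ _ _)) (bigD1 (cidx C X)) //= big1 ?addr0; last first.
  move=> c /eqP cX; rewrite -(fh_comp (eW c) eY eZ eg (p c) (q c) erefl e').
  by rewrite rh_fh_source // iW.
move: (p (cidx C X)) (eW (cidx C X)); rewrite eWX esX => p' eX'.
rewrite (Prop_irrelevance eX' eX) (deg_irr p' eh).
by rewrite -(fh_comp eX eY eZ eg eh el e e') rh_fh.
Qed.

Lemma rh_dif X Y S T (eX : C X = S) (eY : C Y = T) g g' G G'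
    (eg : wdeg n (cwt C X - cwt C Y) g = G)
    (eg' : wdeg n (cwt C X - cwt C Y) g' = G') (e : g + delta = g') (e' : G + delta = G')
    (m : hom S T G) : rh eX eY eg' (dif e' m) = dif e (rh eX eY eg m).
Proof.
have [W [s [eW iW dW eWX esX]]] := fiber_at eX g.
have p c : wdeg n (cwt C (W c) - cwt C Y) (s c) = G by wdegs eg (dW c).
have q c : wdeg n (cwt C (W c) - cwt C Y) (s c + delta) = G' by wdegs (p c) e'.
rewrite -{1}(fh_sum_source eY eW p m iW) (linp_sum (dif_lin _)).
rewrite (linp_sum (rh_lin _ _ _)) (bigD1 (cidx C X)) //= big1 ?addr0; last first.
  move=> c /eqP cX; rewrite -(fh_dif (eW c) eY (p c) (q c) erefl e').
  by rewrite rh_fh_source // iW.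
move: (p (cidx C X)) (eW (cidx C X)); rewrite eWX esX => p' eX'.
rewrite (Prop_irrelevance eX' eX) (deg_irr p' eg).
by rewrite -(fh_dif eX eY eg eg' e e') rh_fh.
Qed.

End CoverHom.

Arguments fh : simpl never.
Arguments rh : simpl never.

(** * Pulling back modules along a cover *)

Section Pullback.
Variables (k : fieldType) (n : nat) (E' E : adgcat k) (C : adams_cover n E' E).

Lemma cdegD X Y g h l : g + h = l ->
  cdeg C Y g + wdeg n (cwt C X - cwt C Y) h = cdeg C X l.
Proof. by rewrite !cdegE => e; wdegs e. Qed.

Lemma cdeg_delta X g g' : g + delta = g' -> cdeg C X g + delta = cdeg C X g'.
Proof. by rewrite !cdegE => e; wdegs e. Qed.

Definition pullback (M : dgmod E) : dgmod E'.
Proof.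
refine (@Dgmod k E' (fun X g => M (C X) (cdeg C X g))
  (fun X Y g h l e m f => act (cdegD X Y e) m (fh (C := C) erefl erefl erefl f))
  (fun X g g' e m => mdif (cdeg_delta X e) m) _ _ _ _ _ _ _).
- by move=> X Y g h l e f; apply: act_linl.
- by move=> X Y g h l e m a u v; rewrite fh_lin act_linr.
- by move=> X g g' e; apply: mdif_lin.
- move=> X g h e0 e m; have e1 : wdeg n (cwt C X - cwt C X) h = 0 by wdegs e0.
  by rewrite (fh_id (erefl (C X)) erefl e0 e1) act_id.
- move=> X Y Z g1 g2 g3 g12 g23 g e12 e e23 e' m f u.
  have e1 : wdeg n (cwt C Y - cwt C Z) g2 + wdeg n (cwt C X - cwt C Y) g3
    = wdeg n (cwt C X - cwt C Z) g23 by wdegs e23.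
  rewrite (act_comp _ _ e1 (cdegD X Z e')).
  by rewrite -(fh_comp (erefl (C X)) (erefl (C Y)) (erefl (C Z)) erefl erefl erefl e23).
- by move=> X g g' g'' e e' m; apply: mdif_mdif.
- move=> X Y g h l g' h' l' e el eg eh e1 e2 m f.
  have p : wdeg n (cwt C X - cwt C Y) h + delta = wdeg n (cwt C X - cwt C Y) h' by wdegs eh.
  rewrite (mdif_act _ _ (cdeg_delta Y eg) p (cdegD X Y e1) (cdegD X Y e2)).
  by rewrite -(fh_dif (erefl (C X)) (erefl (C Y)) erefl erefl eh) [in ksg _]cdegE.
Defined.

Definition pullback_map (M N : dgmod E) (f : dgmap M N) : dgmap (pullback M) (pullback N).
Proof.
refine (@Dgmap k E' (pullback M) (pullback N) (fun X g m => dgmap_fun f m) _ _ _).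
- by move=> X g a u v; rewrite dgmap_lin.
- by move=> *; rewrite /= dgmap_act.
- by move=> *; rewrite /= dgmap_dif.
Defined.

(** The differential has Adams degree 0, so a primitive in M of an element seen by the pullback is
    itself seen by the pullback. This makes pullback reflect exactness. *)
Lemma cdeg_surj X g G : G + delta = cdeg C X g -> G = cdeg C X (g - delta).
Proof. by rewrite !cdegE => e; wdegs e. Qed.

Lemma pullback_closed M X g (m : pullback M X g) :
  closed m <-> @closed k E M (C X) (cdeg C X g) m.
Proof. exact: iff_sym (closedE (cdeg_delta X erefl) _). Qed.

Lemma pullback_exact M X g (m : pullback M X g) :
  exact m <-> @exact k E M (C X) (cdeg C X g) m.
Proof.
split=> [[g0 [e [m0 ->]]]|[G [e [m0 ->]]]].
  by exists (cdeg C X g0), (cdeg_delta X e), m0.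
have E0 := cdeg_surj e; subst G.
have e0 : g - delta + delta = g by rewrite subrK.
by exists (g - delta), e0, m0; rewrite /= (deg_irr (cdeg_delta X e0) e).
Qed.

Lemma pullback_quasi_iso M N (f : dgmap M N) : quasi_iso f -> quasi_iso (pullback_map f).
Proof.
move=> qf X g; have [f1 f2] := qf (C X) (cdeg C X g); split.
  by move=> m /pullback_closed cm /pullback_exact em; apply/pullback_exact/f1.
move=> m /pullback_closed /f2[m' cm em]; exists m'; first exact/pullback_closed.
exact/pullback_exact.
Qed.

(** Morphisms of the derived category are formal words, so the induced functor is defined generator
    by generator; preservation of quasi-isomorphisms handles the formal inverses. *)
Fixpoint pullback_dhom (M N : dgmod E) (a : dhom M N) : dhom (pullback M) (pullback N) :=
  match a in dhom M' N' return dhom (pullback M') (pullback N') with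
  | Dmap _ _ f => Dmap (pullback_map f)
  | Dinv _ _ _ q => Dinv (pullback_quasi_iso q)
  | Did M => Did (pullback M)
  | Dcomp _ _ _ a b => Dcomp (pullback_dhom a) (pullback_dhom b)
  end.

Lemma pullback_deq M N (a b : dhom M N) :
  deq a b -> deq (pullback_dhom a) (pullback_dhom b).
Proof.
elim=> {M N a b} /=.
- by move=> *; apply: deq_refl.
- by move=> *; apply: deq_sym.
- by move=> M N a b c _ h _; apply: deq_trans h.
- by move=> *; apply: deq_comp.
- by move=> *; apply: deq_compA.
- by move=> *; apply: deq_idl.
- by move=> *; apply: deq_idr.
- by move=> M f fid; apply: deq_map_id => X g m; apply: fid.
- by move=> L M N f g h hfg; apply: deq_map_comp => X i m; apply: hfg.
- by move=> *; apply: deq_invl.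
- by move=> *; apply: deq_invr.
Qed.

Lemma pullback_derived_iso M N :
  derived_iso M N -> derived_iso (pullback M) (pullback N).
Proof.
case=> a [b [/pullback_deq ba /pullback_deq ab]].
by exists (pullback_dhom a), (pullback_dhom b).
Qed.

Lemma cdeg_shift s X g : cdeg C X (s + g) = wdeg n 0 s + cdeg C X g.
Proof. by rewrite !cdegE; wdegs. Qed.

Definition pullback_shift (M : dgmod E) s :
  dgmap (shift (pullback M) s) (pullback (shift M (wdeg n 0 s))).
Proof.
refine (@Dgmap k E' (shift (pullback M) s) (pullback (shift M (wdeg n 0 s)))
  (fun X g m => mcast (cdeg_shift s X g) m) _ _ _).
- by move=> X g; apply: (@mcast_lin _ _ M).
- move=> X Y g h l e m f; symmetry.
  exact: (@mcast_act _ _ M _ _ _ _ _ _ _ _ _ (cdegD X Y (shift_act_deg s e))).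
- move=> X g g' e m /=.
  rewrite (mcast_dif _ _ (cdeg_delta X (shift_act_deg s e)) (cdeg_shift s X g')).
  exact: (linpZ (@mcast_lin _ _ M _ _ _ _)).
Defined.

Lemma bij_pullback_shift M s : bij_dgmap (pullback_shift M s).
Proof. by move=> X g; exact: (@mcast_bij _ _ M). Qed.

Definition pullback_cone (M N : dgmod E) (f : dgmap M N) :
  dgmap (cone (pullback_map f)) (pullback (cone f)).
Proof.
refine (@Dgmap k E' (cone (pullback_map f)) (pullback (cone f))
  (fun X g m => (m.1, mcast (esym (cdeg_delta X (erefl (g + delta)))) m.2)) _ _ _).
- by move=> X g a u v; rewrite /= mcast_lin.
- move=> X Y g h l e m u; congr (_, _) => /=; symmetry.
  exact: (@mcast_act _ _ M _ _ _ _ _ _ _ _ (cone_act_deg (cdegD X Y e))).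
- move=> X g g' e m /=; congr (_, _).
    congr (_ + _); rewrite mcast_fun; case: g' / e => /=.
    by symmetry; exact: (@mcastKV _ _ N).
  rewrite (linpN (mcast_lin _)); congr (- _).
  by symmetry; exact: (@mcast_dif _ _ M _ _ _ _ _ _ (cone_act_deg (cdeg_delta X e))).
Defined.

Lemma bij_pullback_cone M N (f : dgmap M N) : bij_dgmap (pullback_cone f).
Proof.
move=> X g; have [h hK hK'] := @mcast_bij _ _ M (C X) _ _ (esym (cdeg_delta X (erefl (g + delta)))).
by exists (fun m => (m.1, h m.2)) => -[m1 m2] /=; rewrite ?hK ?hK'.
Qed.

(** * Pullback of representable and perfect modules *)

Section Representable.
Variables (T : E) (s : deg) (Y : E') (t : deg).
Hypotheses (eY : C Y = T) (et : wdeg n (- cwt C Y) t = s).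
Let W := pullback (shift (representable T) s).
Let R := shift (representable Y) t.

Lemma rep_deg X g : wdeg n (cwt C X - cwt C Y) (t + g) = s + cdeg C X g.
Proof. by rewrite cdegE; wdegs et. Qed.

Definition rep_proj : dgmap W R.
Proof.
refine (@Dgmap k E' W R (fun X g m => rh erefl eY (rep_deg X g) m) _ _ _).
- by move=> X g; apply: rh_lin.
- move=> X Z g h l e m f.
  exact: (rh_compr (erefl (C X)) (erefl (C Z)) eY (rep_deg Z g) erefl (rep_deg X l)
    (shift_act_deg t e)).
- move=> X g g' e m; rewrite /= (linpZ (rh_lin _ _ _)).
  rewrite (rh_dif (erefl (C X)) eY (rep_deg X g) _ (shift_act_deg t e)).
  by have -> : s.1 = t.1 by rewrite -et.
Defined.

Definition rep_incl : dgmap R W.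
Proof.
refine (@Dgmap k E' R W (fun X g m => fh erefl eY (rep_deg X g) m) _ _ _).
- by move=> X g; apply: fh_lin.
- move=> X Z g h l e m f.
  exact: (fh_comp (erefl (C X)) (erefl (C Z)) eY (rep_deg Z g) erefl (rep_deg X l)
    (shift_act_deg t e)).
- move=> X g g' e m; rewrite /= (linpZ (fh_lin _ _ _)).
  rewrite (fh_dif (erefl (C X)) eY (rep_deg X g) _ (shift_act_deg t e)
    (shift_act_deg s (cdeg_delta X e))).
  by have -> : s.1 = t.1 by rewrite -et.
Defined.

End Representable.

Lemma pullback_representable T s : perfect (pullback (shift (representable T) s)).
Proof.
(* Both signs are reversed because T is the target of the Hom spaces: the lifts live over [- s] and
   the shifts are [- t c]. *)
have [Z [t [eZ iZ dZ]]] := fiber C T (- s).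
have et c : wdeg n (- cwt C (Z c)) (- t c) = s by wdegs (dZ c).
apply: (perfect_finite_retract (p := fun c => rep_proj (eZ c) (et c))
  (q := fun c => rep_incl (eZ c) (et c))) => X g m.
exact: (fh_sum_target (erefl (C X)) eZ (fun c => rep_deg (et c) X g) m iZ).
Qed.

Lemma pullback_perfect M : perfect M -> perfect (pullback M).
Proof.
elim=> {M}.
- by move=> M M0; apply: perfect_zero => X g m; apply: M0.
- exact: pullback_representable.
- move=> M N f _ pM _ pN.
  apply: perfect_derived_iso (perfect_cone (pullback_map f) pM pN).
  exact: bij_derived_iso (bij_pullback_cone f).
- move=> M N i r ri _ pM.
  exact: (perfect_retract (i := pullback_dhom i) (r := pullback_dhom r) (pullback_deq ri)).
Qed.

End Pullback.

(** * Coinduction *)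

Section DependentProduct.
Variables (k : fieldType) (I : Type) (F : I -> lmodType k).

Definition dprod := forall i, F i.

Lemma dprodP (u v : dprod) : (forall i, u i = v i) -> u = v.
Proof. exact: functional_extensionality_dep. Qed.

HB.instance Definition _ := gen_eqMixin dprod.
HB.instance Definition _ := gen_choiceMixin dprod.

Definition dpzero : dprod := fun=> 0.
Definition dpadd (u v : dprod) : dprod := fun i => u i + v i.
Definition dpscale a (u : dprod) : dprod := fun i => a *: u i.

Fact dpaddA : associative dpadd.
Proof. by move=> u v w; apply: dprodP => i; apply: addrA. Qed.
Fact dpaddC : commutative dpadd.
Proof. by move=> u v; apply: dprodP => i; apply: addrC. Qed.
Fact dpadd0 : left_id dpzero dpadd.
Proof. by move=> u; apply: dprodP => i; apply: add0r. Qed.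
Fact dpaddN : left_inverse dpzero (dpscale (-1)) dpadd.
Proof.
by move=> u; apply: dprodP => i; rewrite /dpadd /dpscale scaleN1r addNr.
Qed.
HB.instance Definition _ := GRing.isZmodule.Build dprod dpaddA dpaddC dpadd0 dpaddN.

Fact dpscaleA a b u : dpscale a (dpscale b u) = dpscale (a * b) u.
Proof. by apply: dprodP => i; apply: scalerA. Qed.
Fact dpscale1 : left_id 1 dpscale.
Proof. by move=> u; apply: dprodP => i; apply: scale1r. Qed.
Fact dpscaleDr : right_distributive dpscale +%R.
Proof. by move=> a u v; apply: dprodP => i; apply: scalerDr. Qed.
Fact dpscaleDl u : {morph dpscale^~ u : a b / a + b}.
Proof. by move=> a b; apply: dprodP => i; apply: scalerDl. Qed.
HB.instance Definition _ := GRing.Zmodule_isLmodule.Build k dprod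
  dpscaleA dpscale1 dpscaleDr dpscaleDl.

Lemma dprodD (u v : dprod) i : (u + v) i = u i + v i. Proof. by []. Qed.
Lemma dprodZ a (u : dprod) i : (a *: u) i = a *: u i. Proof. by []. Qed.
Lemma dprodN (u : dprod) i : (- u) i = - u i.
Proof. exact: scaleN1r. Qed.
Lemma dprod0 i : (0 : dprod) i = 0. Proof. by []. Qed.

End DependentProduct.

Section Coinduction.
Variables (k : fieldType) (n : nat) (E' E : adgcat k) (C : adams_cover n E' E).

Record oblift (T : E) (G : deg) := Lift {
  lob :> E';
  ldeg : deg;
  lobE : C lob = T;
  ldegE : wdeg n (cwt C lob) ldeg = G }.

Lemma ldeg1 T G (i : oblift T G) : (ldeg i).1 = G.1.
Proof. exact: (congr1 fst (ldegE i)). Qed.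

(** With [lift_ex], this makes [cidx] a bijection from the lifts of T and G onto ['I_n], so that
    sums over lifts can be written as sums over indices. *)
Lemma lift_eq T G (i j : oblift T G) : cidx C i = cidx C j -> i = j.
Proof.
case: i j => X g eX eg [Y h eY eh] /= ij.
have [|XY gh] := fiber_inj _ ij (etrans eg (esym eh)); first by rewrite eX.
subst Y h; by rewrite (Prop_irrelevance eX eY) (Prop_irrelevance eg eh).
Qed.

Lemma lift_ex T G c : exists i : oblift T G, cidx C i = c.
Proof. by have [Y [g [eY iY eg]]] := fiber_ex C T c G; exists (Lift eY eg). Qed.

Definition lift_at T G c : oblift T G := projT1 (cid (lift_ex T G c)).

Lemma lift_atE T G c : cidx C (lift_at T G c) = c.
Proof. exact: projT2 (cid (lift_ex T G c)). Qed.

Lemma lift_at_idx T G (i : oblift T G) : lift_at T G (cidx C i) = i.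
Proof. by apply: lift_eq; rewrite lift_atE. Qed.

Lemma lift_homdeg S T L G H (e : G + H = L) (i : oblift S L) (j : oblift T G) :
  wdeg n (cwt C i - cwt C j) (ldeg i - ldeg j) = H.
Proof. by wdegs e (ldegE i) (ldegE j). Qed.

Lemma lift_actdeg S T L G (i : oblift S L) (j : oblift T G) : ldeg j + (ldeg i - ldeg j) = ldeg i.
Proof. by rewrite addrC subrK. Qed.

Lemma lift_pred_deg T G G' (e : G + delta = G') (i : oblift T G') :
  wdeg n (cwt C i) (ldeg i - delta) = G.
Proof. by wdegs e (ldegE i). Qed.

Definition lift_pred T G G' (e : G + delta = G') (i : oblift T G') : oblift T G :=
  Lift (lobE i) (lift_pred_deg e i).

Lemma lift_pred_at T G G' (e : G + delta = G') c :
  lift_pred e (lift_at T G' c) = lift_at T G c.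
Proof. by apply: lift_eq; rewrite /= !lift_atE. Qed.

Lemma act_rh_irr (N : dgmod E') (X Y : E') S T (eX : C X = S) (eY : C Y = T) g h h' l H
    (eh : wdeg n (cwt C X - cwt C Y) h = H) (eh' : wdeg n (cwt C X - cwt C Y) h' = H)
    (e : g + h = l) (e' : g + h' = l) (m : N Y g) (f : hom S T H) :
  act e m (rh eX eY eh f) = act e' m (rh eX eY eh' f).
Proof.
have hh : h = h' by apply: (addrI g); rewrite e.
by subst h'; rewrite (deg_irr eh eh') (deg_irr e e').
Qed.

Section Module.
Variable N : dgmod E'.

(* The right adjoint of [pullback]: a product over all lifts of [T] and [G], of
   which there are [n]. *)
Definition coind_car T G : lmodType k := dprod (fun i : oblift T G => N i (ldeg i)).

(** A matrix entry of the action: f in E(S, T) is replaced by its component in E'(i, j), and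
    [coind_act] is the product of a row vector by this matrix. *)
Definition coind_term S T G H L (e : G + H = L) (m : coind_car T G) (f : hom S T H)
    (i : oblift S L) (j : oblift T G) : N i (ldeg i) :=
  act (lift_actdeg i j) (m j) (rh (lobE i) (lobE j) (lift_homdeg e i j) f).

Definition coind_act S T G H L (e : G + H = L) (m : coind_car T G) (f : hom S T H) :
  coind_car S L := fun i => \sum_c coind_term e m f i (lift_at T G c).

Definition coind_dif T G G' (e : G + delta = G') (m : coind_car T G) : coind_car T G' :=
  fun i => mdif (subrK delta (ldeg i)) (m (lift_pred e i)).

(* The other summands vanish since [fh _ _ _ u] lies in a single residue class. *)
Lemma coind_act_fh S T G H L (e : G + H = L) (m : coind_car T G) (i : oblift S L)
    (j : oblift T G) h (eh : wdeg n (cwt C i - cwt C j) h = H) (e' : ldeg j + h = ldeg i)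
    (u : hom i j h) :
  coind_act e m (fh (lobE i) (lobE j) eh u) i = act e' (m j) u.
Proof.
rewrite /coind_act (bigD1 (cidx C j)) //= big1 ?addr0; last first.
  move=> c /eqP cj; rewrite /coind_term rh_fh_target ?(linp0 (act_linr _ _)) //.
  by rewrite lift_atE => /esym.
rewrite lift_at_idx /coind_term.
have eh' : h = ldeg i - ldeg j by rewrite -e' addrAC subrr add0r.
subst h; rewrite (deg_irr eh (lift_homdeg e i j)) rh_fh.
by rewrite (deg_irr (lift_actdeg i j) e').
Qed.

Lemma coind_term_linl S T G H L (e : G + H = L) (f : hom S T H) (i : oblift S L) j :
  linear (fun m : coind_car T G => coind_term e m f i j).
Proof. by move=> a u v; rewrite /coind_term dprodD dprodZ act_linl. Qed.

Lemma coind_term_linr S T G H L (e : G + H = L) (m : coind_car T G) (i : oblift S L) j :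
  linear (fun f : hom S T H => coind_term e m f i j).
Proof. by move=> a u v; rewrite /coind_term rh_lin act_linr. Qed.

Definition coinduction : dgmod E.
Proof.
refine (@Dgmod k E coind_car coind_act coind_dif _ _ _ _ _ _ _).
- move=> S T G H L e f a u v; apply: dprodP => i; rewrite dprodD dprodZ.
  by apply: (lin_sum _ _ (fun c => @coind_term_linl S T G H L e f i (lift_at T G c))).
- move=> S T G H L e m a u v; apply: dprodP => i; rewrite dprodD dprodZ.
  by apply: (lin_sum _ _ (fun c => @coind_term_linr S T G H L e m i (lift_at T G c))).
- move=> T G G' e a u v; apply: dprodP => i; rewrite dprodD dprodZ /coind_dif.
  by rewrite dprodD dprodZ mdif_lin.
- move=> T G H e0 e m; apply: dprodP => i.
  have eh : wdeg n (cwt C i - cwt C i) 0 = H by rewrite e0; wdegs.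
  rewrite -(fh_id (lobE i) eh erefl e0).
  by rewrite (coind_act_fh _ _ _ (addr0 _)) act_id.
- move=> R S T g1 g2 g3 g12 g23 g e12 e e23 e' m f u; apply: dprodP => i.
  rewrite /coind_act /coind_term.
  under eq_bigr => c _ do rewrite (linp_sum (act_linl _ _)).
  rewrite exchange_big /=; apply: eq_bigr => c _.
  set j := lift_at T g1 c; pose J d := lift_at S g12 d.
  (* Splitting u over the lifts of its target S turns the components of the composite into a matrix
     product; associativity is then checked entry by entry. *)
  rewrite -{2}(fh_sum_target (lobE i) (fun d => lobE (J d))
    (fun d => lift_homdeg e i (J d)) u (fun d => lift_atE _ _ _)).
  rewrite (linp_sum (comp_linr _ _)) (linp_sum (rh_lin _ _ _)) (linp_sum (act_linr _ _)).
  apply: eq_bigr => d _.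
  have p : ldeg (J d) - ldeg j + (ldeg i - ldeg (J d)) = ldeg i - ldeg j.
    by rewrite addrC addrA subrK.
  rewrite (rh_compr (lobE i) (lobE (J d)) (lobE j) (lift_homdeg e12 (J d) j) _ _ p).
  exact: act_comp.
- move=> T g g' g'' e e' m; apply: dprodP => i; exact: mdif_mdif.
- move=> S T g h l g' h' l' e el eg eh e1 e2 m f; apply: dprodP => i.
  rewrite dprodD dprodZ /coind_dif /coind_act (linp_sum (mdif_lin _)).
  rewrite scaler_sumr -big_split /=; apply: eq_bigr => c _.
  rewrite -!(lift_pred_at T eg c) /coind_term.
  set j := lift_at T g' c; set j' := lift_pred eg j; set i' := lift_pred el i.
  have q1 : ldeg i' - ldeg j' + delta = ldeg i - ldeg j' by rewrite /= addrAC subrK.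
  have q2 : ldeg j' + delta = ldeg j by rewrite /= subrK.
  have q3 : ldeg j + (ldeg i' - ldeg j') = ldeg i by rewrite /= addrC -addrA; degs.
  have q4 : ldeg j' + (ldeg i - ldeg j') = ldeg i by rewrite addrC subrK.
  rewrite (mdif_act _ _ q2 q1 q3 q4).
  rewrite -(rh_dif (lobE i) (lobE j') (lift_homdeg e i' j') (lift_homdeg e2 i j') q1 eh).
  rewrite (deg_irr q2 (subrK delta (ldeg j))) (deg_irr q4 (lift_actdeg i j')).
  rewrite (ldeg1 j').
  congr (_ + _); exact: act_rh_irr.
Defined.

Lemma coind_irr T G (m : coind_car T G) X (eX : C X = T) g g' g0
    (eg : wdeg n (cwt C X) g = G) (eg' : wdeg n (cwt C X) g' = G)
    (e : g0 + delta = g) (e' : g0 + delta = g') (m0 : N X g0) : g = g' ->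
  m (Lift eX eg) = mdif e m0 -> m (Lift eX eg') = mdif e' m0.
Proof.
by move=> gg; case: g' / gg eg' e' => eg' e'; rewrite (deg_irr eg eg') (deg_irr e e').
Qed.

Lemma coind_dif_irr T G (m : coind_car T G) X (eX : C X = T) g g' l
    (eg : wdeg n (cwt C X) g = G) (eg' : wdeg n (cwt C X) g' = G)
    (e : g + delta = l) (e' : g' + delta = l) :
  mdif e (m (Lift eX eg)) = mdif e' (m (Lift eX eg')).
Proof.
have gg : g = g' by apply: (addIr delta); rewrite e.
by subst g'; rewrite (deg_irr eg eg') (deg_irr e e').
Qed.

(** The differential acts separately on each component, so primitives are chosen componentwise. They
    are indexed by lifts in degree [G - delta], each raised by [delta] to reach a component of m. *)
Lemma coind_acyclic : acyclic N -> acyclic coinduction.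
Proof.
move=> acN T G m cm.
have e : G - delta + delta = G by rewrite subrK.
have closed_m (i : oblift T G) : closed (m i).
  case: i => X g eX eg /=.
  have ei : wdeg n (cwt C X) (g + delta) = G + delta by wdegs eg.
  have := congr1 (fun u : coind_car T _ => u (Lift eX ei)) cm; rewrite dprod0 => H.
  rewrite /closed -[RHS]H; exact: coind_dif_irr.
have up_deg (j : oblift T (G - delta)) : wdeg n (cwt C j) (ldeg j + delta) = G.
  by wdegs (ldegE j).
have ex (j : oblift T (G - delta)) : exists m0 : N j (ldeg j),
    m (Lift (lobE j) (up_deg j)) = mdif erefl m0.
  have [g0 [e0 [m0 em]]] := acN _ _ _ (closed_m (Lift (lobE j) (up_deg j))).
  have g0E : g0 = ldeg j by apply: (addIr delta); rewrite e0.
  by subst g0; exists m0; rewrite em (deg_irr e0 erefl).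
exists (G - delta), e, (fun j => projT1 (cid (ex j))); apply: dprodP => i.
rewrite /= /coind_dif; case: (cid _) => m0 /= em.
case: i m0 em => X g eX eg /= m0; apply: coind_irr; exact: subrK.
Qed.

End Module.
End Coinduction.

(** * Adjunction and duality *)

Section Evaluation.
Variables (k : fieldType) (n : nat) (E' E : adgcat k) (C : adams_cover n E' E).
Variable M : dgmod E.

(* An element of [M], seen in the pullback of [M] at a lift of its object and
   degree. *)
Definition at_lift T G (i : oblift C T G) (m : M T G) : pullback C M i (ldeg i) :=
  mcast (esym (etrans (cdegE C i (ldeg i)) (ldegE i)))
    (ecast T0 (M T0 G) (esym (lobE i)) m).

Lemma at_lift_lin T G (i : oblift C T G) : linear (at_lift i).
Proof.
rewrite /at_lift; move: (esym _); case: i => X g eX eg /=; case: T / eX => e.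
exact: mcast_lin.
Qed.

Lemma at_lift_act S T G H L (e : G + H = L) (i : oblift C S L) (j : oblift C T G) h
    (eh : wdeg n (cwt C i - cwt C j) h = H) (e' : ldeg j + h = ldeg i)
    (u : hom i j h) (m : M T G) :
  at_lift i (act e m (fh (lobE i) (lobE j) eh u)) = act e' (at_lift j m) u.
Proof.
case: i j eh e' u => X g eX eg [Y g' eY eg'] /= eh e' u.
case: S / eX eg; case: T / eY m eg' => m eg' eg; subst H.
rewrite /at_lift /=; symmetry; exact: mcast_act.
Qed.

Lemma at_lift_dif T G G' (e : G + delta = G') X (eX : C X = T) g g'
    (eg : wdeg n (cwt C X) g = G) (eg' : wdeg n (cwt C X) g' = G')
    (e' : g + delta = g') (m : M T G) :
  at_lift (Lift eX eg') (mdif e m) = mdif e' (at_lift (Lift eX eg) m).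
Proof.
case: T / eX m => m; rewrite /at_lift /=; symmetry; exact: mcast_dif.
Qed.

(** The family of all [at_lift i m] is the unit of the adjunction, from M to the coinduction of its
    pullback; this is its E-linearity. *)
Lemma at_lift_sum S T G H L (e : G + H = L) (i : oblift C S L) (J : 'I_n -> oblift C T G)
    (m : M T G) (f : hom S T H) : (forall c, cidx C (J c) = c) ->
  at_lift i (act e m f) = \sum_c act (lift_actdeg i (J c)) (at_lift (J c) m)
    (rh (lobE i) (lobE (J c)) (lift_homdeg e i (J c)) f).
Proof.
move=> iJ; rewrite -{1}(fh_sum_target (lobE i) (fun c => lobE (J c))
    (fun c => lift_homdeg e i (J c)) f iJ).
rewrite (linp_sum (act_linr _ _)) (linp_sum (at_lift_lin i)).
by apply: eq_bigr => c _; apply: at_lift_act.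
Qed.

Lemma hfun_at_base N s (f : dghom (pullback C M) N s) X g g' h
    (eg : wdeg n (cwt C X) g' = cdeg C X g) (e : s + g = h) (e' : s + g' = h)
    (m : M (C X) (cdeg C X g)) :
  hfun f e' (at_lift (Lift (erefl (C X)) eg) m) = hfun f e m.
Proof.
have gg : g' = g by apply: (addrI s); rewrite e.
subst g'; rewrite (deg_irr e' e) /at_lift /=; congr (hfun f e _).
exact: (@mcast_id _ _ M).
Qed.

End Evaluation.

Section Adjunction.
Variables (k : fieldType) (n : nat) (E' E : adgcat k) (C : adams_cover n E' E).
Variables (P : dgmod E) (N : dgmod E').

Lemma lift_sub_deg s T G L (e : wdeg n 0 s + G = L) (i : oblift C T L) :
  wdeg n (cwt C i) (ldeg i - s) = G.
Proof. by wdegs e (ldegE i). Qed.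

Definition lift_sub s T G L (e : wdeg n 0 s + G = L) (i : oblift C T L) : oblift C T G :=
  Lift (lobE i) (lift_sub_deg e i).

Lemma subKdeg (s g : deg) : s + (g - s) = g.
Proof. by rewrite addrC subrK. Qed.

Definition adjunct s (f : dghom (pullback C P) N s) :
  dghom P (coinduction C N) (wdeg n 0 s).
Proof.
refine (@Dghom k E P (coinduction C N) (wdeg n 0 s) (fun T G L e m i =>
  hfun f (subKdeg s (ldeg i)) (at_lift (lift_sub e i) m)) _ _).
- move=> T G L e a u v; apply: dprodP => i.
  by rewrite dprodD dprodZ at_lift_lin hfun_lin.
- move=> S T g h l g' l' e eg el e' m f'; apply: dprodP => i.
  have iJ c : cidx C (lift_sub eg (lift_at C T g' c)) = c by rewrite /= lift_atE.
  rewrite (at_lift_sum e (lift_sub el i) _ _ iJ) (linp_sum (hfun_lin _ _)).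
  apply: eq_bigr => c _; set j := lift_at C T g' c.
  have p : ldeg j + (ldeg (lift_sub el i) - ldeg (lift_sub eg j)) = ldeg i.
    rewrite /=; degs.
  rewrite (hfun_act f _ (subKdeg s (ldeg j)) _ p); exact: act_rh_irr.
Defined.

Lemma adjunct_closed s (f : dghom (pullback C P) N s) :
  hdif erefl f = 0 -> hdif erefl (adjunct f) = 0.
Proof.
move=> cf; apply: dghomP => T G L e m; apply: dprodP => i.
have p1 : wdeg n 0 s + G + delta = L by rewrite -e; degs.
have p2 : wdeg n 0 s + (G + delta) = L by rewrite -e; degs.
rewrite (hdifE erefl _ _ _ erefl p1 erefl p2).
pose i' := lift_sub erefl (lift_pred p1 i).
have q1 : s + delta + ldeg i' = ldeg i by rewrite /=; degs.
have q2 : ldeg i' + delta = ldeg i - s by rewrite /=; degs.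
have := congr1 (fun f => hfun f q1 (at_lift i' m)) cf.
rewrite (hdifE erefl _ _ _ (subKdeg s (ldeg i - delta)) (subrK delta _) q2 (subKdeg s _)) /=.
move=> H; apply: etrans _ H; rewrite dprodD dprodN dprodZ.
congr (_ - _ *: _); congr (hfun f _ _).
exact: (at_lift_dif erefl (lobE i) (lift_sub_deg erefl (lift_pred p1 i))
  (lift_sub_deg p2 i) q2).
Qed.

Lemma adjunct_inv_deg s s' X g g' : wdeg n 0 s = s' -> s + g = g' ->
  s' + cdeg C X g = wdeg n (cwt C X) g'.
Proof. by rewrite cdegE => e e'; wdegs e e'. Qed.

(** Composition with the counit, which takes the component at the tautological lift. The degree is a
    variable [s'] with an equation since the maps to be transposed back have a degree known only up
    to equality. *)
Definition adjunct_inv s s' (es : wdeg n 0 s = s') (f : dghom P (coinduction C N) s') :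
  dghom (pullback C P) N s.
Proof.
refine (@Dghom k E' (pullback C P) N s (fun X g g' e m =>
  (hfun f (adjunct_inv_deg X es e) m : coind_car C N _ _)
    (Lift (erefl (C X)) (erefl (wdeg n (cwt C X) g')))) _ _).
- by move=> X g g' e a u v; rewrite hfun_lin.
- move=> X Y g h l g' l' e eg el e' m u.
  have p : wdeg n (cwt C Y) g' + wdeg n (cwt C X - cwt C Y) h = wdeg n (cwt C X) l'.
    by wdegs e'.
  rewrite (hfun_act f _ (adjunct_inv_deg Y es eg) _ p).
  exact: (coind_act_fh p _ (i := Lift (erefl (C X)) erefl) (j := Lift (erefl (C Y)) erefl)).
Defined.

End Adjunction.

(** The transpose of a closed map is closed and takes values in an acyclic module, hence it is a
    boundary; the transpose of the bounding map bounds f. *)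
Lemma pullback_kprojective k n (E' E : adgcat k) (C : adams_cover n E' E) P :
  kprojective P -> kprojective (pullback C P).
Proof.
move=> kP N acN s f cf.
have [s1 [e1 [f1 ef]]] := kP _ (coind_acyclic acN) _ _ (adjunct_closed cf).
(* Transposing back requires the Adams part of [s1] to be a multiple of n; it is that of
   [wdeg n 0 s], as [delta] has Adams part 0. *)
have es : wdeg n 0 (s - delta) = s1 by wdegs e1.
have e0 : s - delta + delta = s by rewrite subrK.
exists (s - delta), e0, (adjunct_inv es f1); apply: dghomP => X g g' e m.
have p1 : s - delta + g + delta = g' by degs.
have p2 : s - delta + (g + delta) = g' by degs.
rewrite (hdifE e0 _ _ _ erefl p1 erefl p2).
have q : wdeg n 0 s + cdeg C X g = wdeg n (cwt C X) g' by exact: adjunct_inv_deg.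
(* At this tautological lift, the transpose of f takes the value of f itself, by [hfun_at_base]. *)
pose i := Lift (erefl (C X)) (erefl (wdeg n (cwt C X) g')).
have := congr1 (fun f : dghom P (coinduction C N) _ => (hfun f q m : coind_car C N _ _) i) ef.
have r1 : s1 + cdeg C X g + delta = wdeg n (cwt C X) g' by rewrite -q -e1; degs.
have r2 : s1 + cdeg C X (g + delta) = wdeg n (cwt C X) g' by exact: adjunct_inv_deg es p2.
rewrite (hdifE e1 _ _ _ erefl r1 (cdeg_delta C X erefl) r2).
rewrite dprodD dprodN dprodZ => H.
apply: etrans (etrans H _); first exact/esym/hfun_at_base.
have -> : ksg s1.1 = ksg (s - delta).1 :> k by rewrite -es.
congr (_ - _ *: _).
  have gen h G (a : s1 + cdeg C X g = G) (b : wdeg n (cwt C X) h = G)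
      (b' : wdeg n (cwt C X) h = s1 + cdeg C X g) :
      (hfun f1 a m : coind_car C N _ _) (Lift (erefl (C X)) b)
      = (hfun f1 erefl m : coind_car C N _ _) (Lift (erefl (C X)) b').
    by case: G / a b => b; rewrite (deg_irr b b').
  rewrite /= (gen _ _ _ _ (esym (adjunct_inv_deg C X es erefl))).
  exact: coind_dif_irr.
by rewrite /= (deg_irr r2 (adjunct_inv_deg C X es p2)).
Qed.

(** * Maps from a pullback into a representable *)

Section Duality.
Variables (k : fieldType) (n : nat) (E' E : adgcat k) (C : adams_cover n E' E).
Variables (P : dgmod E) (X' : E') (s S : deg) (es : wdeg n (- cwt C X') s = S).

Lemma dual_deg1 Y g g' : s + g = g' ->
  S + cdeg C Y g = wdeg n (cwt C Y - cwt C X') g'.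
Proof. by rewrite cdegE => e; wdegs es e. Qed.

Definition pullback_hom (f : dghom P (representable (C X')) S) :
  dghom (pullback C P) (representable X') s.
Proof.
refine (@Dghom k E' (pullback C P) (representable X') s (fun Y g g' e m =>
  rh (erefl (C Y)) (erefl (C X')) erefl (hfun f (dual_deg1 Y e) m)) _ _).
- by move=> Y g g' e a u v; rewrite hfun_lin rh_lin.
- move=> Y Z g h l g' l' e eg el e' m u.
  have p : wdeg n (cwt C Z - cwt C X') g' + wdeg n (cwt C Y - cwt C Z) h
    = wdeg n (cwt C Y - cwt C X') l' by wdegs e'.
  rewrite (hfun_act f _ (dual_deg1 Z eg) _ p); exact: rh_compr.
Defined.

Lemma dual_deg2 T G L (i : oblift C T G) : S + G = L ->
  wdeg n (cwt C i - cwt C X') (s + ldeg i) = L.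
Proof. by move=> e; wdegs es e (ldegE i). Qed.

(** Sums over the lifts of T identify the coinduction of the representable at [X'] with the
    representable at [C X']; under this identification the formula is the transpose of f. The two
    cancellation laws below are the splitting over source lifts and the orthogonality of its
    components. *)
Definition pullback_hom_inv (f : dghom (pullback C P) (representable X') s) :
  dghom P (representable (C X')) S.
Proof.
refine (@Dghom k E P (representable (C X')) S (fun T G L e m =>
  \sum_c fh (lobE (lift_at C T G c)) (erefl (C X')) (dual_deg2 (lift_at C T G c) e)
    (hfun f erefl (at_lift (lift_at C T G c) m))) _ _).
- move=> T G L e; apply: lin_sum => c a u v.
  by rewrite at_lift_lin hfun_lin fh_lin.
- move=> R T g h l g' l' e eg el e' m u.
  rewrite /= (linp_sum (comp_linl _ _)).
  pose J c := lift_at C T g c; pose I c := lift_at C R l c.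
  have iJ c : cidx C (J c) = c by apply: lift_atE.
  (* Here d runs over the lifts of T and c over those of R. Once the sums are exchanged, the sum
     over c reassembles u from its components. *)
  transitivity (\sum_c \sum_d comp e'
      (fh (lobE (J d)) (erefl (C X')) (dual_deg2 (J d) eg) (hfun f erefl (at_lift (J d) m)))
      (fh (lobE (I c)) (lobE (J d)) (lift_homdeg e (I c) (J d))
        (rh (lobE (I c)) (lobE (J d)) (lift_homdeg e (I c) (J d)) u))).
    apply: eq_bigr => c _; rewrite -/(I c) (at_lift_sum e (I c) _ _ iJ).
    rewrite (linp_sum (hfun_lin _ _)).
    have sumfh F : fh (lobE (I c)) (erefl (C X')) (dual_deg2 (I c) el) (\sum_d F d)
      = \sum_d fh (lobE (I c)) (erefl (C X')) (dual_deg2 (I c) el) (F d).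
      exact: (linp_sum (fh_lin _ _ _)).
    rewrite [LHS]sumfh; apply: eq_bigr => d _.
    have p : s + ldeg (J d) + (ldeg (I c) - ldeg (J d)) = s + ldeg (I c).
      by rewrite -addrA lift_actdeg.
    rewrite (hfun_act f _ erefl erefl p); exact: fh_comp.
  rewrite exchange_big /=; apply: eq_bigr => d _; rewrite -(linp_sum (comp_linr _ _)).
  congr (comp _ _ _).
  exact: (fh_sum_source (lobE (J d)) (fun c => lobE (I c))
    (fun c => lift_homdeg e (I c) (J d)) u (fun c => lift_atE _ _ _ _)).
Defined.

Lemma hfun_mcast (M N : dgmod E) t (f : dghom M N t) T g g' L (r : g = g')
    (e : t + g' = L) (e' : t + g = L) (m : M T g) : hfun f e (mcast r m) = hfun f e' m.
Proof. by case: g' / r e => e; rewrite (deg_irr e e'). Qed.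

Lemma rh_at_lift (f : dghom P (representable (C X')) S) T G L (e : S + G = L)
    (i : oblift C T G) (m : P T G) :
  rh (erefl (C i)) (erefl (C X')) erefl
      (hfun f (dual_deg1 i (erefl (s + ldeg i))) (at_lift i m))
    = rh (lobE i) (erefl (C X')) (dual_deg2 i e) (hfun f e m).
Proof.
rewrite /at_lift; move: (dual_deg1 _ _) (dual_deg2 _ _) (esym (etrans _ _)).
case: i => X g eX eg /=; case: T / eX m => m p q r; case: L / q e => e.
congr (rh _ _ _ _); exact: (@hfun_mcast P (representable (C X'))).
Qed.

Lemma pullback_homK : cancel pullback_hom pullback_hom_inv.
Proof.
move=> f; apply: dghomP => T G L e m /=.
pose J c := lift_at C T G c.
have iJ c : cidx C (J c) = c by apply: lift_atE.
rewrite -[RHS](fh_sum_source (erefl (C X')) (fun c => lobE (J c))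
  (fun c => dual_deg2 (J c) e) _ iJ).
by apply: eq_bigr => c _; rewrite -/(J c) (rh_at_lift f e).
Qed.

Lemma pullback_hom_invK : cancel pullback_hom_inv pullback_hom.
Proof.
move=> f; apply: dghomP => Y g g' e m /=; case: g' / e.
(* Projection to Y kills every summand except that of Y itself, viewed as a lift of its own
   image. *)
pose i := Lift (erefl (C Y)) (esym (cdegE C Y g)).
rewrite (linp_sum (rh_lin _ _ _)) (bigD1 (cidx C i)) //= big1 ?addr0; last first.
  by move=> c /eqP ci; rewrite rh_fh_source ?lift_atE.
rewrite (lift_at_idx i); move: (dual_deg2 _ _) => /= q; rewrite (deg_irr q erefl) rh_fh.
exact: (@hfun_at_base _ _ _ _ C P (representable X')).
Qed.

End Duality.

(** * The enveloping category of a quasi-Veronese category *)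

Section EnvPure.
Variables (k : fieldType) (A : adgcat k).
Implicit Types x y z : envcat A.

(** A pure tensor with its type fixed to a Hom space of [envcat A], so that composition and
    differential are recognized as those of the enveloping category. *)
Definition env_pure x y l g h (e : g + h = l) (f : @hom k (opcat A) x.1 y.1 g)
  (u : @hom k A x.2 y.2 h) : hom x y l := pure e f u.

Lemma env_pure_ext x y l (W : lmodType k) (p q : hom x y l -> W) :
  linear p -> linear q ->
  (forall g h (e : g + h = l) f u, p (env_pure e f u) = q (env_pure e f u)) ->
  forall t, p t = q t.
Proof. exact: tens_ext. Qed.

Lemma env_pure_linl x y l g h (e : g + h = l) u :
  linear (fun f => @env_pure x y l g h e f u).
Proof. exact: pure_linl. Qed.

Lemma env_pure_linr x y l g h (e : g + h = l) f : linear (@env_pure x y l g h e f).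
Proof. exact: pure_linr. Qed.

Lemma env_pure_id x g h l (eg : g = 0) (eh : h = 0) (e : g + h = l) (el : l = 0) :
  @env_pure x x l g h e (@idm k (opcat A) x.1 g eg) (idm x.2 eh) = idm x el.
Proof.
subst g h; rewrite /env_pure /= /tidm.
by rewrite (deg_irr e (etrans (addr0 (0 : deg)) (esym el))).
Qed.

Lemma env_pure_comp x y z g h l (e : g + h = l)
    g1 g2 (eg : g1 + g2 = g) h1 h2 (eh : h1 + h2 = h)
    l1 l2 (e1 : g1 + h1 = l1) (e2 : g2 + h2 = l2) (el : l1 + l2 = l)
    (f : @hom k (opcat A) y.1 z.1 g1) u (f' : @hom k (opcat A) x.1 y.1 h1) u' :
  comp e (env_pure eg f u) (env_pure eh f' u')
    = ksg (g2.1 * h1.1) *: @env_pure x z _ _ _ el (comp e1 f f') (comp e2 u u').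
Proof. exact: tcompE. Qed.

Lemma env_pure_dif x y g g' (e : g + delta = g')
    g1 g2 (eg : g1 + g2 = g) g1' g2' (e1 : g1 + delta = g1')
    (e2 : g2 + delta = g2') (el : g1' + g2 = g') (er : g1 + g2' = g')
    (f : @hom k (opcat A) x.1 y.1 g1) u :
  dif e (env_pure eg f u)
    = env_pure el (dif e1 f) u + ksg g1.1 *: @env_pure x y _ _ _ er f (dif e2 u).
Proof. exact: tdifE. Qed.

Lemma env_pure_swap x y l g h (e : g + h = l) (e' : h + g = l)
    (f : @hom k (opcat A) x.1 y.1 g) (u : @hom k A x.2 y.2 h) :
  fhom (env_swap A) (env_pure e f u)
    = ksg (g.1 * h.1) *: @env_pure (y.2, y.1) (x.2, x.1) l h g e' u f.
Proof. exact: swapE. Qed.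

Lemma env_pure_act x y g h l (e : g + h = l) (m : diagonal A y g) h1 h2 (eh : h1 + h2 = h)
    (f : @hom k (opcat A) x.1 y.1 h1) (u : @hom k A x.2 y.2 h2)
    j (ej : g + h2 = j) (ej' : h1 + j = l) :
  act e m (env_pure eh f u)
    = ksg (h1.1 * g.1) *: @comp k A x.2 y.1 x.1 _ _ _ ej' f (comp ej (m : @hom k A y.2 y.1 g) u).
Proof. exact: bactE. Qed.

End EnvPure.

Section EnvCover.
Variables (k : fieldType) (n : nat) (A : adgcat k).
Let B := quasi_veronese n A.
Let E := envcat A.
Let E' := envcat B.
Implicit Types X Y Z : E'.

Definition env_ob X : E := (X.1.1, X.2.1).
Definition env_wt X : int := (X.1.2 : nat)%:Z - (X.2.2 : nat)%:Z.
(** The first copy index alone names a lift: once the total degree is fixed, the second index is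
    determined by its residue modulo n. *)
Definition env_idx X : 'I_n := X.1.2.
(** Convertible with the degree that occurs in the diagonal of B, but only propositionally equal to
    a [wdeg]; this is why a cover carries [cdeg] as separate data. *)
Definition env_deg X : deg -> deg := vdeg X.1.2 X.2.2.

Lemma env_degE X g : env_deg X g = wdeg n (env_wt X) g.
Proof. by rewrite /env_deg /env_wt /vdeg /wdeg; apply: deg_ext => //=; lia. Qed.

Lemma env_pure_deg X Y g G g1 g2 : wdeg n (env_wt X - env_wt Y) g = G -> g1 + g2 = g ->
  vdeg X.1.2 Y.1.2 g1 + vdeg Y.2.2 X.2.2 g2 = G.
Proof. by rewrite /env_wt /vdeg => e e'; wdegs e e'. Qed.

Definition env_hom_pure X Y g G (e : wdeg n (env_wt X - env_wt Y) g = G)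
    g1 g2 (eg : g1 + g2 = g) (f : @hom k (opcat B) X.1 Y.1 g1) (u : @hom k B X.2 Y.2 g2) :
    hom (env_ob X) (env_ob Y) G :=
  @env_pure k A (env_ob X) (env_ob Y) G _ _ (env_pure_deg e eg) f u.

Definition env_hom X Y g G (e : wdeg n (env_wt X - env_wt Y) g = G) (t : hom X Y g) :
  hom (env_ob X) (env_ob Y) G := tlift (env_hom_pure e) t.

Lemma env_hom_bilin X Y g G (e : wdeg n (env_wt X - env_wt Y) g = G) :
  bilin (env_hom_pure e).
Proof.
split=> g1 g2 eg w.
- exact: (@env_pure_linl k A (env_ob X) (env_ob Y) _ _ _ (env_pure_deg e eg) w).
- exact: (@env_pure_linr k A (env_ob X) (env_ob Y) _ _ _ (env_pure_deg e eg) w).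
Qed.

Lemma env_hom_lin X Y g G (e : wdeg n (env_wt X - env_wt Y) g = G) : linear (env_hom e).
Proof. exact: tlift_lin (env_hom_bilin e). Qed.

Lemma env_homE X Y g G (e : wdeg n (env_wt X - env_wt Y) g = G)
    g1 g2 (eg : g1 + g2 = g) (eG : vdeg X.1.2 Y.1.2 g1 + vdeg Y.2.2 X.2.2 g2 = G)
    (f : @hom k (opcat B) X.1 Y.1 g1) (u : @hom k B X.2 Y.2 g2) :
  env_hom e (env_pure eg f u) = @env_pure k A (env_ob X) (env_ob Y) G _ _ eG f u.
Proof.
rewrite /env_hom /env_pure (tlift_pure (env_hom_bilin e)) /env_hom_pure.
by rewrite (deg_irr (env_pure_deg e eg) eG).
Qed.

(* The degree [g] with [vdeg c c' g = h] when there is one, junk otherwise (see [vdivP]). *)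
Definition vdiv (c c' : 'I_n) (h : deg) : deg :=
  (h.1, ((h.2 - (c : nat)%:Z + (c' : nat)%:Z) %/ n%:Z)%Z).

Lemma ord_gt0 (c : 'I_n) : n%:Z != 0.
Proof. by rewrite -lt0n (leq_trans _ (ltn_ord c)). Qed.

Lemma vdivK (c c' : 'I_n) g : vdiv c c' (vdeg c c' g) = g.
Proof.
apply: deg_ext => //=; rewrite [X in (X %/ _)%Z](_ : _ = g.2 * n%:Z); last by lia.
exact: mulzK (ord_gt0 c).
Qed.

Lemma vdivP (c c' : 'I_n) h :
  reflect (vdeg c c' (vdiv c c' h) = h) (n%:Z %| h.2 - (c : nat)%:Z + (c' : nat)%:Z)%Z.
Proof.
apply: (iffP idP) => [d|<-].
  by apply: deg_ext => //=; rewrite mulrC divzK //; lia.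
by apply/dvdzP; exists (vdiv c c' h).2; rewrite /=; lia.
Qed.

Lemma env_rest_deg X Y g G g1 h1 h2 : wdeg n (env_wt X - env_wt Y) g = G ->
  h1 + h2 = G -> vdeg X.1.2 Y.1.2 g1 = h1 -> vdeg Y.2.2 X.2.2 (g - g1) = h2.
Proof. by rewrite /env_wt /vdeg => e e' e''; wdegs e e' e''. Qed.

(** Keeps a pure tensor when the degree of its first factor has the residue prescribed by X and Y,
    and sends it to 0 otherwise. The residue of the second factor then follows from the total
    degree, by [env_rest_deg]. *)
Definition env_res_pure X Y g G (e : wdeg n (env_wt X - env_wt Y) g = G)
    h1 h2 (eh : h1 + h2 = G) (f : @hom k (opcat A) X.1.1 Y.1.1 h1)
    (u : @hom k A X.2.1 Y.2.1 h2) : hom X Y g :=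
  match vdivP X.1.2 Y.1.2 h1 with
  | ReflectT p => @env_pure k B X Y g _ _ (subKdeg (vdiv X.1.2 Y.1.2 h1) g)
      (ecast i (@hom k (opcat A) X.1.1 Y.1.1 i) (esym p) f)
      (ecast i (@hom k A X.2.1 Y.2.1 i) (esym (env_rest_deg e eh p)) u)
  | ReflectF _ => 0
  end.

Definition env_res X Y g G (e : wdeg n (env_wt X - env_wt Y) g = G)
  (t : hom (env_ob X) (env_ob Y) G) : hom X Y g := tlift (env_res_pure e) t.

Lemma ecast_lin (F : deg -> lmodType k) i j (e : i = j) : linear (fun v : F i => ecast l (F l) e v).
Proof. by case: j / e. Qed.

Lemma env_res_bilin X Y g G (e : wdeg n (env_wt X - env_wt Y) g = G) :
  bilin (env_res_pure e).
Proof.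
split=> h1 h2 eh w; rewrite /env_res_pure; case: vdivP => p.
- exact: (lin_comp (@env_pure_linl k B X Y _ _ _ (subKdeg _ g) _)
    (@ecast_lin (@hom k (opcat A) X.1.1 Y.1.1) _ _ (esym p))).
- by move=> a u v; rewrite scaler0 addr0.
- exact: (lin_comp (@env_pure_linr k B X Y _ _ _ (subKdeg _ g) _)
    (@ecast_lin (@hom k A X.2.1 Y.2.1) _ _ (esym (env_rest_deg e eh p)))).
- by move=> a u v; rewrite scaler0 addr0.
Qed.

Lemma env_res_lin X Y g G (e : wdeg n (env_wt X - env_wt Y) g = G) : linear (env_res e).
Proof. exact: tlift_lin (env_res_bilin e). Qed.

Lemma env_resE X Y g G (e : wdeg n (env_wt X - env_wt Y) g = G)
    g1 g2 (eg : g1 + g2 = g) (eG : vdeg X.1.2 Y.1.2 g1 + vdeg Y.2.2 X.2.2 g2 = G)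
    (f : @hom k (opcat B) X.1 Y.1 g1) (u : @hom k B X.2 Y.2 g2) :
  env_res e (@env_pure k A (env_ob X) (env_ob Y) G _ _ eG f u) = env_pure eg f u.
Proof.
rewrite /env_res {1}/env_pure (tlift_pure (env_res_bilin e)) /env_res_pure.
case: vdivP => [p|]; last by case; rewrite vdivK.
have e2 : g - g1 = g2 by rewrite -eg addrAC subrr add0r.
move: (esym (env_rest_deg e eG p)) (esym p) (subKdeg _ g); rewrite vdivK e2 => r q s.
by rewrite (deg_irr r erefl) (deg_irr q erefl) (deg_irr s eg).
Qed.

Lemma env_res0 X Y g G (e : wdeg n (env_wt X - env_wt Y) g = G)
    h1 h2 (eh : h1 + h2 = G) (f : @hom k (opcat A) X.1.1 Y.1.1 h1)
    (u : @hom k A X.2.1 Y.2.1 h2) :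
  ~~ (n%:Z %| h1.2 - (X.1.2 : nat)%:Z + (Y.1.2 : nat)%:Z)%Z ->
  env_res e (@env_pure k A (env_ob X) (env_ob Y) G _ _ eh f u) = 0.
Proof.
rewrite /env_res /env_pure (tlift_pure (env_res_bilin e)) /env_res_pure.
by case: vdivP.
Qed.

Lemma env_homK X Y g G (e : wdeg n (env_wt X - env_wt Y) g = G) :
  cancel (env_hom e) (env_res e).
Proof.
apply: env_pure_ext => //; first exact: (lin_comp (env_res_lin e) (env_hom_lin e)).
move=> g1 g2 eg f u; rewrite (env_homE e eg (env_pure_deg e eg)); exact: env_resE.
Qed.

Lemma env_resK X Y g G (e : wdeg n (env_wt X - env_wt Y) g = G)
    h1 h2 (eh : h1 + h2 = G) (f : @hom k (opcat A) X.1.1 Y.1.1 h1)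
    (u : @hom k A X.2.1 Y.2.1 h2) :
  env_hom e (env_res e (@env_pure k A (env_ob X) (env_ob Y) G _ _ eh f u)) =
  if (n%:Z %| h1.2 - (X.1.2 : nat)%:Z + (Y.1.2 : nat)%:Z)%Z
  then @env_pure k A (env_ob X) (env_ob Y) G _ _ eh f u else 0.
Proof.
case: ifPn => [/vdivP p|p]; last by rewrite env_res0 // (linp0 (env_hom_lin e)).
have p2 := env_rest_deg e eh p; move: (vdiv _ _ _) p p2 => q p p2.
case: h2 / p2 u eh => u eh; case: h1 / p f eh => f eh.
rewrite (@env_resE X Y g G e _ _ (subKdeg _ g) eh f u); exact: env_homE.
Qed.

(** Exactly one index has the residue of [- z]. The index [c0] guarantees that n is non-zero;
    otherwise the sum would be empty. *)
Lemma sum_residue (V : zmodType) (z : int) (v : V) (c0 : 'I_n) :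
  \sum_(c < n) (if (n%:Z %| z + (c : nat)%:Z)%Z then v else 0) = v.
Proof.
have n0 : n%:Z != 0 := ord_gt0 c0.
have r0 : 0 <= ((- z) %% n%:Z)%Z by exact: modz_ge0.
have rn : (((- z) %% n%:Z)%Z < n%:Z) by apply: ltz_pmod; lia.
have rn' : (`|((- z) %% n%:Z)%Z| < n)%N by lia.
pose c1 := Ordinal rn'.
have dvd (c : 'I_n) : (n%:Z %| z + (c : nat)%:Z)%Z = (c == c1).
  rewrite addrC -[z in _ + z]opprK -eqz_mod_dvd (modz_small (m := (c : nat)%:Z)).
    by rewrite -val_eqE /=; lia.
  by have := ltn_ord c; lia.
rewrite (bigD1 c1) // dvd eqxx big1 /= ?addr0 // => c /negPf.
by rewrite dvd => ->.
Qed.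

Lemma residue_inj (c c' : 'I_n) (z z' : int) :
  n%:Z * z + (c : nat)%:Z = n%:Z * z' + (c' : nat)%:Z -> c = c' /\ z = z'.
Proof.
move=> e; have cn := ltn_ord c; have c'n := ltn_ord c'.
have zz : z = z'.
  case: (ltgtP z z') => [zz|zz|->] //; exfalso.
    (* Distinct quotients put the two products at least n apart, whereas c and [c'] differ by less
       than n. *)
    have : 0 <= n%:Z * (z' - z - 1) by rewrite mulr_ge0 //; lia.
    by rewrite !mulrBr mulr1; lia.
  have : 0 <= n%:Z * (z - z' - 1) by rewrite mulr_ge0 //; lia.
  by rewrite !mulrBr mulr1; lia.
by split=> //; apply: val_inj => /=; lia.
Qed.

Lemma env_hom_id X g G (e : wdeg n (env_wt X - env_wt X) g = G) (e0 : g = 0) (e1 : G = 0) :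
  env_hom e (idm X e0) = idm (env_ob X) e1.
Proof.
have z : 0 + 0 = g by rewrite addr0.
rewrite -(@env_pure_id k B X 0 0 g erefl erefl z e0) (env_homE e z (env_pure_deg e z)).
exact: (@env_pure_id k A (env_ob X) _ _ G (vdeg0 X.1.2 erefl) (vdeg0 X.2.2 erefl)).
Qed.

Lemma env_hom_comp X Y Z g h l G H L (eg : wdeg n (env_wt Y - env_wt Z) g = G)
    (eh : wdeg n (env_wt X - env_wt Y) h = H) (el : wdeg n (env_wt X - env_wt Z) l = L)
    (e : g + h = l) (e' : G + H = L) (t : hom Y Z g) (s : hom X Y h) :
  env_hom el (comp e t s) = comp e' (env_hom eg t) (env_hom eh s).
Proof.
move: t; apply: env_pure_ext.
- exact: (lin_comp (env_hom_lin el) (comp_linl e s)).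
- exact: (lin_comp (comp_linl e' _) (env_hom_lin eg)).
move=> a1 a2 ea f u; move: s; apply: env_pure_ext.
- exact: (lin_comp (env_hom_lin el) (comp_linr e _)).
- exact: (lin_comp (comp_linr e' _) (env_hom_lin eh)).
move=> b1 b2 eb f' u'.
have E1 : a1 + b1 + (a2 + b2) = l by degs.
rewrite (env_pure_comp e ea eb erefl erefl E1) (linpZ (env_hom_lin el)).
rewrite (env_homE el E1 (env_pure_deg el E1)).
rewrite (env_homE eg ea (env_pure_deg eg ea)) (env_homE eh eb (env_pure_deg eh eb)).
have p1 : vdeg Y.1.2 Z.1.2 a1 + vdeg X.1.2 Y.1.2 b1 = vdeg X.1.2 Z.1.2 (a1 + b1).
  by rewrite addrC; apply: vdegD; rewrite addrC.
have p2 : vdeg Z.2.2 Y.2.2 a2 + vdeg Y.2.2 X.2.2 b2 = vdeg Z.2.2 X.2.2 (a2 + b2).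
  by apply: vdegD.
rewrite [RHS](@env_pure_comp k A (env_ob X) (env_ob Y) (env_ob Z) _ _ _ e' _ _ _ _ _ _ _ _
  p1 p2 (env_pure_deg el E1)) /=.
congr (_ *: _); move: (opp_deg p1) => q1.
rewrite (deg_irr q1 (vdegD Y.1.2 X.1.2 Z.1.2 (opp_deg (erefl (a1 + b1))))).
by rewrite (deg_irr p2 (vdegD Y.2.2 Z.2.2 X.2.2 erefl)).
Qed.

Lemma env_hom_dif X Y g g' G G' (eg : wdeg n (env_wt X - env_wt Y) g = G)
    (eg' : wdeg n (env_wt X - env_wt Y) g' = G') (e : g + delta = g') (e' : G + delta = G')
    (t : hom X Y g) : env_hom eg' (dif e t) = dif e' (env_hom eg t).
Proof.
move: t; apply: env_pure_ext.
- exact: (lin_comp (env_hom_lin eg') (dif_lin e)).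
- exact: (lin_comp (dif_lin e') (env_hom_lin eg)).
move=> a1 a2 ea f u.
have E1 : a1 + delta + a2 = g' by degs.
have E2 : a1 + (a2 + delta) = g' by degs.
rewrite (env_pure_dif e ea erefl erefl E1 E2) (linpD (env_hom_lin eg')).
rewrite (linpZ (env_hom_lin eg')) (env_homE eg' E1 (env_pure_deg eg' E1)).
rewrite (env_homE eg' E2 (env_pure_deg eg' E2)) (env_homE eg ea (env_pure_deg eg ea)).
exact/esym/(@env_pure_dif k A (env_ob X) (env_ob Y) _ _ e').
Qed.

Lemma env_fiber_inj Y Y' g g' : env_ob Y = env_ob Y' -> env_idx Y = env_idx Y' ->
  wdeg n (env_wt Y) g = wdeg n (env_wt Y') g' -> Y = Y' /\ g = g'.
Proof.
case: Y Y' => [[y1 c] [y2 r]] [[y1' c'] [y2' r']]; rewrite /env_ob /env_idx /= => -[-> ->] -> e.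
have e1 := congr1 fst e; have e2 := congr1 snd e; rewrite /env_wt /= in e1 e2.
have [] := @residue_inj r r' (- g.2) (- g'.2) _; first by lia.
by move=> -> ee; split=> //; apply: deg_ext => //; lia.
Qed.

Lemma env_fiber_ex (T : E) (c : 'I_n) G :
  exists Y g, [/\ env_ob Y = T, env_idx Y = c & wdeg n (env_wt Y) g = G].
Proof.
(* With r the second index and g the Adams degree sought, n g + c - r = [G.2] reads r - n g = q: r
   is the remainder of q and - g its quotient. *)
pose q := (c : nat)%:Z - G.2.
have n0 : n%:Z != 0 := ord_gt0 c.
have r0 : 0 <= (q %% n%:Z)%Z by exact: modz_ge0.
have rn : ((q %% n%:Z)%Z < n%:Z) by apply: ltz_pmod; lia.
have rn' : (`|(q %% n%:Z)%Z| < n)%N by lia.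
exists ((T.1, c), (T.2, Ordinal rn')), (G.1, - (q %/ n%:Z)%Z); split=> //.
  by case: T.
apply: deg_ext => //; rewrite /env_wt /=; have := divz_eq q n%:Z; rewrite /q; lia.
Qed.

Lemma hcast_lin (X Y S T : E) G (eX : X = S) (eY : Y = T) : linear (@hcast k E X Y S T G eX eY).
Proof. by case: S / eX; case: T / eY. Qed.

(** In the image of [env_hom], first factors have Adams degrees n z + [X.1.2] - [Y.1.2]; the
    hypothesis says that none has the residue retained for [X'] and [Y']. It serves for a change of
    target as well as of source. *)
Lemma env_res_hom_other X Y X' Y' (eX : env_ob X = env_ob X') (eY : env_ob Y = env_ob Y') g g' G
    (e : wdeg n (env_wt X - env_wt Y) g = G) (e' : wdeg n (env_wt X' - env_wt Y') g' = G)
    (f : hom X Y g) :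
  (forall z : int, ~~ (n%:Z %| n%:Z * z + (X.1.2 : nat)%:Z - (Y.1.2 : nat)%:Z
     - (X'.1.2 : nat)%:Z + (Y'.1.2 : nat)%:Z)%Z) ->
  env_res e' (hcast eX eY (env_hom e f)) = 0.
Proof.
case: X' eX e' => [[x1' cX'] [x2' rX']]; case: X e f => [[x1 cX] [x2 rX]].
case: Y' eY => [[y1' cY'] [y2' rY']]; case: Y => [[y1 cY] [y2 rY]].
rewrite /env_ob /= => eY e f eX e' dvd.
have := congr1 fst eX; have := congr1 snd eX.
have := congr1 fst eY; have := congr1 snd eY.
rewrite /= => ? ? ? ?; subst x1' x2' y1' y2'.
rewrite (Prop_irrelevance eX erefl) (Prop_irrelevance eY erefl) /hcast /=.
move: f; apply: (@env_pure_ext k B (x1, cX, (x2, rX)) (y1, cY, (y2, rY)) g _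
  (fun f => env_res e' (env_hom e f)) (fun=> 0)).
- exact: (lin_comp (env_res_lin e') (env_hom_lin e)).
- by move=> a u v; rewrite scaler0 addr0.
move=> g1 g2 eg f u; rewrite (env_homE e eg (env_pure_deg e eg)).
by apply: env_res0; apply: dvd.
Qed.

Lemma env_res_hom_target X Y Y' T (eY : env_ob Y = T) (eY' : env_ob Y' = T) g g' G
    (e : wdeg n (env_wt X - env_wt Y) g = G) (e' : wdeg n (env_wt X - env_wt Y') g' = G)
    (f : hom X Y g) : env_idx Y <> env_idx Y' ->
  env_res e' (hcast erefl (etrans eY (esym eY')) (env_hom e f)) = 0.
Proof.
move=> ne; apply: env_res_hom_other => z; apply/dvdzP => -[q eq]; apply: ne.
have [] // := @residue_inj Y.1.2 Y'.1.2 (- z) (- q); by lia.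
Qed.

Lemma env_res_hom_source X X' Y S (eX : env_ob X = S) (eX' : env_ob X' = S) g g' G
    (e : wdeg n (env_wt X - env_wt Y) g = G) (e' : wdeg n (env_wt X' - env_wt Y) g' = G)
    (f : hom X Y g) : env_idx X <> env_idx X' ->
  env_res e' (hcast (etrans eX (esym eX')) erefl (env_hom e f)) = 0.
Proof.
move=> ne; apply: env_res_hom_other => z; apply/dvdzP => -[q eq]; apply: ne.
have [] // := @residue_inj X.1.2 X'.1.2 z q; by lia.
Qed.

Lemma env_hcast_res X Y S T (eX : env_ob X = S) (eY : env_ob Y = T) g G
    (e : wdeg n (env_wt X - env_wt Y) g = G) h1 h2 (eh : h1 + h2 = G)
    (f : @hom k (opcat A) S.1 T.1 h1) (u : @hom k A S.2 T.2 h2) :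
  hcast eX eY (env_hom e (env_res e (hcast (esym eX) (esym eY) (env_pure eh f u)))) =
  if (n%:Z %| h1.2 - (X.1.2 : nat)%:Z + (Y.1.2 : nat)%:Z)%Z then env_pure eh f u else 0.
Proof. by case: S / eX f u; case: T / eY => f u; apply: env_resK. Qed.

Lemma env_hcast_lin X Y S T (eX : env_ob X = S) (eY : env_ob Y = T) g G
    (e : wdeg n (env_wt X - env_wt Y) g = G) :
  linear (fun m : hom S T G =>
    hcast eX eY (env_hom e (env_res e (hcast (esym eX) (esym eY) m)))).
Proof.
exact: (lin_comp (hcast_lin _ _) (lin_comp (env_hom_lin e)
  (lin_comp (env_res_lin e) (hcast_lin _ _)))).
Qed.

Lemma env_sum_target X T (Z : 'I_n -> E') (eZ : forall c, env_ob (Z c) = T)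
    (g : 'I_n -> deg) G (e : forall c, wdeg n (env_wt X - env_wt (Z c)) (g c) = G)
    (m : hom (env_ob X) T G) : (forall c, env_idx (Z c) = c) ->
  \sum_c hcast erefl (eZ c) (env_hom (e c) (env_res (e c) (hcast erefl (esym (eZ c)) m))) = m.
Proof.
move=> iZ; move: m; apply: env_pure_ext => //.
  exact: (lin_sum _ _ (fun c => env_hcast_lin erefl (eZ c) (e c))).
move=> h1 h2 eh f u; rewrite -[RHS](sum_residue (h1.2 - (X.1.2 : nat)%:Z) _ X.1.2).
apply: eq_bigr => c _; rewrite -[in RHS](iZ c); exact: (env_hcast_res erefl).
Qed.

Lemma env_sum_source Y S (Z : 'I_n -> E') (eZ : forall c, env_ob (Z c) = S)
    (g : 'I_n -> deg) G (e : forall c, wdeg n (env_wt (Z c) - env_wt Y) (g c) = G)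
    (m : hom S (env_ob Y) G) : (forall c, env_idx (Z c) = c) ->
  \sum_c hcast (eZ c) erefl (env_hom (e c) (env_res (e c) (hcast (esym (eZ c)) erefl m))) = m.
Proof.
move=> iZ; move: m; apply: env_pure_ext => //.
  exact: (lin_sum _ _ (fun c => env_hcast_lin (eZ c) erefl (e c))).
(* The summation index is now that of the source and enters the divisibility condition negatively;
   negating the whole condition brings it to the form of [sum_residue]. *)
move=> h1 h2 eh f u; rewrite -[RHS](sum_residue (- (h1.2 + (Y.1.2 : nat)%:Z)) _ Y.1.2).
apply: eq_bigr => c _; rewrite -[X in _ + (nat_of_ord X)%:Z](iZ c) addrC -opprB rpredN.
rewrite addrAC; exact: (env_hcast_res (eZ c) erefl).
Qed.

Definition env_cover : adams_cover n E' E :=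
  @Cover k n E' E env_ob env_wt env_idx env_deg env_degE env_hom env_res
    env_hom_lin env_res_lin env_hom_id env_hom_comp env_hom_dif env_homK
    env_res_hom_target env_res_hom_source env_sum_target env_sum_source
    env_fiber_inj env_fiber_ex.

(** Exchanging the tensor factors negates weights, and passing to the opposite category exchanges
    source and target; the two sign changes cancel, so the bidegrees match. *)
Lemma env_hom_swap X Y g G (e : wdeg n (env_wt X - env_wt Y) g = G)
    (e' : wdeg n (env_wt (Y.2, Y.1) - env_wt (X.2, X.1)) g = G) (t : hom X Y g) :
  @env_hom (Y.2, Y.1) (X.2, X.1) g G e' (fhom (env_swap B) t)
    = fhom (env_swap A) (env_hom e t).
Proof.
move: t; apply: env_pure_ext.
- exact: (lin_comp (env_hom_lin e') (@fhom_lin _ _ _ (env_swap B) X Y g)).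
- exact: (lin_comp (@fhom_lin _ _ _ (env_swap A) (env_ob X) (env_ob Y) G) (env_hom_lin e)).
move=> a1 a2 ea f u; have ea' : a2 + a1 = g by rewrite addrC.
rewrite (env_pure_swap ea ea') (linpZ (env_hom_lin e')).
rewrite (env_homE e' ea' (env_pure_deg e' ea')) (env_homE e ea (env_pure_deg e ea)).
exact/esym/(@env_pure_swap k A (env_ob X) (env_ob Y)).
Qed.

(** The two modules have convertible carriers, so the map is the identity, and only the actions and
    differentials remain to be compared. *)
Definition pullback_diagonal : dgmap (pullback env_cover (diagonal A)) (diagonal B).
Proof.
refine (@Dgmap k E' (pullback env_cover (diagonal A)) (diagonal B) (fun X g m => m) _ _ _).
- by [].
- move=> X Y g h l e m; apply: env_pure_ext.
  + exact: (@act_linr _ _ (pullback env_cover (diagonal A)) X Y g h l e m).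
  + exact: (@act_linr _ _ (diagonal B) X Y g h l e m).
  move=> a1 a2 ea f u.
  have E1 := env_homE erefl ea (env_pure_deg erefl ea) f u.
  transitivity (@act k E (diagonal A) (env_ob X) (env_ob Y) (env_deg Y g) _ (env_deg X l)
    (cdegD env_cover X Y e) m (env_hom erefl (env_pure ea f u))); first by [].
  have p1 : a1 + (g + a2) = l by rewrite addrCA ea.
  have p2 : env_deg Y g + vdeg Y.2.2 X.2.2 a2 = vdeg Y.1.2 X.2.2 (g + a2) by exact: vdegD.
  have p3 : vdeg X.1.2 Y.1.2 a1 + vdeg Y.1.2 X.2.2 (g + a2) = env_deg X l by exact: vdegD.
  rewrite E1 (@env_pure_act k A (env_ob X) (env_ob Y) _ _ _ _ m _ _ _ f u _ p2 p3).
  rewrite (@env_pure_act k B X Y _ _ _ e m _ _ ea f u _ erefl p1) /=.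
  rewrite (deg_irr p2 (vdegD Y.2.2 Y.1.2 X.2.2 erefl)).
  by rewrite (deg_irr p3 (vdegD Y.1.2 X.1.2 X.2.2 p1)).
- move=> X g g' e m /=.
  by rewrite (deg_irr (cdeg_delta env_cover X e) (vdeg_delta X.1.2 X.2.2 e)).
Defined.

End EnvCover.

(** * Pullback of the bimodule dual and of the Calabi-Yau isomorphism *)

Section Final.
Variables (k : fieldType) (n : nat) (A : adgcat k).
Let B := quasi_veronese n A.
Let C := env_cover n A.
Variable P : dgmod (envcat A).

Lemma env_dual_deg (X : envcat B) g :
  wdeg n (- cwt C ((X.2, X.1) : envcat B)) g = cdeg C X g.
Proof. by rewrite cdegE /= /env_wt /=; wdegs. Qed.

(** The bimodule dual at X consists of maps into the representable at the swapped object, so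
    [pullback_hom] is taken at [(X.2, X.1)]. Linearity is [rh_compl], since the dual is acted on by
    postcomposition, and compatibility with differentials is [rh_dif]. *)
Definition dual_pullback : dgmap (pullback C (bimod_dual P)) (bimod_dual (pullback C P)).
Proof.
refine (@Dgmap k (envcat B) (pullback C (bimod_dual P)) (bimod_dual (pullback C P))
  (fun X g f => @pullback_hom k n (envcat B) (envcat A) C P (X.2, X.1) g _
    (env_dual_deg X g) f) _ _ _).
- move=> X g a u v; apply: dghomP => Y i j e m.
  exact: (@rh_lin _ _ _ _ C Y (X.2, X.1) _ _ (erefl _) (erefl _) _ _ erefl a).
- move=> X Y g h l e f u; apply: dghomP => Z i j ei m.
  pose x' : envcat B := (X.2, X.1); pose y' : envcat B := (Y.2, Y.1).
  have ep : wdeg n (cwt C y' - cwt C x') h = wdeg n (cwt C X - cwt C Y) h.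
    by rewrite /= /env_wt /=; wdegs.
  pose H := wdeg n (cwt C X - cwt C Y) h.
  (* [ub] and [ua] are the morphisms by which u acts on the two duals; [uE] identifies the second
     with the image of the first, which is the form that [rh_compl] requires. *)
  pose ub : @hom k (envcat B) y' x' h := fhom (env_swap B) u.
  pose ua : @hom k (envcat A) (C y') (C x') H :=
    fhom (env_swap A) (chom (a := C) (X := X) (Y := Y) erefl u).
  have uE : ua = fh (erefl (C y')) (erefl (C x')) ep ub by exact/esym/env_hom_swap.
  have ej := dual_deg1 (env_dual_deg Y g) Z (erefl (g + i)).
  have pB : h + (g + i) = j by rewrite addrA (addrC h) e.
  have pA : H + wdeg n (cwt C Z - cwt C y') (g + i) = wdeg n (cwt C Z - cwt C x') j.
    by rewrite /H -ep; wdegs pB.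
  transitivity (rh (erefl (C Z)) (erefl (C x')) erefl
    (ksg (H.1 * (cdeg C Y g).1) *: comp pA ua (hfun f ej m))).
    congr (rh _ _ _ _).
    exact: (@dactE k (envcat A) P (C x') (C y') (cdeg C Y g) H (cdeg C X l)
      (cdegD C X Y e) f ua (C Z) (cdeg C Z i) _
      (dual_deg1 (env_dual_deg X l) Z ei) m _ ej pA).
  rewrite (linpZ (rh_lin _ _ _)).
  transitivity (ksg (h.1 * g.1) *: comp pB ub
      (hfun (pullback_hom (env_dual_deg Y g) f) (erefl (g + i)) m)).
    congr (_ *: _); rewrite uE /= (deg_irr ej (dual_deg1 (env_dual_deg Y g) Z (erefl (g + i)))).
    exact: (@rh_compl _ _ _ _ C Z y' x' _ _ _ (erefl (C Z)) (erefl (C y')) (erefl (C x'))).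
  by symmetry; exact: dactE.
- move=> X g g' e f; apply: dghomP => Y i j ei m.
  pose x' : envcat B := (X.2, X.1).
  have p1 : g + i + delta = j by degs.
  have p2 : g + (i + delta) = j by degs.
  have q1 : wdeg n (cwt C Y - cwt C x') (g + i) + delta = wdeg n (cwt C Y - cwt C x') j.
    by wdegs p1.
  transitivity (rh (erefl (C Y)) (erefl (C x')) erefl
    (dif q1 (hfun f (dual_deg1 (env_dual_deg X g) Y (erefl (g + i))) m)
     - ksg (cdeg C X g).1 *: hfun f (dual_deg1 (env_dual_deg X g) Y p2)
         (mdif (cdeg_delta C Y (erefl (i + delta))) m))).
    congr (rh _ _ _ _).
    exact: (@hdifE k (envcat A) P _ _ _ (cdeg_delta C X e) f (C Y) (cdeg C Y i) _
      (dual_deg1 (env_dual_deg X g') Y ei) m).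
  rewrite (linpD (rh_lin _ _ _)) (linpN (rh_lin _ _ _)) (linpZ (rh_lin _ _ _)).
  transitivity (dif p1 (hfun (pullback_hom (env_dual_deg X g) f) (erefl (g + i)) m)
    - ksg g.1 *: hfun (pullback_hom (env_dual_deg X g) f) p2
        (mdif (d := pullback C P) (erefl (i + delta)) m)).
    congr (_ - _); exact: rh_dif.
  symmetry; exact: (@hdifE k (envcat B) (pullback C P) _ _ _ e
    (pullback_hom (env_dual_deg X g) f) Y i j ei m).
Defined.

Lemma bij_dual_pullback : bij_dgmap dual_pullback.
Proof.
move=> X g; exact: (Bijective (pullback_homK (env_dual_deg X g))
  (pullback_hom_invK (env_dual_deg X g))).
Qed.

Lemma bij_pullback_diagonal : bij_dgmap (pullback_diagonal n A).
Proof. by move=> X g; exists id. Qed.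

End Final.

(** Pullback carries perfection, the resolution, its dual and the Calabi-Yau isomorphism from A to
    B, while Adams shifts are divided by n and cohomological shifts kept. *)
Theorem quasi_veronese_calabi_yau (k : fieldType) (n : nat) (A : adgcat k) (d b : int) :
  calabi_yau A d (n%:Z * b) -> calabi_yau (quasi_veronese n A) d b.
Proof.
case=> smA [P [[kP [q qiso]] iso]]; pose C := env_cover n A; split.
  apply: perfect_derived_iso (pullback_perfect C smA).
  exact: bij_derived_iso (@bij_pullback_diagonal k n A).
exists (pullback C P); split.
  split; first exact: pullback_kprojective.
  exists (dgcomp (pullback_diagonal n A) (pullback_map C q)).
  apply: quasi_iso_comp; last exact: pullback_quasi_iso.
  exact/bij_quasi_iso/bij_pullback_diagonal.
(* Both shifts are put in the form [wdeg n 0 s] that [pullback_shift] accepts; the second is where n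
   b becomes b. *)
have sd : (d, 0) = wdeg n 0 (d, 0) by wdegs.
have sb : (0, n%:Z * b) = wdeg n 0 (0, b) by wdegs.
rewrite sd sb in iso.
have dual_iso := bij_derived_iso (bij_dgshift (d, 0) (@bij_dual_pullback k n A P)).
have diag_iso := bij_derived_iso (bij_dgshift (0, b) (@bij_pullback_diagonal k n A)).
have shift_iso M s := bij_derived_iso (@bij_pullback_shift k n _ _ C M s).
apply: derived_iso_trans (derived_iso_sym dual_iso) _.
apply: derived_iso_trans (shift_iso _ _) _.
apply: derived_iso_trans (pullback_derived_iso C iso) _.
exact: derived_iso_trans (derived_iso_sym (shift_iso _ _)) diag_iso.
Qed.

Theorem corollary6p8 (k : fieldType) (a : nat) (d : int) (Pi : adgcat k)
    (a_ge1 : (1 <= a)%N)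
    (Pi_pos : adams_positive Pi)
    (Pi_cy : calabi_yau Pi (d + 1) a%:Z)
    (Pi0_perfect : zero_part_perfect Pi_pos) :
  calabi_yau (quasi_veronese a Pi) (d + 1) 1.
Proof. by apply: quasi_veronese_calabi_yau; rewrite mulr1. Qed.
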